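(* Let $\Omega\subset\mathbb{R}^n$ be a bounded open set with Lipschitz boundary and let $f:\mathbb{R}^n\to\mathbb{R}$ be a continuous function such that $f(\xi)\ge\gamma(|\xi|)$ for all $\xi\in\mathbb{R}^n$, where $\gamma:\mathbb{R}^+\to\mathbb{R}^+$ is a continuous increasing function with $\lim_{t\to+\infty}\gamma(t)=+\infty$. Let $u_0\in W^{1,\infty}(\Omega)$ and consider $$(P)\quad \inf\Big\{\operatorname*{ess\,sup}_{x\in\Omega}f(\nabla u(x)):\ u\in u_0+W^{1,\infty}_0(\Omega)\Big\},\qquad (P^{\rm lc})\quad \inf\Big\{\operatorname*{ess\,sup}_{x\in\Omega}f^{\rm lslc}(\nabla u(x)):\ u\in u_0+W^{1,\infty}_0(\Omega)\Big\}.$$ Then $\inf(P)=\inf(P^{\rm lc})$. Moreover, if the boundary condition is affine, $u_0=u_{\xi_0}$ for some $\xi_0\in\mathbb{R}^n$, then $\inf(P)=f^{\rm lslc}(\xi_0)$.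
   Context: Notation and definitions. $\mathbb{R}^+=[0,+\infty)$. Functions $u$ are scalar valued. $W^{1,\infty}_0(\Omega)$ is the closure of $C_0^\infty(\Omega)$ in $W^{1,1}(\Omega)$ intersected with $W^{1,\infty}(\Omega)$. A function $g:\mathbb{R}^n\to[-\infty,+\infty]$ is level convex if its sublevel sets $L_c(g)=\{\xi: g(\xi)\le c\}$ are convex for every $c\in\mathbb{R}$, and lower semicontinuous if they are all closed. The lower semicontinuous level convex envelope of $f$ is $$f^{\rm lslc}(\xi)=\sup\{g(\xi):\ g:\mathbb{R}^n\to[-\infty,+\infty],\ g\text{ lower semicontinuous and level convex},\ g\le f\}.$$ For $\xi_0\in\mathbb{R}^n$, $u_{\xi_0}$ denotes an affine function $u_{\xi_0}(x)=\langle\xi_0,x\rangle+c$ for some $c\in\mathbb{R}$. *)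

(* Defs.v *)
From HB Require Import structures.
From mathcomp Require Import all_boot all_order all_algebra.
From mathcomp Require Import all_classical all_reals all_analysis.
From mathcomp Require Import ess_sup_inf.

Set Implicit Arguments.
Unset Strict Implicit.
Unset Printing Implicit Defensive.

Import Order.TTheory GRing.Theory Num.Theory.
Import numFieldNormedType.Exports.

Local Open Scope classical_set_scope.
Local Open Scope ring_scope.

Fact measure_rV_display : measure_display.
Proof. exact: default_measure_display. Qed.

(* The sigma-algebra on R^n is the product one, generated by the coordinate
   projections (as for n.-tuple T in the library); it is the Borel one. *)
Section measurable_rV.
Context (R : realType) (n : nat).

Let coord (i : 'I_n) (v : 'rV[R]_n) : R := v ord0 i.

Let rV_set0 : g_sigma_preimage coord set0.
Proof. exact: sigma_algebra0. Qed.

Let rV_setC A : g_sigma_preimage coord A -> g_sigma_preimage coord (~` A).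
Proof. exact: sigma_algebraC. Qed.

Let rV_bigcup (F : (set 'rV[R]_n)^nat) :
  (forall i, g_sigma_preimage coord (F i)) ->
  g_sigma_preimage coord (\bigcup_i (F i)).
Proof. exact: sigma_algebra_bigcup. Qed.

HB.instance Definition _ := @isMeasurable.Build measure_rV_display
  'rV[R]_n (g_sigma_preimage coord) rV_set0 rV_setC rV_bigcup.

Lemma measurable_rV_coord (i : 'I_n) :
  measurable_fun [set: 'rV[R]_n] (fun v : 'rV[R]_n => v ord0 i).
Proof.
move=> _ Y mY; rewrite setTI; apply: sub_sigma_algebra => /=.
rewrite -bigcup_seq/=; exists i => /=; first by rewrite mem_index_enum.
by exists Y => //; rewrite setTI.
Qed.

End measurable_rV.

Lemma measurable_fun_rVP d (T : measurableType d) (R : realType) n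
    (f : T -> 'rV[R]_n) :
  (forall i, measurable_fun [set: T] (fun t => f t ord0 i)) ->
  measurable_fun [set: T] f.
Proof.
move=> mf _ A mA; rewrite setTI.
suff: g_sigma_preimage (fun (i : 'I_n) (v : 'rV[R]_n) => v ord0 i) `<=`
    [set B | measurable (f @^-1` B)] by exact.
apply: smallest_sub => /=.
  split => /=; first by rewrite preimage_set0.
  - by move=> B mB; rewrite setTD preimage_setC; exact: measurableC.
  - by move=> F mF; rewrite preimage_bigcup; exact: bigcup_measurable.
rewrite -bigcup_seq; apply: bigcup_sub => i _ B [C mC <-] /=.
rewrite setTI; have := mf i measurableT _ mC.
by rewrite setTI.
Qed.

Section lebesgue_rV.
Context (R : realType).

Definition rV_cons n (p : measurableTypeR R * 'rV[R]_n) : 'rV[R]_n.+1 :=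
  \row_i (if unlift ord0 i is Some j then p.2 ord0 j else p.1).

Definition rV_uncons n (v : 'rV[R]_n.+1) : measurableTypeR R * 'rV[R]_n :=
  (v ord0 ord0, \row_j v ord0 (lift ord0 j)).

Lemma rV_consK n : cancel (@rV_cons n) (@rV_uncons n).
Proof.
case=> a v; congr pair; first by rewrite /rV_cons mxE unlift_none.
by apply/rowP => j; rewrite /rV_cons !mxE liftK.
Qed.

Lemma measurable_rV_cons n : measurable_fun [set: _] (@rV_cons n).
Proof.
apply: measurable_fun_rVP => i; case: (unliftP ord0 i) => [j|] ->.
  rewrite (_ : (fun _ => _) = (fun v : 'rV[R]_n => v ord0 j) \o snd).
    by apply: measurableT_comp; [exact: measurable_rV_coord|].
  by apply/funext => p; rewrite /rV_cons mxE liftK.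
rewrite (_ : (fun _ => _) = fst); first exact: measurable_fst.
by apply/funext => p; rewrite /rV_cons mxE unlift_none.
Qed.

Lemma measurable_rV_uncons n : measurable_fun [set: _] (@rV_uncons n).
Proof.
apply/measurable_fun_pairP; split; first exact: measurable_rV_coord.
apply: measurable_fun_rVP => j.
rewrite (_ : (fun _ => _) = fun v : 'rV[R]_n.+1 => v ord0 (lift ord0 j)).
  exact: measurable_rV_coord.
by apply/funext => v; rewrite /= mxE.
Qed.

Section lebesgue_rVS.
Local Open Scope ereal_scope.
Context (n : nat) (mu : {sigma_finite_measure set 'rV[R]_n -> \bar R}).

Definition lebesgue_rVS := pushforward (lebesgue_measure \x mu) (@rV_cons n).

Let lebesgue_rVS_prod (A : set 'rV[R]_n.+1) :
  lebesgue_rVS A = (lebesgue_measure \x mu) (@rV_cons n @^-1` A).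
Proof. by []. Qed.

Let lebesgue_rVS0 : lebesgue_rVS set0 = 0.
Proof. by rewrite lebesgue_rVS_prod preimage_set0 measure0. Qed.

Let lebesgue_rVS_ge0 A : 0 <= lebesgue_rVS A.
Proof. by rewrite lebesgue_rVS_prod; exact: measure_ge0. Qed.

Let lebesgue_rVS_sigma_additive : semi_sigma_additive lebesgue_rVS.
Proof.
move=> F mF tF mUF; apply: measure_semi_sigma_additive => //.
exact: measurable_rV_cons.
Qed.

HB.instance Definition _ := isMeasure.Build _ _ _ lebesgue_rVS
  lebesgue_rVS0 lebesgue_rVS_ge0 lebesgue_rVS_sigma_additive.

Let lebesgue_rVS_sigma_finite : sigma_finite [set: 'rV[R]_n.+1] lebesgue_rVS.
Proof.
have /sigma_finiteP[F [FT ndF Foo]] := sigma_finiteT (@lebesgue_measure R).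
have /sigma_finiteP[G [GT ndG Goo]] := sigma_finiteT mu.
exists (fun k => @rV_uncons n @^-1` (F k `*` G k)).
  apply/esym/seteqP; split=> // v _.
  have [k _ Fk] : (\bigcup_k F k) (rV_uncons v).1 by rewrite -FT.
  have [l _ Gl] : (\bigcup_k G k) (rV_uncons v).2 by rewrite -GT.
  exists (maxn k l) => //; split.
  - by move: Fk; exact/subsetPset/ndF/leq_maxl.
  - by move: Gl; exact/subsetPset/ndG/leq_maxr.
move=> k; have [mFk Fkoo] := Foo k; have [mGk Gkoo] := Goo k; split.
  rewrite -[X in measurable X]setTI; apply: measurable_rV_uncons => //.
  exact: measurableX.
rewrite lebesgue_rVS_prod -comp_preimage (_ : _ \o _ = id).
  by rewrite preimage_id product_measure1E// lte_mul_pinfty// ge0_fin_numE.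
by apply/funext => p /=; rewrite rV_consK.
Qed.

HB.instance Definition _ := Measure_isSigmaFinite.Build _ _ _ lebesgue_rVS
  lebesgue_rVS_sigma_finite.

End lebesgue_rVS.

Fixpoint lebesgue_rV n : {sigma_finite_measure set 'rV[R]_n -> \bar R} :=
  if n is m.+1 then lebesgue_rVS (lebesgue_rV m) else \d_(0 : 'rV[R]_0).

Lemma lebesgue_rV_box n (a b : 'rV[R]_n) :
  (forall i, a ord0 i <= b ord0 i) ->
  lebesgue_rV n [set v | forall i, a ord0 i < v ord0 i <= b ord0 i] =
  (\prod_i (b ord0 i - a ord0 i))%:E.
Proof.
elim: n a b => [|n IH] a b ab.
  rewrite /= diracE mem_set ?big_ord0//.
  by case.
pose a' : 'rV[R]_n := \row_j a ord0 (lift ord0 j).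
pose b' : 'rV[R]_n := \row_j b ord0 (lift ord0 j).
pose J : set (measurableTypeR R) := `]a ord0 ord0, b ord0 ord0]%classic.
pose B := [set v : 'rV[R]_n | forall i, a' ord0 i < v ord0 i <= b' ord0 i].
have mB : measurable B.
  rewrite (_ : B = \bigcap_(i in [set: 'I_n])
      ((fun v : 'rV[R]_n => v ord0 i) @^-1` `]a' ord0 i, b' ord0 i])); last first.
    apply/seteqP; split => v /= Bv i; first by move=> _ /=; rewrite in_itv; exact: Bv.
    by have := Bv i Logic.I; rewrite /= in_itv.
  apply: fin_bigcap_measurable => // i _.
  by rewrite -[X in measurable X]setTI; exact: measurable_rV_coord.
rewrite (_ : lebesgue_rV n.+1 _ = (lebesgue_measure \x lebesgue_rV n)%E (J `*` B)).
  rewrite product_measure1E//; last exact: measurable_itv.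
  rewrite /B IH; last by move=> i; rewrite !mxE.
  rewrite big_ord_recl EFinM; congr (_ * _)%E.
    rewrite [LHS](lebesgue_measure_itv `]a ord0 ord0, b ord0 ord0])/= lte_fin -EFinB; case: ltP => // ba.
    by congr (_%:E); apply/esym/eqP; rewrite subr_eq0 eq_le ba ab.
  congr (_%:E).
  by apply: eq_bigr => i _; rewrite !mxE.
rewrite /= /lebesgue_rVS /pushforward; congr product_measure1.
apply/seteqP; split => [[x v] /= h|[x v] /= [Jx Bv] i].
  split; first by have := h ord0; rewrite /rV_cons mxE unlift_none /J /= in_itv.
  by move=> i; have := h (lift ord0 i); rewrite /rV_cons !mxE liftK.
rewrite /rV_cons mxE; case: (unliftP ord0 i) => [j|] ->.
  by have := Bv j; rewrite !mxE.
by move: Jx; rewrite /J /= in_itv.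
Qed.

End lebesgue_rV.

Section calculus.
Context {R : realType} {n : nat}.
Implicit Types (u v : 'rV[R]_n) (phi : 'rV[R]_n -> R).

Definition dotv u v : R := \sum_i u ord0 i * v ord0 i.

(* The library norm on 'rV[R]_n is the sup norm. *)
Definition enorm u : R := Num.sqrt (dotv u u).

Definition partial (i : 'I_n) phi : 'rV[R]_n -> R :=
  fun x => 'D_(delta_mx ord0 i) phi x.

Definition gradient phi : 'rV[R]_n -> 'rV[R]_n := fun x => \row_i partial i phi x.

Fixpoint Ck (k : nat) phi : Prop :=
  continuous phi /\
  if k is k'.+1 then
    forall i, (forall x, derivable phi x (delta_mx ord0 i)) /\
              Ck k' (partial i phi)
  else True.

Definition smooth phi := forall k, Ck k phi.

Definition closed_support phi : set 'rV[R]_n := closure [set x | phi x != 0].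

Definition test_function (Omega : set 'rV[R]_n) phi :=
  [/\ smooth phi, compact (closed_support phi) &
      closed_support phi `<=` Omega].

End calculus.

(* Omega is, near each of its boundary points and up to an isometry Q, the set
   of points whose first coordinate lies above a Lipschitz function of the n
   other ones. *)
Definition lipschitz_boundary (R : realType) (n : nat)
    (Omega : set 'rV[R]_n.+1) :=
  forall x, (closure Omega `\` Omega°) x ->
  exists (U : set 'rV[R]_n.+1) (Q : 'M[R]_n.+1) (psi : 'rV[R]_n -> R) (L : R),
    [/\ open U /\ U x, Q *m Q^T = 1%:M,
        forall y z, `|psi y - psi z| <= L * enorm (y - z) &
        forall y, U y -> (Omega y <->
          psi (col' ord0 (y *m Q)) < (y *m Q) ord0 ord0)].

Section sobolev.
Context {R : realType} {n : nat} (Omega : set 'rV[R]_n).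
Local Notation mu := (lebesgue_rV R n).
Implicit Types (u : 'rV[R]_n -> R) (g : 'rV[R]_n -> 'rV[R]_n).

(* Essential supremum over Omega: h is extended by -oo, neutral for sup. *)
Definition ess_sup_on (h : 'rV[R]_n -> \bar R) : \bar R :=
  ess_sup mu (fun x => if x \in Omega then h x else -oo%E).

Definition loc_integrable u :=
  measurable_fun Omega u /\
  forall K, compact K -> K `<=` Omega -> mu.-integrable K (EFin \o u).

Definition ess_bounded u :=
  measurable_fun Omega u /\ (ess_sup_on (fun x => `|u x|%:E) < +oo)%E.

Definition weak_gradient u g :=
  [/\ loc_integrable u,
      forall i, loc_integrable (fun x => g x ord0 i) &
      forall phi i, test_function Omega phi ->
        (\int[mu]_(x in Omega) (u x * partial i phi x)%:E =
         - \int[mu]_(x in Omega) (g x ord0 i * phi x)%:E)%E].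

Definition W1oo u :=
  ess_bounded u /\
  exists g, weak_gradient u g /\ forall i, ess_bounded (fun x => g x ord0 i).

(* Closure of the test functions for the norm of W^{1,1}(Omega). *)
Definition W11_0 u :=
  exists g,
    [/\ weak_gradient u g,
        mu.-integrable Omega (EFin \o u),
        forall i, mu.-integrable Omega (fun x => (g x ord0 i)%:E) &
        forall eps : R, 0 < eps -> exists phi, test_function Omega phi /\
          (\int[mu]_(x in Omega) `|u x - phi x|%:E +
           \int[mu]_(x in Omega) (enorm (g x - gradient phi x))%:E < eps%:E)%E].

Definition W1oo_0 u := W11_0 u /\ W1oo u.

(* The weak gradient is unique up to null sets, so that g stands for Du. *)
Definition inf_sup_problem (F : 'rV[R]_n -> \bar R) u0 : \bar R :=
  ereal_inf [set y | exists u g,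
    [/\ W1oo_0 (fun x => u x - u0 x), weak_gradient u g &
        y = ess_sup_on (F \o g)]].

End sobolev.

Section level_convexity.
Context {R : realType} {n : nat}.
Implicit Types (g : 'rV[R]_n -> \bar R) (f : 'rV[R]_n -> R).

Definition sublevel g (c : R) : set 'rV[R]_n := [set xi | (g xi <= c%:E)%E].

Definition level_convex g := forall c, convex_set (sublevel g c).

Definition lsc g := forall c, closed (sublevel g c).

Definition lslc_envelope f (xi : 'rV[R]_n) : \bar R :=
  ereal_sup [set y | exists g,
    [/\ lsc g, level_convex g, forall eta, (g eta <= (f eta)%:E)%E & y = g xi]].

End level_convexity.

(* Main.v *)
Require Import Defs.
From mathcomp Require Import all_boot all_order all_algebra.
From mathcomp Require Import all_classical all_reals all_analysis.
From mathcomp Require Import ess_sup_inf measurable_realfun.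
From mathcomp Require Import ring lra.

Set Implicit Arguments.
Unset Strict Implicit.
Unset Printing Implicit Defensive.

Import Order.TTheory GRing.Theory Num.Theory.
Import numFieldNormedType.Exports.

Local Open Scope classical_set_scope.
Local Open Scope ring_scope.

(** Since [lslc_envelope f <= f], the infimum of the relaxed problem is at most the
    other one. For the converse, let [u] be admissible with
    [lslc_envelope f (Du) <= m] almost everywhere, and let [m < c < c'].

    - The sublevel set of [f] at [c] is compact by coercivity, and [f] is uniformly
      continuous near it. Hence there is a finite set [E] of slopes with [f <= c']
      on [E] whose convex hull contains that sublevel set well inside
      ([sublevel_hull_dir]), and therefore also almost all the values of [Du]
      ([lslc_hull_dir]).
    - Let [H] be the support function of [E]. By mollification, [u] has a
      representative [V] such that [V x - V y <= H (x - y) - delta * |x - y|] along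
      the segments inside [Omega] ([lipschitz_representative]).
    - The cone [V y - r + H (x - y)] with vertex at [y] lies below [V] near [y] and,
      thanks to [delta], above [V] as soon as [|x - y|] exceeds [r / delta]. The
      lower envelope [w] of such cones, with vertices in finer and finer nets as one
      approaches the boundary, is therefore locally a minimum of finitely many affine
      functions with slopes in [E]: it is locally affine outside countably many
      hyperplanes ([perturbation_exists]). As the depths [r] may decrease as fast as
      desired towards the boundary, cutting off [w - u] near the boundary changes it
      little, with its gradient, in [L^1]; so [w - u] belongs to [W11_0]
      ([W11_0_boundary_decay]).

    Then [w] is admissible, with [f (Dw) <= c'] almost everywhere
    ([relaxed_competitor]), and [c'] is arbitrarily close to [m].

    For affine data of slope [xi0], the datum itself is a competitor of the relaxed
    problem with value [lslc_envelope f xi0]. Conversely, if [u] is admissible then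
    [Du - xi0] has mean zero, in the approximate sense of [W11_0_mean_zero]; so [xi0]
    lies in every closed convex set that contains almost all the values of [Du]
    ([W11_0_convex_mean]), for instance in the sublevel sets of the envelope.

    Most integrals are those of bounded measurable functions with bounded support on
    the whole space; the general ones in the definition of the Sobolev spaces reduce
    to them because the functions involved are essentially bounded. *)

(** * Measure and topology of R^n *)

Section continuous_algebra.
Context {R : realType} {T : topologicalType}.
Implicit Types f g : T -> R.

Lemma continuous_add f g : continuous f -> continuous g ->
  continuous (fun x => f x + g x).
Proof. by move=> cf cg x; apply: cvgD; [exact: cf|exact: cg]. Qed.

Lemma continuous_opp f : continuous f -> continuous (fun x => - f x).
Proof. by move=> cf x; apply: cvgN; exact: cf. Qed.

Lemma continuous_mul f g : continuous f -> continuous g ->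
  continuous (fun x => f x * g x).
Proof. by move=> cf cg x; apply: cvgM; [exact: cf|exact: cg]. Qed.

Lemma continuous_sum (I : Type) (s : seq I) (F : I -> T -> R) :
  (forall i, continuous (F i)) -> continuous (fun x => \sum_(i <- s) F i x).
Proof.
move=> cF; elim: s => [|i s IH].
  rewrite (_ : (fun _ => _) = cst 0); first exact: cst_continuous.
  by apply/funext => y; rewrite big_nil.
rewrite (_ : (fun _ => _) = (fun y => F i y + \sum_(j <- s) F j y)).
  by apply: continuous_add.
by apply/funext => y; rewrite big_cons.
Qed.

Lemma open_superlevel (A : set T) f r : open A -> {in A, continuous f} ->
  open (A `&` f @^-1` [set y | r < y]).
Proof.
rewrite !openE => oA cf x [Ax /= rx].
have hx : {for x, continuous f} by apply: cf; rewrite inE.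
by apply: filterI; [exact: oA|exact: (cvgr_gt _ hx _ rx)].
Qed.

End continuous_algebra.

Section rV_norm.
Context {R : realType} {n : nat}.
Implicit Types (x y z : 'rV[R]_n) (r : R).

Lemma rV_norm_ltP x r : 0 < r -> reflect (forall i, `|x ord0 i| < r) (`|x| < r).
Proof.
move=> r0; apply: (iffP idP) => [xr i|xr].
  have : ball (0 : 'rV[R]_n) r x by rewrite mx_norm_ball /ball_ /= sub0r normrN.
  case=> _ /(_ ord0 i).
  by rewrite -ball_normE /ball_ /= mxE sub0r normrN.
have : ball (0 : 'rV[R]_n) r x.
  split => // i j; rewrite (ord1 i) -ball_normE /ball_ /= mxE sub0r normrN.
  exact: xr.
by rewrite mx_norm_ball /ball_ /= sub0r normrN.
Qed.

Lemma rV_norm_coord x i : `|x ord0 i| <= `|x|.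
Proof.
rewrite leNgt; apply/negP => h.
have x0 : 0 < `|x ord0 i| by rewrite (le_lt_trans _ h).
by have /(_ i) := rV_norm_ltP x x0 h; rewrite ltxx.
Qed.

Lemma rV_norm_leP x r : 0 <= r -> (forall i, `|x ord0 i| <= r) -> `|x| <= r.
Proof.
move=> r0 xr; apply/ler_addgt0Pr => e e0; apply/ltW/rV_norm_ltP.
  by rewrite ltr_wpDl.
by move=> i; rewrite (le_lt_trans (xr i))// ltrDl.
Qed.

Lemma ball_rVE x y r : ball x r y = (`|y - x| < r).
Proof. by rewrite -ball_normE /ball_ /= distrC. Qed.

Lemma dotvC x y : dotv x y = dotv y x.
Proof. by apply: eq_bigr => i _; rewrite mulrC. Qed.

Lemma dotvDr x y z : dotv x (y + z) = dotv x y + dotv x z.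
Proof.
by rewrite /dotv -big_split /=; apply: eq_bigr => i _; rewrite mxE mulrDr.
Qed.

Lemma dotvZr r x y : dotv x (r *: y) = r * dotv x y.
Proof.
by rewrite /dotv mulr_sumr; apply: eq_bigr => i _; rewrite mxE mulrCA.
Qed.

Lemma dotvNr x y : dotv x (- y) = - dotv x y.
Proof. by rewrite -scaleN1r dotvZr mulN1r. Qed.

Lemma dotvBr x y z : dotv x (y - z) = dotv x y - dotv x z.
Proof. by rewrite dotvDr dotvNr. Qed.

Lemma dotvDl x y z : dotv (x + y) z = dotv x z + dotv y z.
Proof. by rewrite !(dotvC _ z) dotvDr. Qed.

Lemma dotvZl r x y : dotv (r *: x) y = r * dotv x y.
Proof. by rewrite !(dotvC _ y) dotvZr. Qed.

Lemma dotvBl x y z : dotv (x - y) z = dotv x z - dotv y z.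
Proof. by rewrite !(dotvC _ z) dotvBr. Qed.

Lemma dotv0r x : dotv x 0 = 0.
Proof. by apply: big1 => i _; rewrite mxE mulr0. Qed.

Lemma dotv_delta x i : dotv x (delta_mx ord0 i) = x ord0 i.
Proof.
rewrite /dotv (bigD1 i)//= mxE !eqxx mulr1 big1 ?addr0// => j ji.
by rewrite mxE (negbTE ji) andbF mulr0.
Qed.

Lemma dotv_ge0 x : 0 <= dotv x x.
Proof. by apply: sumr_ge0 => i _; rewrite -expr2 sqr_ge0. Qed.

Lemma dotv_gt0 x : x != 0 -> 0 < dotv x x.
Proof.
move=> x0; rewrite lt_neqAle dotv_ge0 andbT eq_sym; apply: contra x0 => /eqP x0.
apply/eqP/rowP => i; rewrite mxE; apply/eqP; rewrite -sqrf_eq0 expr2; apply/eqP.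
by apply: (psumr_eq0P _ x0) => // j _; rewrite -expr2 sqr_ge0.
Qed.

Lemma le_dotv x y : `|dotv x y| <= n%:R * `|x| * `|y|.
Proof.
apply: le_trans (ler_norm_sum _ _ _) _.
rewrite -mulrA; have -> : n%:R * (`|x| * `|y|) = \sum_(i < n) (`|x| * `|y|).
  by rewrite sumr_const card_ord mulr_natl.
by apply: ler_sum => i _; rewrite normrM ler_pM// rV_norm_coord.
Qed.

Lemma le_norm_enorm x : `|x| <= enorm x.
Proof.
apply: rV_norm_leP; first exact: sqrtr_ge0.
move=> i; rewrite -sqrtr_sqr ler_sqrt ?dotv_ge0//.
rewrite /dotv (bigD1 i)//= -expr2 lerDl.
by apply: sumr_ge0 => j _; rewrite -expr2 sqr_ge0.
Qed.

Lemma le_enorm_sum x : enorm x <= \sum_i `|x ord0 i|.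
Proof.
have s0 : 0 <= \sum_i `|x ord0 i| by apply: sumr_ge0.
rewrite -(ger0_norm s0) -sqrtr_sqr ler_sqrt ?sqr_ge0//.
rewrite expr2 mulr_suml /dotv; apply: ler_sum => i _.
rewrite -expr2 -real_normK ?num_real// expr2 ler_wpM2l//.
by rewrite (bigD1 i)//= lerDl sumr_ge0.
Qed.

Lemma dotv_continuous x : continuous (dotv x).
Proof.
apply: continuous_sum => i; apply: continuous_mul; first exact: cst_continuous.
exact: coord_continuous.
Qed.

Lemma norm_delta_mx i : `|delta_mx ord0 i : 'rV[R]_n| <= 1.
Proof.
apply: rV_norm_leP => // j; rewrite mxE eqxx /=.
by case: eqP => _; rewrite ?normr1 ?normr0.
Qed.

End rV_norm.

Section rV_measurable.
Context {R : realType}.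

Lemma measurable_ball_rV n (x : 'rV[R]_n) r : measurable (ball x r).
Proof.
have [r0|r0] := leP r 0.
  rewrite (_ : ball x r = set0) //; apply/seteqP; split => // y [].
  by rewrite ltNge r0.
rewrite (_ : ball x r = \bigcap_(i in [set: 'I_n])
    ((fun v : 'rV[R]_n => v ord0 i) @^-1` (ball (x ord0 i) r))).
  apply: fin_bigcap_measurable => // i _; rewrite -[X in measurable X]setTI.
  by apply: measurable_rV_coord => //; rewrite ball_itv; exact: measurable_itv.
apply/seteqP; split => [y [_ h] i _|y h]; first exact: h.
by split => // i j; rewrite (ord1 i); exact: h.
Qed.

(** Boxes with rational centres and rational radii form a countable base. *)
Lemma open_measurable_rV n (A : set 'rV[R]_n) : open A -> measurable A.
Proof.
move=> oA.
pose F (p : 'rV[rat]_n * nat) : set 'rV[R]_n :=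
  let B := ball (map_mx ratr p.1 : 'rV[R]_n) (p.2.+1%:R^-1) in
  if `[< B `<=` A >] then B else set0.
rewrite (_ : A = \bigcup_p F p).
  apply: countable_bigcupT_measurable; first exact: countableP.
  by move=> p; rewrite /F; case: ifP => // _; exact: measurable_ball_rV.
apply/seteqP; split => [x Ax|x [p _]]; last first.
  by rewrite /F; case: ifPn => // /asboolP; exact.
have /nbhs_ballP[e /= e0 eA] : nbhs x A by exact: open_nbhs_nbhs.
have [k] := ltr_add_invr (divr_gt0 e0 (ltr0n R 2)); rewrite add0r => ke.
have k0 : 0 < k.+1%:R^-1 :> R by rewrite invr_gt0.
have [d dE] : exists d : R, d = k.+1%:R^-1 by eexists.
rewrite -dE in ke k0.
have [q xq] : exists q : 'rV[rat]_n, forall i,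
    x ord0 i - d < ratr (q ord0 i) < x ord0 i + d.
  have /choice[q hq] : forall i, exists q : rat,
      x ord0 i - d < ratr q < x ord0 i + d.
    move=> i; have [|q] := @rat_in_itvoo R (x ord0 i - d) (x ord0 i + d).
      by lra.
    by rewrite inE /= => ?; exists q.
  by exists (\row_i q i) => i; rewrite mxE.
have xB : ball (map_mx ratr q : 'rV[R]_n) d x.
  rewrite ball_rVE; apply/rV_norm_ltP => // i; rewrite !mxE ltr_norml.
  by have := xq i; lra.
exists (q, k) => //; rewrite /F /= -dE; case: ifPn => // /asboolPn; case=> y /= qy.
apply: eA; apply: (@le_ball _ _ _ (d + d)); first by lra.
by apply: ball_triangle qy; exact: ball_sym.
Qed.

Lemma closed_measurable_rV n (A : set 'rV[R]_n) : closed A -> measurable A.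
Proof.
move=> cA; rewrite -(setCK A); apply: measurableC.
by apply: open_measurable_rV; exact: closed_openC.
Qed.

Lemma continuous_measurable_rV n (A : set 'rV[R]_n) (h : 'rV[R]_n -> R) :
  open A -> {in A, continuous h} -> measurable_fun A h.
Proof.
move=> oA ch; apply: (measurability _ (RGenOInfty.measurableE R)).
move=> _ [_ [r ->] <-]; apply: open_measurable_rV.
by rewrite set_itvoy; exact: open_superlevel.
Qed.

Lemma continuousT_measurable_rV n (h : 'rV[R]_n -> R) :
  continuous h -> measurable_fun setT h.
Proof. by move=> ch; apply: continuous_measurable_rV => //; exact: openT. Qed.

Lemma measurable_add_rV n : measurable_fun [set: 'rV[R]_n * 'rV[R]_n] (fun p => p.1 + p.2).
Proof.
apply: measurable_fun_rVP => i.
rewrite (_ : (fun _ => _) = (fun p : 'rV[R]_n * 'rV[R]_n => p.1 ord0 i + p.2 ord0 i)); last first.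
  by apply/funext => p; rewrite !mxE.
apply: measurable_funD.
  exact: (measurableT_comp (measurable_rV_coord i) measurable_fst).
exact: (measurableT_comp (measurable_rV_coord i) measurable_snd).
Qed.

Lemma measurable_shift_rV n (a : 'rV[R]_n) : measurable_fun setT (fun x : 'rV[R]_n => x + a).
Proof.
apply: measurable_fun_rVP => i.
rewrite (_ : (fun _ => _) = (fun p : 'rV[R]_n => p ord0 i + a ord0 i)); last first.
  by apply/funext => p; rewrite !mxE.
by apply: measurable_funD => //; exact: measurable_rV_coord.
Qed.

End rV_measurable.

Section rV_translation.
Context {R : realType}.
Local Notation mu n := (lebesgue_rV R n).

Lemma lebesgue_measure_shift (a : R) (A : set (measurableTypeR R)) : measurable A ->
  lebesgue_measure ((fun x => x + a) @^-1` A) = lebesgue_measure A.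
Proof.
move=> mA.
have ms : measurable_fun setT ((fun x => x + a) : measurableTypeR R -> measurableTypeR R).
  by apply: measurable_funD => //; exact: measurable_id.
have := @lebesgue_measure_unique R (pushforward (@lebesgue_measure R)
  (fun x : measurableTypeR R => x + a : measurableTypeR R)).
move=> /(_ ms) h; apply/esym/h => // _ [[b c] _ <-].
transitivity (lebesgue_measure (`]b - a, c - a]%classic : set (measurableTypeR R))).
  rewrite !lebesgue_measure_itv /= !lte_fin ltrD2r.
  by case: ifP => // _; rewrite -!EFinB; congr EFin; lra.
congr lebesgue_measure.
by apply/seteqP; split => x /=; rewrite !in_itv /= ltrBlDr lerBrDr.
Qed.

(** By induction on the dimension: the translated product measure agrees with the
    product measure on rectangles, hence everywhere. *)
Lemma lebesgue_rV_shift n (a : 'rV[R]_n) (A : set 'rV[R]_n) : measurable A ->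
  mu n ((fun x => x + a) @^-1` A) = mu n A.
Proof.
elim: n a A => [|n IH] a A mA.
  congr (mu 0 _); apply/seteqP.
  by split=> x /=; rewrite [a]thinmx0 addr0.
pose a' : 'rV[R]_n := \row_j a ord0 (lift ord0 j).
pose psi (p : measurableTypeR R * 'rV[R]_n) : measurableTypeR R * 'rV[R]_n :=
  (p.1 + a ord0 ord0, p.2 + a').
have mpsi : measurable_fun setT psi.
  apply/measurable_fun_pairP; split.
    by apply: measurable_funD => //; exact: measurable_fst.
  by apply: (measurableT_comp (measurable_shift_rV a')); exact: measurable_snd.
have mcA : measurable (@rV_cons R n @^-1` A).
  by rewrite -[X in measurable X]setTI; apply: measurable_rV_cons.
rewrite /= /lebesgue_rVS /pushforward -comp_preimage.
rewrite (_ : _ \o _ = (@rV_cons R n) \o psi); last first.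
  apply/funext => -[x v]; apply/rowP => i; rewrite /psi /rV_cons /= !mxE.
  by case: (unliftP ord0 i) => [j ->|->] //; rewrite !mxE.
rewrite comp_preimage.
have := @product_measure_unique _ _ _ _ R (@lebesgue_measure R) (mu n)
  (pushforward (lebesgue_measure \x mu n)%E psi).
move=> /(_ mpsi) h; rewrite -[LHS]h //.
move=> B C mB mC.
transitivity ((lebesgue_measure \x mu n)%E
  (((fun x : measurableTypeR R => x + a ord0 ord0 : measurableTypeR R) @^-1` B) `*`
   ((fun x => x + a') @^-1` C))); first by [].
rewrite product_measure1E.
- by congr (_ * _)%E; [exact: lebesgue_measure_shift|exact: IH].
- rewrite -[X in measurable X]setTI.
  by apply: measurable_funD => //; exact: measurable_id.
- by rewrite -[X in measurable X]setTI; exact: measurable_shift_rV.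
Qed.

Lemma measurable_box_rV n (a b : 'rV[R]_n) :
  measurable [set v : 'rV[R]_n | forall i, a ord0 i < v ord0 i <= b ord0 i].
Proof.
rewrite (_ : [set v | _] = \bigcap_(i in [set: 'I_n])
    ((fun v : 'rV[R]_n => v ord0 i) @^-1` `]a ord0 i, b ord0 i])).
  apply: fin_bigcap_measurable => // i _.
  by rewrite -[X in measurable X]setTI; exact: measurable_rV_coord.
apply/seteqP; split => v /= Bv i; first by move=> _ /=; rewrite in_itv; exact: Bv.
by have := Bv i Logic.I; rewrite /= in_itv.
Qed.

Lemma lebesgue_rV_bounded n (A : set 'rV[R]_n) (r : R) :
  A `<=` [set x | `|x| <= r] -> measurable A -> (mu n A < +oo)%E.
Proof.
move=> Ar mA; have [r0|r0] := ltP r 0.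
  rewrite (_ : A = set0) ?measure0//; apply/seteqP; split => // x /Ar /=.
  by rewrite leNgt (lt_le_trans r0).
pose B := [set v : 'rV[R]_n | forall i, (const_mx (- r - 1) : 'rV[R]_n) ord0 i
  < v ord0 i <= (const_mx r : 'rV[R]_n) ord0 i].
have mB : measurable B by exact: measurable_box_rV.
apply: (@le_lt_trans _ _ (mu n B)).
  apply: le_measure; rewrite ?inE// => x /Ar /= xr i; rewrite !mxE.
  have := le_trans (rV_norm_coord x i) xr; rewrite ler_norml => /andP[h1 h2].
  by rewrite h2 andbT; lra.
by rewrite lebesgue_rV_box ?ltry// => i; rewrite !mxE; lra.
Qed.

Lemma lebesgue_rV_ball_gt0 n (x : 'rV[R]_n) (r : R) : 0 < r ->
  (0 < mu n (ball x r))%E.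
Proof.
move=> r0.
pose B := [set v : 'rV[R]_n | forall i, (x - const_mx (r / 2)) ord0 i
  < v ord0 i <= (x + const_mx (r / 2)) ord0 i].
have mB : measurable B by exact: measurable_box_rV.
apply: (@lt_le_trans _ _ (mu n B)).
  rewrite lebesgue_rV_box; last by move=> i; rewrite !mxE; lra.
  by rewrite lte_fin prodr_gt0// => i _; rewrite !mxE; lra.
apply: le_measure; rewrite ?inE//; first exact: measurable_ball_rV.
move=> y By; rewrite ball_rVE; apply/rV_norm_ltP => // i.
by have := By i; rewrite !mxE ltr_norml; lra.
Qed.


End rV_translation.

(** * Bounded measurable functions with bounded support *)

Section tame.
Context {R : realType} {n : nat}.
Local Notation mu := (lebesgue_rV R n).
Implicit Types (g h : 'rV[R]_n -> R).

Definition bounded_mfun g :=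
  measurable_fun setT g /\ exists M, forall x, `|g x| <= M.

(** A class stable under the operations needed and made of integrable functions.
    An essentially bounded function on a bounded set belongs to it after extension
    by zero and modification on a null set. *)
Definition tame h :=
  [/\ measurable_fun setT h, exists M, forall x, `|h x| <= M &
      exists r, forall x, r < `|x| -> h x = 0].

Definition intg h : R := Rintegral mu setT h.

Lemma tame_bounded h : tame h -> bounded_mfun h.
Proof. by case. Qed.

Lemma tame_mul g h : bounded_mfun g -> tame h -> tame (fun x => g x * h x).
Proof.
move=> [mg [M gM]] [mh [M' hM] [r hr]]; split; first exact: measurable_funM.
  by exists (M * M') => x; rewrite normrM ler_pM.
by exists r => x /hr ->; rewrite mulr0.
Qed.

Lemma bounded_mfun_cst c : bounded_mfun (fun=> c).
Proof. by split; [exact: measurable_cst|exists `|c|]. Qed.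

Lemma tame_scale c h : tame h -> tame (fun x => c * h x).
Proof. exact: tame_mul (bounded_mfun_cst c). Qed.

Lemma tame_opp h : tame h -> tame (fun x => - h x).
Proof. by move=> /(tame_scale (-1)); under eq_fun do rewrite mulN1r. Qed.

Lemma tame_add g h : tame g -> tame h -> tame (fun x => g x + h x).
Proof.
move=> [mg [M gM] [r gr]] [mh [M' hM] [r' hr]]; split; first exact: measurable_funD.
  by exists (M + M') => x; rewrite (le_trans (ler_normD _ _))// lerD.
exists (Num.max r r') => x; rewrite gt_max => /andP[rx r'x].
by rewrite gr// hr// addr0.
Qed.

Lemma tame_sub g h : tame g -> tame h -> tame (fun x => g x - h x).
Proof. by move=> tg th; apply: tame_add => //; exact: tame_opp. Qed.

Lemma tame_norm h : tame h -> tame (fun x => `|h x|).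
Proof.
move=> [mh [M hM] [r hr]]; split; first exact: measurableT_comp.
  by exists M => x; rewrite normr_id.
by exists r => x /hr ->; rewrite normr0.
Qed.

Lemma tame0 : tame (fun=> 0).
Proof.
by split; [exact: measurable_cst|exists 0 => x; rewrite normr0|exists 0].
Qed.

Lemma tame_sum (J : Type) (s : seq J) (F : J -> 'rV[R]_n -> R) :
  (forall j, tame (F j)) -> tame (fun x => \sum_(j <- s) F j x).
Proof.
move=> tF; elim: s => [|j s IH].
  by under eq_fun do rewrite big_nil; exact: tame0.
by under eq_fun do rewrite big_cons; exact: tame_add.
Qed.

Lemma tame_shift h (a : 'rV[R]_n) : tame h -> tame (fun x => h (x + a)).
Proof.
move=> [mh [M hM] [r hr]]; split.
- by apply: measurableT_comp => //; exact: measurable_shift_rV.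
- by exists M.
- exists (r + `|a|) => x rx; apply: hr.
  have := ler_normB (x + a) a; rewrite addrK.
  by move=> h1; have := lt_le_trans rx h1; rewrite ltrD2r.
Qed.

Lemma tame_integrable h : tame h -> mu.-integrable setT (EFin \o h).
Proof.
move=> [mh [M hM] [r hr]].
pose B := [set x : 'rV[R]_n | `|x| <= `|r|].
have mB : measurable B.
  apply: closed_measurable_rV.
  rewrite (_ : B = closed_ball_ (fun x => `|x|) 0 `|r|).
    exact: closed_closed_ball_.
  by apply/seteqP; split => x /=; rewrite /closed_ball_ /= sub0r normrN.
have hE : EFin \o h = (EFin \o h) \_ B.
  apply/funext => x; rewrite /= patchE; case: ifPn => //.
  rewrite notin_setE => /negP; rewrite -ltNge => rx.
  by rewrite hr// (le_lt_trans (ler_norm r)).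
rewrite hE; apply/(integrable_mkcond _ mB).
apply: measurable_bounded_integrable => //.
- exact: (@lebesgue_rV_bounded _ _ _ `|r|).
- exact: measurable_funS mh.
- exists M; split; first exact: num_real.
  by move=> N /ltW MN x _ /=; apply: le_trans (hM x) MN.
Qed.

Lemma intgE h : tame h -> (\int[mu]_x (h x)%:E)%E = (intg h)%:E.
Proof.
move=> th; rewrite /intg /Rintegral fineK//.
exact: integrable_fin_num (tame_integrable th).
Qed.

Lemma intgD g h : tame g -> tame h -> intg (fun x => g x + h x) = intg g + intg h.
Proof. by move=> tg th; rewrite /intg RintegralD//; exact: tame_integrable. Qed.

Lemma intgZ c h : tame h -> intg (fun x => c * h x) = c * intg h.
Proof. by move=> th; rewrite /intg RintegralZl//; exact: tame_integrable. Qed.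

Lemma intgN h : tame h -> intg (fun x => - h x) = - intg h.
Proof. by move=> th; rewrite -mulN1r -intgZ//; congr intg; apply/funext => x; rewrite mulN1r. Qed.

Lemma intgB g h : tame g -> tame h -> intg (fun x => g x - h x) = intg g - intg h.
Proof. by move=> tg th; rewrite intgD ?intgN//; exact: tame_opp. Qed.

Lemma intg0 : intg (fun=> 0) = 0.
Proof. by rewrite /intg /Rintegral integral0. Qed.

Lemma intg_sum (J : Type) (s : seq J) (F : J -> 'rV[R]_n -> R) :
  (forall j, tame (F j)) ->
  intg (fun x => \sum_(j <- s) F j x) = \sum_(j <- s) intg (F j).
Proof.
move=> tF; elim: s => [|j s IH].
  by rewrite big_nil -[RHS]intg0; congr intg; apply/funext => x; rewrite big_nil.
rewrite big_cons -IH -intgD//; last exact: tame_sum.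
by congr intg; apply/funext => x; rewrite big_cons.
Qed.

Lemma ler_intg g h : tame g -> tame h -> (forall x, g x <= h x) -> intg g <= intg h.
Proof. by move=> tg th gh; apply: le_Rintegral => //; exact: tame_integrable. Qed.

Lemma intg_ge0 h : (forall x, 0 <= h x) -> 0 <= intg h.
Proof. by move=> h0; exact: Rintegral_ge0. Qed.

Lemma ler_norm_intg h : tame h -> `|intg h| <= intg (fun x => `|h x|).
Proof. by move=> th; apply: le_normr_Rintegral => //; exact: tame_integrable. Qed.

Lemma intg_shift h a : tame h -> intg (fun x => h (x + a)) = intg h.
Proof.
move=> th; have tha := tame_shift a th; apply: EFin_inj; rewrite -!intgE//.
have ms := measurable_shift_rV a.
have mh : measurable_fun setT (EFin \o h).
  by apply/measurable_EFinP; case: th.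
have := @integral_pushforward _ _ _ _ _ _ ms mu setT (EFin \o h) mh.
rewrite preimage_setT => /(_ (tame_integrable tha) measurableT) <-.
by apply: eq_measure_integral => A mA _; exact: lebesgue_rV_shift.
Qed.

Lemma ae_eq_intg g h : tame g -> tame h -> (\forall x \ae mu, g x = h x) ->
  intg g = intg h.
Proof.
move=> tg th gh; apply: EFin_inj; rewrite -!intgE//.
apply: ae_eq_integral => //.
- by apply/measurable_EFinP; case: tg.
- by apply/measurable_EFinP; case: th.
- by apply: filterS gh => x /= -> _.
Qed.

Lemma intg_dominated (F : nat -> 'rV[R]_n -> R) g h :
  (forall k, tame (F k)) -> tame g -> tame h ->
  (\forall x \ae mu, F k x @[k --> \oo] --> h x) ->
  (forall k x, `|F k x| <= g x) ->
  intg (F k) @[k --> \oo] --> intg h.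
Proof.
move=> tF tg th Fh Fg.
have [] := @dominated_convergence _ _ _ mu setT measurableT
  (fun k => EFin \o F k) (EFin \o h) (EFin \o g).
- by move=> k; apply/measurable_EFinP; case: (tF k).
- by apply/measurable_EFinP; case: th.
- by apply: filterS Fh => x /= hx _; apply: cvg_EFin => //; exact: nearW.
- exact: tame_integrable.
- by apply: aeW => x k _ /=; rewrite lee_fin.
- move=> _ _; rewrite intgE// => hE.
  have -> : (fun k => intg (F k)) = (fun k => fine (\int[mu]_x (F k x)%:E)%E).
    by apply/funext => k; rewrite intgE.
  exact: (fine_cvg hE).
Qed.

Lemma intg_dominated_norm (F : nat -> 'rV[R]_n -> R) g h :
  (forall k, tame (F k)) -> tame g -> tame h ->
  (\forall x \ae mu, F k x @[k --> \oo] --> h x) ->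
  (forall k x, `|F k x| <= g x) ->
  intg (fun x => `|F k x - h x|) @[k --> \oo] --> 0.
Proof.
move=> tF tg th Fh Fg; rewrite -intg0.
apply: (@intg_dominated _ (fun x => g x + `|h x|)) => //.
- by move=> k; apply/tame_norm/tame_sub.
- by apply: tame_add => //; exact: tame_norm.
- exact: tame0.
- apply: filterS Fh => x hx.
  rewrite -[X in _ --> X](normr0 R) -(subrr (h x)).
  by apply: cvg_norm; apply: cvgB => //; exact: cvg_cst.
- move=> k x; rewrite normr_id (le_trans (ler_normB _ _))//.
  by rewrite lerD2r.
Qed.

Lemma tame_indic (A : set 'rV[R]_n) (h : 'rV[R]_n -> R) r :
  measurable A -> A `<=` [set x | `|x| <= r] ->
  measurable_fun A h -> (exists M, forall x, A x -> `|h x| <= M) ->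
  tame (h \_ A).
Proof.
move=> mA Ar mh [M hM]; split.
- by apply/measurable_restrict => //; rewrite setTI.
- exists `|M| => x; rewrite patchE; case: ifPn => [/set_mem Ax|_].
    by rewrite (le_trans (hM _ Ax))// ler_norm.
  by rewrite normr0.
- exists r => x rx; rewrite patchE; case: ifPn => // /set_mem /Ar /=.
  by rewrite leNgt rx.
Qed.

Lemma tame_compact (K : set 'rV[R]_n) (h : 'rV[R]_n -> R) :
  compact K -> continuous h -> (forall x, ~ K x -> h x = 0) -> tame h.
Proof.
move=> cK ch hK.
have [M [_ KM]] := compact_bounded cK.
have bK : bounded_set (h @` K).
  apply: compact_bounded; apply: continuous_compact => //.
  exact: continuous_subspaceT.
have [N [_ hN]] := bK.
split.
- exact: continuousT_measurable_rV.
- exists (`|N| + 1) => x; have [Kx|Kx] := pselect (K x).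
    apply: (hN (`|N| + 1)); last by exists x.
    by rewrite (le_lt_trans (ler_norm N))// ltrDl.
  by rewrite hK// normr0 addr_ge0.
- exists (M + 1) => x Mx; apply: hK => Kx.
  have : `|x| <= M + 1 by apply: (KM (M + 1)) => //; rewrite ltrDl.
  by rewrite leNgt Mx.
Qed.

End tame.

(** * Smooth functions and mollifiers *)

Section bump1.
Context {R : realType}.
Implicit Types (P : {poly R}) (x s : R).

Lemma poly_le_exp P : exists C, 0 <= C /\ forall s, 0 <= s -> `|P.[s]| <= C * expR s.
Proof.
exists (\sum_(i < size P) `|P`_i| * (i`!)%:R); split.
  by apply: sumr_ge0 => i _; rewrite mulr_ge0.
move=> s s0; rewrite horner_coef (le_trans (ler_norm_sum _ _ _))// mulr_suml.
apply: ler_sum => i _; rewrite normrM -mulrA ler_wpM2l// ger0_norm ?exprn_ge0//.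
case: (nat_of_ord i) => [|m].
  by rewrite expr0 fact0 mul1r -[leLHS]addr0 (le_trans _ (expR_ge1Dx s))// lerD2l.
have := expR_ge1Dxn m s0.
set f := (m.+1)`!%:R : R; have f0 : 0 < f by rewrite ltr0n fact_gt0.
rewrite -ler_pdivrMl// mulrC => h.
by apply: le_trans h; rewrite lerDr.
Qed.

(** The functions [P(1/x) exp(-1/x)] vanishing for [x <= 0] are stable under
    derivation, hence smooth. *)
Definition flat P x := if 0 < x then P.[x^-1] * expR (- x^-1) else 0.

(** Quadratic decay, which makes [flat P] differentiable at zero. *)
Lemma flat_le P : exists C, forall x, `|flat P x| <= C * x ^+ 2.
Proof.
have [C [C0 hC]] := poly_le_exp ('X^2 * P); exists C => x; rewrite /flat.
case: ifPn => [x0|_]; last by rewrite normr0 mulr_ge0// sqr_ge0.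
have s0 : 0 <= x^-1 by rewrite invr_ge0 ltW.
have := hC _ s0; rewrite hornerM hornerXn normrM ger0_norm ?exprn_ge0// exprVn.
rewrite ler_pdivrMl ?exprn_gt0// mulrCA => h.
rewrite normrM (ger0_norm (expR_ge0 _)) expRN ler_pdivrMr ?expR_gt0//.
by rewrite -mulrA.
Qed.

Lemma is_derive_flat_gt0 P x : 0 < x ->
  is_derive x 1 (flat P) (flat ('X^2 * (P - P^`())) x).
Proof.
move=> x0; rewrite {2}/flat x0.
pose Phi s : R := P.[s] * expR (- s).
apply: (@near_eq_is_derive _ _ _ (Phi \o (fun y : R => y^-1))).
  by near=> y; rewrite /flat ifT//; near: y; exact: lt_nbhsr.
have x_neq0 : x != 0 by rewrite gt_eqF.
have dI : derivable (fun y : R => y^-1) x 1.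
  exact: (@derivableV _ _ (@idfun R)).
have dIE : (fun y : R => y^-1)^`()%classic x = - x ^- 2.
  have did : derivable (@idfun R) x 1 by exact: derivable_id.
  rewrite derive1E (@deriveV _ _ (@idfun R) x 1 x_neq0 did).
  by rewrite derive_id [_%:A]mulr1.
have dN s : derivable (expR \o -%R : R -> R) s 1.
  apply: diff_derivable; apply: differentiable_comp; apply/derivable1_diffP.
    exact: derivable_opp.
  exact: derivable_expR.
have dNE s : 'D_1 (expR \o -%R : R -> R) s = - expR (- s).
  rewrite -derive1E derive1_comp; [|exact: derivable_opp|exact: derivable_expR].
  have did : derivable (@idfun R) s 1 by exact: derivable_id.
  rewrite derive1N//. rewrite derive1_id mulrN1 derive1E; congr (- _).
  exact: (congr1 (fun h => h (- s)) (@derive_expR R)).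
have dP0 s : derivable (horner P : R -> R) s 1 by exact: derivable_horner.
have PhiE : Phi = horner P * (expR \o -%R) by apply/funext.
have dP s : derivable Phi s 1 by rewrite PhiE; exact: (derivableM (dP0 s) (dN s)).
have dPE s : Phi^`()%classic s = P^`().[s] * expR (- s) - P.[s] * expR (- s).
  rewrite derive1E PhiE (deriveM (dP0 s) (dN s)) dNE -derive1E -derivE /=.
  by rewrite [_ *: _]mulrN [expR _ *: _]mulrC addrC.
apply: DeriveDef.
  apply: diff_derivable; apply: differentiable_comp; first exact/derivable1_diffP.
  exact/derivable1_diffP/dP.
rewrite -derive1E (derive1_comp dI (dP x^-1)) dPE dIE.
rewrite hornerM hornerD hornerN hornerXn exprVn.
move: (P.[_]) (P^`().[_]) (expR _) (x ^- 2) => a b c d; ring.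
Unshelve. all: by end_near. Qed.

Lemma is_derive_flat0 P : is_derive (0 : R) 1 (flat P) 0.
Proof.
have [C hC] := flat_le P.
have flat0 : flat P 0 = 0 by rewrite /flat ltxx.
have h : (fun h : R => h^-1 * flat P h) h @[h --> 0^'] --> (0 : R).
  apply/cvgr0Pnorm_le => e e0.
  near=> h.
  have h0 : h != 0 by near: h; exact: nbhs_dnbhs_neq.
  rewrite normrM normfV ler_pdivrMl ?normr_gt0//.
  apply: le_trans (hC h) _.
  rewrite -real_normK ?num_real// expr2 mulrCA ler_wpM2l//.
  have : `|h| <= e / (`|C| + 1).
    near: h; apply: dnbhs0_le.
    by rewrite divr_gt0// ltr_wpDl.
  rewrite ler_pdivlMr ?ltr_wpDl// => he; apply: le_trans he.
  by rewrite mulrC ler_wpM2l// (le_trans (ler_norm C))// lerDl.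
have hE : (fun h => h^-1 *: ((flat P \o shift 0) (h *: 1%:A) - flat P 0)) =
    (fun h : R => h^-1 * flat P h).
  by apply/funext => t; rewrite /= flat0 subr0 addr0 [1%:A]mulr1 [_%:A]mulr1.
rewrite -hE [1%:A]mulr1 in h.
by apply: DeriveDef; [apply/cvg_ex; exists 0|exact: cvg_lim h].
Unshelve. all: by end_near. Qed.

Lemma flat_le0 P x : x <= 0 -> flat P x = 0.
Proof. by move=> x0; rewrite /flat ltNge x0. Qed.

Lemma is_derive_flat P x : is_derive x 1 (flat P) (flat ('X^2 * (P - P^`())) x).
Proof.
have [x0|x0|->] := ltgtP x 0; last 1 first.
- by rewrite (@flat_le0 ('X^2 * _))//; exact: is_derive_flat0.
- rewrite (@flat_le0 ('X^2 * _)) ?ltW//.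
  apply: (@near_eq_is_derive _ _ _ (cst 0)).
  near=> y; rewrite /flat ltNge (_ : y <= 0)//.
  by near: y; apply: filterS (lt_nbhsl x0) => y /ltW.
- exact: is_derive_flat_gt0.
Unshelve. all: by end_near. Qed.

Lemma flat1_ge0 x : 0 <= flat 1 x.
Proof. by rewrite /flat; case: ifP => // _; rewrite hornerC mul1r expR_ge0. Qed.

Lemma flat1_gt0 x : 0 < x -> 0 < flat 1 x.
Proof. by move=> x0; rewrite /flat x0 hornerC mul1r expR_gt0. Qed.

Lemma differentiable_flat P x : differentiable (flat P) x.
Proof. by apply/derivable1_diffP; case: (is_derive_flat P x). Qed.

End bump1.

Section Ck_algebra.
Context {R : realType} {n : nat}.
Implicit Types (phi psi : 'rV[R]_n -> R) (v x : 'rV[R]_n).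

Lemma CkW k phi : Ck k.+1 phi -> Ck k phi.
Proof.
elim: k phi => [|k IH] phi [cphi dphi]; first by split.
by split=> // i; have [d /IH] := dphi i.
Qed.

Lemma Ck_cst k (c : R) : Ck k (fun _ : 'rV[R]_n => c).
Proof.
elim: k c => [|k IH] c; first by split; [exact: cst_continuous|].
split; first exact: cst_continuous.
move=> i; split=> [x|]; first exact: derivable_cst.
rewrite (_ : partial i _ = (fun=> 0)); first exact: IH.
by apply/funext => x; rewrite /partial derive_cst.
Qed.

Lemma Ck_add k phi psi : Ck k phi -> Ck k psi -> Ck k (fun x => phi x + psi x).
Proof.
elim: k phi psi => [|k IH] phi psi [c1 d1] [c2 d2].
  by split => //; exact: continuous_add.
split; first exact: continuous_add.
move=> i; have [d1i C1] := d1 i; have [d2i C2] := d2 i.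
split=> [x|]; first exact: derivableD.
rewrite (_ : partial i _ = (fun x => partial i phi x + partial i psi x)).
  exact: IH.
by apply/funext => x; rewrite /partial (deriveD (d1i x) (d2i x)).
Qed.

Lemma Ck_mul k phi psi : Ck k phi -> Ck k psi -> Ck k (fun x => phi x * psi x).
Proof.
elim: k phi psi => [|k IH] phi psi C1 C2.
  by case: C1 C2 => [c1 _] [c2 _]; split => //; exact: continuous_mul.
have [[c1 d1] [c2 d2]] := (C1, C2).
split; first exact: continuous_mul.
move=> i; have [d1i C1i] := d1 i; have [d2i C2i] := d2 i.
split=> [x|]; first exact: (derivableM (d1i x) (d2i x)).
rewrite (_ : partial i _ = (fun x => phi x * partial i psi x + psi x * partial i phi x)).
  by apply: Ck_add; apply: IH => //; exact: CkW.
by apply/funext => x; rewrite /partial (deriveM (d1i x) (d2i x)).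
Qed.

Lemma smooth_mul phi psi : smooth phi -> smooth psi -> smooth (fun x => phi x * psi x).
Proof. by move=> s1 s2 k; exact: Ck_mul. Qed.

Lemma smooth_cst (c : R) : smooth (fun _ : 'rV[R]_n => c).
Proof. by move=> k; exact: Ck_cst. Qed.

Lemma smooth_add phi psi : smooth phi -> smooth psi -> smooth (fun x => phi x + psi x).
Proof. by move=> s1 s2 k; exact: Ck_add. Qed.

Lemma smooth_prod (J : Type) (s : seq J) (F : J -> 'rV[R]_n -> R) :
  (forall j, smooth (F j)) -> smooth (fun x => \prod_(j <- s) F j x).
Proof.
move=> sF; elim: s => [|j s IH].
  by under eq_fun do rewrite big_nil; exact: smooth_cst.
by under eq_fun do rewrite big_cons; exact: smooth_mul.
Qed.

Lemma smooth_continuous phi : smooth phi -> continuous phi.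
Proof. by move=> /(_ 0%N) []. Qed.

Lemma smooth_derivable phi i x : smooth phi -> derivable phi x (delta_mx ord0 i).
Proof. by move=> /(_ 1%N) [_ /(_ i)] []. Qed.

Lemma smooth_partial phi i : smooth phi -> smooth (partial i phi).
Proof. by move=> sphi k; have [_ /(_ i)] := sphi k.+1; case. Qed.

Lemma partial_mul phi psi i x : smooth phi -> smooth psi ->
  partial i (fun x => phi x * psi x) x = phi x * partial i psi x + psi x * partial i phi x.
Proof.
by move=> s1 s2; rewrite /partial deriveM//; exact: smooth_derivable.
Qed.

End Ck_algebra.

Section affine_pullback.
Context {R : realType} {n : nat}.
Implicit Types (v x : 'rV[R]_n).
Variables (A : 'rV[R]_n -> R) (l : 'rV[R]_n -> R).
Hypothesis cA : continuous A.
Hypothesis Al : forall t v x, A (t *: v + x) = A x + t * l v.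

Let quotE (P : {poly R}) v x :
  (fun h : R => h^-1 *: ((flat P \o A \o shift x) (h *: v) - (flat P \o A) x)) =
  (fun h : R => h^-1 *: ((flat P \o shift (A x)) (h *: l v) - flat P (A x))).
Proof. by apply/funext => h /=; rewrite Al; congr (_ *: (flat P _ - _)); rewrite addrC. Qed.

Lemma derivable_flat_affine P v x : derivable (flat P \o A) x v.
Proof.
by rewrite /derivable quotE; exact: (diff_derivable (differentiable_flat P (A x))).
Qed.

Lemma derive_flat_affine P v x :
  'D_v (flat P \o A) x = l v * flat ('X^2 * (P - P^`())) (A x).
Proof.
have dP := differentiable_flat P (A x).
rewrite /derive quotE -/(derive _ _ _) deriveE//.
rewrite (_ : l v = l v *: 1); last by rewrite [_%:A]mulr1.
rewrite linearZ /= -deriveE// (derive_val (is_derive := is_derive_flat P (A x))).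
by rewrite [_%:A]mulr1.
Qed.

Lemma smooth_flat_affine P : smooth (flat P \o A).
Proof.
move=> k; elim: k P => [|k IH] P.
  split=> // x; apply: continuous_comp; first exact: cA.
  exact: (differentiable_continuous (differentiable_flat _ _)).
split.
  move=> x; apply: continuous_comp; first exact: cA.
  exact: (differentiable_continuous (differentiable_flat _ _)).
move=> i; split=> [x|]; first exact: derivable_flat_affine.
rewrite (_ : partial i _ = (fun x => l (delta_mx ord0 i) *
    (flat ('X^2 * (P - P^`())) \o A) x)).
  by apply: Ck_mul; [exact: Ck_cst|exact: IH].
by apply/funext => x; rewrite /partial derive_flat_affine.
Qed.

End affine_pullback.

Section mollifier.
Context {R : realType} {n : nat}.
Local Notation mu := (lebesgue_rV R n).
Implicit Types (v x y : 'rV[R]_n).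

Lemma compact_norm_le (r : R) : compact [set x : 'rV[R]_n | `|x| <= r].
Proof.
apply: bounded_closed_compact.
  by exists r; split; [exact: num_real|move=> M /ltW rM x /= /le_trans; exact].
rewrite (_ : [set x | _] = closed_ball_ (fun x => `|x|) 0 r).
  exact: closed_closed_ball_.
by apply/seteqP; split => x /=; rewrite /closed_ball_ /= sub0r normrN.
Qed.

Lemma ae_meets_ball (P : 'rV[R]_n -> Prop) x (r : R) : 0 < r ->
  (\forall y \ae mu, P y) -> exists y, `|y - x| < r /\ P y.
Proof.
move=> r0 [N [mN N0 hN]]; apply: contrapT => hno.
have := lebesgue_rV_ball_gt0 x r0; apply/negP; rewrite -leNgt -N0.
apply: le_measure; rewrite ?inE//; first exact: measurable_ball_rV.
move=> y; rewrite ball_rVE => xy; apply: hN => /= Py; apply: hno.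
by exists y.
Qed.

Lemma differentiable_derive (phi : 'rV[R]_n -> R) x v : differentiable phi x ->
  is_derive x v phi (\sum_i v ord0 i * partial i phi x).
Proof.
move=> dphi; apply: DeriveDef; first exact: diff_derivable.
rewrite deriveE// {1}(row_sum_delta v) linear_sum /=.
by apply: eq_bigr => i _; rewrite linearZ /= -deriveE.
Qed.

(** Differentiability is a separate requirement because [smooth] only speaks of
    partial derivatives, whereas mollifications are derived along arbitrary
    segments. *)
Definition mollifier (e : R) (rho : 'rV[R]_n -> R) :=
  [/\ smooth rho, forall x, 0 <= rho x, forall x, e <= `|x| -> rho x = 0,
      intg rho = 1 & forall x, differentiable rho x].

Lemma tame_mollifier e rho : mollifier e rho -> tame rho.
Proof.
move=> [srho _ rho_out _ _]; apply: (@tame_compact _ _ [set x | `|x| <= e]).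
- exact: compact_norm_le.
- exact: smooth_continuous.
by move=> x /negP; rewrite -ltNge => /ltW /rho_out.
Qed.

(** A product of one-dimensional bumps. Its integral, which is made equal to one by
    rescaling, is positive because the product does not vanish on a ball. *)
Lemma mollifier_exists (e : R) : 0 < e -> exists rho, mollifier e rho.
Proof.
move=> e0.
pose Ap i (x : 'rV[R]_n) := e + x ord0 i.
pose Am i (x : 'rV[R]_n) := e - x ord0 i.
pose b i x := flat 1 (Ap i x) * flat 1 (Am i x).
pose rho x := \prod_(i < n) b i x.
have cc i : continuous (fun x : 'rV[R]_n => x ord0 i) by exact: coord_continuous.
have sb i : smooth (b i).
  apply: smooth_mul.
    apply: (@smooth_flat_affine _ _ (Ap i) (fun v => v ord0 i)).
      by apply: continuous_add => //; exact: cst_continuous.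
    by move=> t v x; rewrite /Ap !mxE; ring.
  apply: (@smooth_flat_affine _ _ (Am i) (fun v => - v ord0 i)).
    apply: continuous_add; first exact: cst_continuous.
    exact: continuous_opp.
  by move=> t v x; rewrite /Am !mxE; ring.
have db i x : differentiable (b i) x.
  apply: differentiableM; apply: differentiable_comp; try exact: differentiable_flat.
    by apply: differentiableD => //; exact: differentiable_coord.
  apply: differentiableD => //; apply: differentiableN; exact: differentiable_coord.
have srho : smooth rho by exact: smooth_prod.
have drho x : differentiable rho x.
  rewrite /rho; elim: (index_enum _) => [|i s IH].
    under eq_fun do rewrite big_nil; exact: differentiable_cst.
  under eq_fun do rewrite big_cons.
  exact: differentiableM.
have rho_ge0 x : 0 <= rho x.
  by apply: prodr_ge0 => i _; rewrite mulr_ge0 ?flat1_ge0.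
have rho_out x : e <= `|x| -> rho x = 0.
  move=> ex; apply/eqP; apply: contraTT ex => rx; rewrite -ltNge.
  apply/rV_norm_ltP => // i; rewrite ltNge; apply: contra rx => ei.
  rewrite /rho (bigD1 i)//= /b; move: ei; rewrite ler_normr => /orP[] ei.
    by rewrite [X in _ * X * _]flat_le0 ?mulr0 ?mul0r// /Am; lra.
  by rewrite flat_le0 ?mul0r// /Ap; lra.
have trho : tame rho.
  apply: (@tame_compact _ _ [set x | `|x| <= e]).
  - exact: compact_norm_le.
  - exact: smooth_continuous.
  by move=> x /negP; rewrite -ltNge => /ltW /rho_out.
have I0 : 0 < intg rho.
  rewrite lt_neqAle intg_ge0// andbT; apply/eqP => I0.
  have := intgE trho; rewrite -I0.
  rewrite (_ : (\int[mu]_x _)%E = (\int[mu]_x `|(rho x)%:E|)%E); last first.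
    by apply: eq_integral => x _; rewrite /= ger0_norm.
  have mrho : measurable_fun setT (EFin \o rho).
    by apply/measurable_EFinP; case: trho.
  move=> /(ae_eq_integral_abs mu measurableT mrho) rho0.
  have [y [ye /= /(_ I) [ry]]] := ae_meets_ball 0 e0 rho0.
  have : 0 < rho y.
    rewrite subr0 in ye; apply: prodr_gt0 => i _.
    have := le_lt_trans (rV_norm_coord y i) ye; rewrite ltr_norml => yi.
    by rewrite mulr_gt0// flat1_gt0// /Ap /Am; lra.
  by rewrite ry ltxx.
exists (fun x => (intg rho)^-1 * rho x); split.
- by apply: smooth_mul => //; exact: smooth_cst.
- by move=> x; rewrite mulr_ge0// invr_ge0 ltW.
- by move=> x /rho_out ->; rewrite mulr0.
- by rewrite intgZ// mulVf// gt_eqF.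
- by move=> x; apply: differentiableM.
Qed.

End mollifier.

(** * Convolution *)

Section uniform_quotient.
Context {R : realType} {n : nat}.
Implicit Types (v x y : 'rV[R]_n) (phi : 'rV[R]_n -> R).

Lemma derive_line phi v y (s : R) : derivable phi (y + s *: v) v ->
  is_derive s 1 (fun r : R => phi (y + r *: v)) ('D_v phi (y + s *: v)).
Proof.
move=> dphi.
have E : (fun h : R => h^-1 *: (((fun r : R => phi (y + r *: v)) \o shift s) (h *: 1%:A)
      - phi (y + s *: v))) =
    (fun h : R => h^-1 *: ((phi \o shift (y + s *: v)) (h *: v) - phi (y + s *: v))).
  apply/funext => h /=; congr (_ *: (phi _ - _)).
  by rewrite [1%:A]mulr1 [_%:A]mulr1 scalerDl addrCA.
rewrite [1%:A]mulr1 in E.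
by apply: DeriveDef; [rewrite /derivable E|rewrite /derive E].
Qed.

Lemma mean_value_line phi v y (t : R) : (forall x, derivable phi x v) ->
  exists s, `|s| <= `|t| /\
    phi (y + t *: v) - phi y = t * 'D_v phi (y + s *: v).
Proof.
move=> dphi; pose k (r : R) := phi (y + r *: v).
have dk (r : R) : is_derive r 1 k ('D_v phi (y + r *: v)) by exact: derive_line.
have ck : continuous k.
  by move=> r; apply: differentiable_continuous; apply/derivable1_diffP; case: (dk r).
have [t0|t0|->] := ltgtP t 0; last first.
- by exists 0; rewrite scale0r addr0 subrr mul0r.
- have [//|c] := @MVT _ k (fun r => 'D_v phi (y + r *: v)) 0 t t0 (fun r _ => dk r).
    exact: continuous_subspaceT.
  rewrite in_itv /= => /andP[c0 ct] /eqP; rewrite /k scale0r addr0 subr0 => /eqP kE.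
  by exists c; rewrite kE mulrC !gtr0_norm// ltW.
- have [//|c] := @MVT _ k (fun r => 'D_v phi (y + r *: v)) t 0 t0 (fun r _ => dk r).
    exact: continuous_subspaceT.
  rewrite in_itv /= => /andP[c0 ct]; rewrite /k scale0r addr0 sub0r => kE.
  exists c; split; first by rewrite !ltr0_norm// lerN2 ltW.
  by rewrite -opprB kE mulrN opprK mulrC.
Qed.

Lemma near_translate_unif phi (K : set 'rV[R]_n) (eps : R) : compact K ->
  continuous phi -> 0 < eps ->
  exists2 d : R, 0 < d & forall y z, K y -> `|z| < d -> `|phi (y + z) - phi y| <= eps.
Proof.
move=> /compact_near_coveringP cK cphi eps0.
have /nbhs_ballP[d /= d0 hd] : nbhs (0 : 'rV[R]_n)
    [set z | K `<=` [set y | `|phi (y + z) - phi y| <= eps]].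
  apply: (cK _ (nbhs (0 : 'rV[R]_n)) (fun z y => `|phi (y + z) - phi y| <= eps)) => y Ky.
  have e20 : 0 < eps / 2 by rewrite divr_gt0.
  have /nbhs_ballP[d /= d0 hd] : nbhs y [set y' | `|phi y - phi y'| < eps / 2].
    by have /cvgrPdist_lt := cphi y; apply.
  have d20 : 0 < d / 2 by rewrite divr_gt0.
  exists (ball y (d / 2), ball 0 (d / 2)).
    by split; exact: nbhsx_ballx.
  move=> [y' z] /= []; rewrite !ball_rVE subr0 => yy' z0.
  have h1 : `|phi y - phi y'| < eps / 2.
    by apply: hd; rewrite ball_rVE; lra.
  have h2 : `|phi y - phi (y' + z)| < eps / 2.
    apply: hd; rewrite ball_rVE addrAC.
    by rewrite (le_lt_trans (ler_normD _ _))// [ltRHS]splitr ltrD.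
  rewrite -(subrKA (phi y)) (le_trans (ler_normD _ _))// [leRHS]splitr.
  by rewrite lerD// ltW// distrC.
exists d => // y z Ky zd; apply: hd => //.
by rewrite ball_rVE subr0.
Qed.

(** A difference quotient is a derivative at a nearby point. *)
Lemma quotient_unif phi v (K : set 'rV[R]_n) (eps : R) : compact K ->
  (forall x, derivable phi x v) -> continuous (fun x => 'D_v phi x) -> 0 < eps ->
  exists2 d : R, 0 < d & forall t y, t != 0 -> `|t| < d -> K y ->
    `|t^-1 * (phi (y + t *: v) - phi y) - 'D_v phi y| <= eps.
Proof.
move=> cK dphi cD eps0.
have [d d0 hd] := near_translate_unif cK cD eps0.
exists (d / (`|v| + 1)); first by rewrite divr_gt0// ltr_wpDl.
move=> t y t0 td Ky; have [s [st ->]] := @mean_value_line phi v y t dphi.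
rewrite mulKf//; apply: hd => //; rewrite normrZ.
have : `|s| < d / (`|v| + 1) by exact: le_lt_trans td.
rewrite ltr_pdivlMr ?ltr_wpDl//; apply: le_lt_trans.
by rewrite ler_wpM2l// lerDl.
Qed.

End uniform_quotient.

Lemma continuous_subr (R : numFieldType) (V : normedModType R) (x : V) :
  continuous (fun y : V => y - x).
Proof. by move=> y; apply: cvgB; [exact: cvg_id|exact: cvg_cst]. Qed.

Lemma continuous_epsP (R : realType) (V : normedModType R) (f : V -> R) (x : V) :
  {for x, continuous f} <-> forall eps : R, 0 < eps ->
    exists2 d : R, 0 < d & forall y, `|y - x| < d -> `|f y - f x| <= eps.
Proof.
split=> [cf eps eps0|h].
  have /cvgrPdist_le/(_ _ eps0)/nbhs_ballP[d /= d0 hd] := cf.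
  exists d => // y yx; rewrite distrC; apply: hd.
  by rewrite -ball_normE /= distrC.
apply/cvgrPdist_le => eps /h[d d0 hd]; apply/nbhs_ballP; exists d => //= y.
by rewrite -ball_normE /= distrC => /hd; rewrite distrC.
Qed.

Section convolution.
Context {R : realType} {n : nat}.
Local Notation mu := (lebesgue_rV R n).
Implicit Types (v x y : 'rV[R]_n) (h phi psi : 'rV[R]_n -> R).

Lemma tame_mul_continuous h psi : tame h -> continuous psi ->
  tame (fun y => h y * psi y).
Proof.
move=> [mh [M hM] [r hr]] cpsi.
have [N hN] : exists N, forall x, `|x| <= r -> `|psi x| <= N.
  have : bounded_set (psi @` [set x | `|x| <= r]).
    apply: compact_bounded; apply: continuous_compact; last exact: compact_norm_le.
    exact: continuous_subspaceT.
  move=> [N [_ hN]]; exists (N + 1) => x xr; apply: (hN (N + 1)); first by rewrite ltrDl.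
  by exists x.
split.
- by apply: measurable_funM => //; exact: continuousT_measurable_rV.
- exists (`|M| * `|N|) => x; have [xr|xr] := leP `|x| r.
    rewrite normrM ler_pM// (le_trans _ (ler_norm _)) ?hM// ?hN//.
  by rewrite hr// mul0r normr0 mulr_ge0.
- by exists r => x /hr ->; rewrite mul0r.
Qed.

(** Correlation rather than convolution: the kernel is not reflected, whence the
    sign in [partial_mollify]. *)
Definition mollify h psi x : R := intg (fun y => h y * psi (y - x)).

Lemma continuous_shift psi x : continuous psi -> continuous (fun y => psi (y - x)).
Proof.
move=> cpsi y; apply: continuous_comp; last exact: cpsi.
exact: continuous_subr.
Qed.

Lemma tame_mollify h psi x : tame h -> continuous psi -> tame (fun y => h y * psi (y - x)).
Proof. by move=> th cpsi; apply: tame_mul_continuous => //; exact: continuous_shift. Qed.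

Lemma le_intg_supp h g (r eps : R) : tame h -> tame (fun y => h y * g y) ->
  (forall x, r < `|x| -> h x = 0) -> (forall x, `|x| <= r -> `|g x| <= eps) ->
  `|intg (fun y => h y * g y)| <= eps * intg (fun y => `|h y|).
Proof.
move=> th thg hr hg; rewrite (le_trans (ler_norm_intg thg))// -intgZ; last exact: tame_norm.
apply: ler_intg; [exact: tame_norm|by apply: tame_scale; exact: tame_norm|].
move=> x; rewrite normrM mulrC; have [xr|xr] := leP `|x| r.
  by rewrite ler_wpM2r// hg.
by rewrite hr// normr0 !mulr0.
Qed.

Lemma continuous_mollify h psi : tame h -> continuous psi -> continuous (mollify h psi).
Proof.
move=> th cpsi x; have [_ _ [r hr]] := th.
apply/continuous_epsP => eps eps0.
set J := intg (fun y => `|h y|).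
have J0 : 0 <= J by exact: intg_ge0.
have [d d0 hd] := near_translate_unif (@compact_norm_le _ n (r + `|x|)) cpsi
  (divr_gt0 eps0 (ltr_wpDl J0 ltr01)).
exists d => // x' xx'.
rewrite /mollify -intgB; [|exact: tame_mollify|exact: tame_mollify].
under [in X in `|X|]eq_fun do rewrite -mulrBr.
apply: le_trans (@le_intg_supp h (fun y => psi (y - x') - psi (y - x)) r
  (eps / (J + 1)) th _ hr _) _.
- by under eq_fun do rewrite mulrBr; apply: tame_sub; exact: tame_mollify.
- move=> y yr.
  rewrite (_ : y - x' = (y - x) + (x - x')); last by rewrite addrA subrK.
  apply: hd => /=; first by rewrite (le_trans (ler_normB _ _))// lerD2r.
  by rewrite distrC.
- rewrite mulrAC ler_pdivrMr ?ltr_wpDl// ler_wpM2l ?(ltW eps0)//.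
  by rewrite lerDl.
Qed.

(** The difference quotients of the kernel converge uniformly on the support of
    [h]. *)
Lemma is_derive_mollify h psi v x : tame h -> continuous psi ->
  (forall x, derivable psi x v) -> continuous (fun x => 'D_v psi x) ->
  is_derive x v (mollify h psi) (- mollify h (fun y => 'D_v psi y) x).
Proof.
move=> th cpsi dpsi cD; have [_ _ [r hr]] := th.
set J := intg (fun y => `|h y|).
have J0 : 0 <= J by exact: intg_ge0.
suff Q : h0^-1 *: ((mollify h psi \o shift x) (h0 *: v) - mollify h psi x) @[h0 --> 0^'] -->
    - mollify h (fun y => 'D_v psi y) x.
  by apply: DeriveDef; [apply/cvg_ex; eexists; exact: Q|exact: cvg_lim Q].
apply/cvgrPdist_le => eps eps0.
have [d d0 hd] := quotient_unif (@compact_norm_le _ n (r + `|x|)) dpsi cD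
  (divr_gt0 eps0 (ltr_wpDl J0 ltr01)).
near=> t.
have t0 : t != 0 by near: t; exact: nbhs_dnbhs_neq.
have td : `|t| < d by near: t; exact: dnbhs0_lt.
pose g y := t^-1 * (psi (y - (t *: v + x)) - psi (y - x)) + 'D_v psi (y - x).
have tg : tame (fun y => h y * g y).
  apply: tame_mul_continuous => //; apply: continuous_add; last exact: (@continuous_shift (fun y => 'D_v psi y) x cD).
  apply: continuous_mul; first exact: cst_continuous.
  apply: continuous_add; first exact: continuous_shift.
  by apply: continuous_opp; exact: continuous_shift.
have E : - mollify h (fun y => 'D_v psi y) x -
    t^-1 *: ((mollify h psi \o shift x) (t *: v) - mollify h psi x) =
    - intg (fun y => h y * g y).
  rewrite /mollify /= -intgB; [|exact: tame_mollify|exact: tame_mollify].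
  have scaleE (a b : R) : a *: b = a * b by [].
  rewrite scaleE -intgZ; last by apply: tame_sub; exact: tame_mollify.
  rewrite -opprD -intgD; last 2 first.
  - exact: (@tame_mollify h (fun y => 'D_v psi y) x th cD).
  - by apply: (@tame_scale _ _ t^-1); apply: tame_sub; exact: tame_mollify.
  by congr (- intg _); apply/funext => y; rewrite /g; ring.
rewrite E normrN; apply: le_trans (@le_intg_supp h g r (eps / (J + 1)) th tg hr _) _.
- move=> y yr; rewrite /g.
  have := hd (- t) (y - x); rewrite oppr_eq0 normrN => /(_ t0 td).
  rewrite scaleNr -addrA -opprD [x + _]addrC => /(_ _)/wrap[].
    by rewrite /= (le_trans (ler_normB _ _))// lerD2r.
  by rewrite invrN mulNr -opprD normrN.
- rewrite mulrAC ler_pdivrMr ?ltr_wpDl// ler_wpM2l ?(ltW eps0)//.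
  by rewrite lerDl.
Unshelve. all: by end_near. Qed.

Lemma partial_mollify h psi i x : tame h -> smooth psi ->
  partial i (mollify h psi) x = - mollify h (partial i psi) x.
Proof.
move=> th spsi; rewrite /partial.
apply: (derive_val (is_derive := is_derive_mollify x th _ _ _)).
- exact: smooth_continuous.
- by move=> y; exact: smooth_derivable.
- by apply: smooth_continuous; exact: (smooth_partial i spsi).
Qed.

Lemma smooth_mollify h psi : tame h -> smooth psi -> smooth (mollify h psi).
Proof.
move=> th spsi k; elim: k psi spsi => [|k IH] psi spsi.
  by split => //; apply: continuous_mollify => //; exact: smooth_continuous.
split; first by apply: continuous_mollify => //; exact: smooth_continuous.
move=> i; split => [x|].
  have dpsi y : derivable psi y (delta_mx ord0 i) by exact: smooth_derivable.
  have cD : continuous (fun y => 'D_(delta_mx ord0 i) psi y).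
    by apply: smooth_continuous; exact: (smooth_partial i spsi).
  by have [] := is_derive_mollify x th (smooth_continuous spsi) dpsi cD.
rewrite (_ : partial i _ = (fun x => -1 * mollify h (partial i psi) x)).
  by apply: Ck_mul; [exact: Ck_cst|apply: IH; exact: smooth_partial].
by apply/funext => x; rewrite partial_mollify// mulN1r.
Qed.

End convolution.

(** * Continuity of translations and convergence of mollifications in L^1 *)

Section inner_set.
Context {R : realType} {n : nat}.
Implicit Types (A : set 'rV[R]_n) (d : R).

(** Points at distance at least [d] from the complement. *)
Definition inner A d : set 'rV[R]_n := [set x | forall y, `|y - x| < d -> A y].

Lemma inner_closed A d : closed (inner A d).
Proof.
move=> x clx y yx.
have e0 : 0 < d - `|y - x| by rewrite subr_gt0.
have [z [zA xz]] := clx _ (nbhsx_ballx x _ e0).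
apply: zA; rewrite -(subrKA x) (le_lt_trans (ler_normD _ _))//.
by rewrite -ltrBrDl distrC -ball_rVE.
Qed.

Lemma inner_sub A d : 0 < d -> inner A d `<=` A.
Proof. by move=> d0 x; apply; rewrite subrr normr0. Qed.

Lemma innerS A d e : d <= e -> inner A e `<=` inner A d.
Proof. by move=> de x h y yx; apply: h; exact: lt_le_trans de. Qed.

Lemma inner_near A d e x y : inner A d x -> `|y - x| <= d - e -> inner A e y.
Proof.
move=> h yx z zy; apply: h; rewrite -(subrKA y) (le_lt_trans (ler_normD _ _))//.
by have := ltr_leD zy yx; rewrite addrCA subrr addr0.
Qed.

Lemma inner_open A x : open A -> A x -> exists2 d : R, 0 < d & inner A d x.
Proof.
move=> oA Ax; have /nbhs_ballP[d /= d0 hd] : nbhs x A by exact: open_nbhs_nbhs.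
by exists d => // y yx; apply: hd; rewrite ball_rVE.
Qed.

End inner_set.

Section L1_translation.
Context {R : realType} {n : nat}.
Local Notation mu := (lebesgue_rV R n).
Implicit Types (g h : 'rV[R]_n -> R) (A : set 'rV[R]_n).

Definition L1_translation_continuous h := forall eps : R, 0 < eps ->
  exists2 d : R, 0 < d & forall z, `|z| < d -> intg (fun x => `|h (x + z) - h x|) <= eps.
Local Notation tc := L1_translation_continuous.

Lemma tame_diff_shift h z : tame h -> tame (fun x => `|h (x + z) - h x|).
Proof. by move=> th; apply: tame_norm; apply: tame_sub => //; exact: tame_shift. Qed.

Lemma tc_add g h : tame g -> tame h -> tc g -> tc h -> tc (fun x => g x + h x).
Proof.
move=> tg th cg ch eps eps0; have e2 : 0 < eps / 2 by rewrite divr_gt0.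
have [d d0 hd] := cg _ e2; have [d' d'0 hd'] := ch _ e2.
exists (Num.min d d'); first by rewrite lt_min d0.
move=> z; rewrite lt_min => /andP[/hd zd /hd' zd'].
rewrite [leRHS]splitr; apply: le_trans (lerD zd zd').
rewrite -intgD; [|exact: tame_diff_shift|exact: tame_diff_shift].
apply: ler_intg.
- by apply: (@tame_diff_shift (fun x => g x + h x)); exact: tame_add.
- by apply: tame_add; exact: tame_diff_shift.
- by move=> x; rewrite opprD addrACA ler_normD.
Qed.

Lemma tc_scale (c : R) h : tame h -> tc h -> tc (fun x => c * h x).
Proof.
move=> th ch eps eps0.
have c0 : 0 < `|c| + 1 by rewrite ltr_wpDl.
have [d d0 hd] := ch _ (divr_gt0 eps0 c0); exists d => // z /hd.
rewrite ler_pdivlMr//; apply: le_trans; rewrite mulrC -intgZ; last exact: tame_diff_shift.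
apply: ler_intg.
- by apply: (@tame_diff_shift (fun x => c * h x)); exact: tame_scale.
- by apply: tame_scale; exact: tame_diff_shift.
- by move=> x; rewrite -mulrBr normrM ler_wpM2r// lerDl.
Qed.

Lemma tc_approx h : tame h -> (forall eps : R, 0 < eps -> exists s,
  [/\ tame s, tc s & intg (fun x => `|h x - s x|) <= eps]) -> tc h.
Proof.
move=> th hs eps eps0; have e3 : 0 < eps / 3 by rewrite divr_gt0.
have [s [ts cs hsx]] := hs _ e3; have [d d0 hd] := cs _ e3.
exists d => // z /hd zd.
pose r x := `|h x - s x|.
have tr : tame r by apply: tame_norm; exact: tame_sub.
apply: (@le_trans _ _ (intg (fun x => r (x + z)) + intg (fun x => `|s (x + z) - s x|) + intg r)).
  rewrite -intgD; [|exact: tame_shift|exact: tame_diff_shift].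
  rewrite -intgD//; last by apply: tame_add; [exact: tame_shift|exact: tame_diff_shift].
  apply: ler_intg; first exact: tame_diff_shift.
    by apply: tame_add => //; apply: tame_add; [exact: tame_shift|exact: tame_diff_shift].
  move=> x; rewrite /r (_ : h (x + z) - h x =
    h (x + z) - s (x + z) + (s (x + z) - s x) - (h x - s x)); last by ring.
  by rewrite (le_trans (ler_normB _ _))// lerD2r ler_normD.
rewrite intg_shift//; have {}hsx : intg r <= eps / 3 := hsx.
by lra.
Qed.

Lemma tame_bounded_set A (r : R) : measurable A -> A `<=` [set x | `|x| <= r] -> tame (\1_A).
Proof.
move=> mA Ar; split; first exact: measurable_indic.
- by exists 1 => x; rewrite indicE; case: (_ \in _); rewrite ?normr1 ?normr0 ?ler01.
- exists r => x rx; rewrite indicE memNset// => /Ar /=.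
  by rewrite leNgt rx.
Qed.

Lemma tame_inner A (r d : R) : 0 < d -> A `<=` [set x | `|x| <= r] -> tame (\1_(inner A d)).
Proof.
move=> d0 Ar; apply: (@tame_bounded_set _ r); first by apply: closed_measurable_rV; exact: inner_closed.
exact: subset_trans (inner_sub d0) Ar.
Qed.

Lemma inner_exhausts A (r : R) : open A -> A `<=` [set x | `|x| <= r] ->
  intg (fun x => \1_A x - \1_(inner A k.+1%:R^-1) x : R) @[k --> \oo] --> 0.
Proof.
move=> oA Ar; have tA := tame_bounded_set (open_measurable_rV oA) Ar.
have k0 k : 0 < k.+1%:R^-1 :> R by rewrite invr_gt0.
have sub k : inner A (k.+1%:R^-1 : R) `<=` A by exact: inner_sub.
rewrite -(@intg0 R n); apply: (intg_dominated (g := \1_A)) => //.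
- by move=> k; apply: tame_sub => //; exact: tame_inner Ar.
- exact: tame0.
- apply: aeW => x; apply: cvg_near_cst; have [Ax|Ax] := pselect (A x); last first.
    by apply: nearW => k; rewrite !indicE !memNset ?subrr// => /sub.
  have [d d0 xd] := inner_open oA Ax.
  have := near_infty_natSinv_lt (PosNum d0); apply: filterS => k /= kd.
  by rewrite !indicE !mem_set ?subrr//; exact: (innerS (ltW kd)).
- move=> k x; rewrite !indicE; have [xk|xk] := boolP (x \in inner _ _).
    by rewrite mem_set ?subrr ?normr0//; apply: (sub k); exact: set_mem.
  by rewrite subr0 ger0_norm ?ler0n.
Qed.

(** For [|z| < d] the set [inner A d] is translated by [z] into [A], while [A]
    and its translate have the same measure. *)
Lemma tc_open A (r : R) : open A -> A `<=` [set x | `|x| <= r] -> tc (\1_A).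
Proof.
move=> oA Ar eps eps0.
have mA := open_measurable_rV oA.
have tA := tame_bounded_set mA Ar.
have e2 : 0 < eps / 2 by rewrite divr_gt0.
have /cvgrPdist_lt/(_ _ e2)[k _ /(_ k (leqnn k))] := inner_exhausts oA Ar.
have k0 : 0 < k.+1%:R^-1 :> R by rewrite invr_gt0.
have FA : inner A k.+1%:R^-1 `<=` A by exact: inner_sub.
have tF := tame_inner k0 Ar.
rewrite /= sub0r normrN => /ltr_normlW hk.
exists k.+1%:R^-1; first by rewrite invr_gt0.
move=> z zk.
pose D x : R := \1_A x - \1_A x * \1_A (x + z).
have tAz : tame (fun x => \1_A x * \1_A (x + z) : R).
  by apply: tame_mul; [exact: tame_bounded|exact: tame_shift].
have tD : tame D by exact: tame_sub.
have DE : intg (fun x => `|\1_A (x + z) - \1_A x| : R) = intg D + intg D.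
  have {2}-> : intg D = intg (fun x => \1_A (x + z) - \1_A x * \1_A (x + z) : R).
    by rewrite /D !intgB// ?intg_shift//; exact: tame_shift.
  rewrite -intgD//; last by apply: tame_sub => //; exact: tame_shift.
  congr intg; apply/funext => x; rewrite /D !indicE.
  by case: (x \in A); case: (_ \in A); rewrite ?mulr1 ?mulr0 ?mul0r ?subrr ?subr0 ?sub0r ?normrN ?normr1 ?normr0 ?addr0 ?add0r.
rewrite DE [leRHS]splitr; suff : intg D <= eps / 2 by move=> ?; exact: lerD.
apply: le_trans (ltW hk); apply: ler_intg => //; first exact: tame_sub.
move=> x; rewrite /D !indicE; have [xk|xk] := boolP (x \in inner _ _).
  have Ax : A x by apply: FA; exact: set_mem.
  have Axz : A (x + z) by apply: (set_mem xk); rewrite addrAC subrr add0r.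
  by rewrite !mem_set// mulr1 subrr.
case: (x \in A); last by rewrite mul0r subr0.
by rewrite mul1r subr0; case: (_ \in A); rewrite ?subrr ?subr0 ?ler01.
Qed.

Lemma measurable_rVE : @measurable _ 'rV[R]_n = <<s [set A : set 'rV[R]_n | open A] >>.
Proof.
apply/seteqP; split => A.
  have mid : measurable_fun [set: g_sigma_algebraType [set A : set 'rV[R]_n | open A]]
      (id : _ -> 'rV[R]_n).
    apply: measurable_fun_rVP => i.
    apply: (measurability _ (RGenOInfty.measurableE R)).
    move=> _ [_ [r ->] <-]; apply: sub_sigma_algebra => /=.
    rewrite set_itvoy; apply: open_superlevel; first exact: openT.
    by move=> x _; exact: coord_continuous.
  by move=> mA; have := mid measurableT _ mA; rewrite setTI.
apply: smallest_sub; first exact: sigma_algebra_measurable.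
by move=> B; exact: open_measurable_rV.
Qed.

(** Open sets form a pi-system generating the sigma-algebra, and the property passes
    to complements in [B] and to disjoint unions. *)
Lemma tc_measurable A B (r : R) : measurable A -> open B ->
  B `<=` [set x | `|x| <= r] -> tc (\1_(A `&` B)).
Proof.
move=> mA oB Br; have mB := open_measurable_rV oB.
have tI C : measurable C -> tame (\1_(C `&` B)).
  move=> mC; apply: (@tame_bounded_set _ r); first exact: measurableI.
  by move=> x [_ /Br].
apply: (@dynkin_induction _ _ [set A : set 'rV[R]_n | open A]
  [set A | tc (\1_(A `&` B))] measurable_rVE).
- by move=> C D /= oC oD; exact: openI.
- by rewrite /= setTI; exact: tc_open Br.
- by move=> C /= oC; apply: (@tc_open _ r); [exact: openI|move=> x [_ /Br]].
- move=> C mC /= cC.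
  rewrite (_ : \1_(~` C `&` B) = (fun x => \1_B x + -1 * \1_(C `&` B) x)).
    apply: tc_add.
    + exact: tame_bounded_set Br.
    + by apply: tame_scale; exact: tI.
    + exact: tc_open Br.
    + by apply: tc_scale => //; exact: tI.
  apply/funext => x; rewrite !indicE !in_setI in_setC.
  by case: (x \in C); case: (x \in B); rewrite /= ?mulN1r ?subrr ?oppr0 ?addr0 ?mulr0 ?addr0.
- move=> F mF tF cF /=; apply: tc_approx.
    by apply: tI; exact: bigcupT_measurable.
  move=> eps eps0.
  pose U k := \bigcup_(i < k) F i; pose S k : 'rV[R]_n -> R := \1_(U k `&` B).
  have tS k : tame (S k) by apply: tI; exact: bigcup_measurable.
  have US k : S k.+1 = (fun x => S k x + \1_(F k `&` B) x).
    apply/funext => x; rewrite /S /U !bigcup_mkord big_ord_recr /= -bigcup_mkord.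
    rewrite !indicE !in_setI in_setU; case: (x \in B); rewrite ?andbF ?addr0 ?andbT//.
    have [xk|xk] := boolP (x \in F k); last by rewrite orbF addr0.
    rewrite memNset ?add0r// => -[i /= ik Fix].
    have /trivIsetP/(_ i k Logic.I Logic.I) := tF.
    rewrite neq_ltn ik => /(_ isT) /seteqP[+ _] => /(_ x); apply.
    by split => //; exact: set_mem.
  have tcS k : tc (S k).
    elim: k => [|k IH]; last by rewrite US; apply: tc_add => //; [exact: tI|exact: cF].
    move=> e e0; exists 1 => // z _; rewrite /S /U bigcup_mkord big_ord0 set0I indic0.
    by under eq_fun do rewrite subrr normr0; rewrite intg0 ltW.
  have mU : measurable (\bigcup_k F k) by exact: bigcupT_measurable.
  have cS : intg (fun x => `|S k x - \1_(\bigcup_k F k `&` B) x|) @[k --> \oo] --> 0.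
    apply: (intg_dominated_norm tS (tame_bounded_set mB Br) (tI _ mU)); last first.
      move=> k x; rewrite /S !indicE in_setI.
      by case: (x \in B); rewrite ?andbF ?normr0//; case: (_ \in _); rewrite ?normr1 ?normr0 ?ler01.
    apply: aeW => x; apply: cvg_near_cst.
    have [[[i _ Fix] Bx]|Ux] := pselect ((\bigcup_k F k `&` B) x).
      have h2 : (\bigcup_k F k `&` B) x by split => //; exists i.
      near=> k; have h1 : ((\bigcup_(j < k) F j) `&` B) x.
        by split => //; exists i => //=; near: k; exact: nbhs_infty_gt.
      by rewrite /S !indicE (mem_set h1) (mem_set h2).
    apply: nearW => k; rewrite /S !indicE !memNset// => -[[i _ Fix] Bx].
    by apply: Ux; split => //; exists i.
  have /cvgrPdist_lt/(_ _ eps0)[k _ /(_ k (leqnn k))] := cS.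
  rewrite sub0r normrN ger0_norm ?intg_ge0// => /ltW hk.
  by exists (S k); split => //; under eq_fun do rewrite distrC.
- by rewrite -measurable_rVE.
Unshelve. all: by end_near. Qed.

(** Each step removes a third of the remaining range: [h] is compared with the
    levels [C/3] and [-C/3]. *)
Lemma tc_step h (C r : R) : tame h -> (forall x, r < `|x| -> h x = 0) ->
  (forall x, `|h x| <= C) -> exists s,
  [/\ tame s, tc s, forall x, r < `|x| -> s x = 0 &
      forall x, `|h x - s x| <= 2 / 3 * C].
Proof.
move=> [mh bh sh] hr hC.
pose B : set 'rV[R]_n := ball 0 (r + 1).
have Br : B `<=` [set x | `|x| <= r + 1] by move=> x; rewrite /B ball_rVE subr0 => /ltW.
have oB : open B by exact: ball_open.
have mB := open_measurable_rV oB.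
have Bx x : `|x| <= r -> B x by move=> xr; rewrite /B ball_rVE subr0; lra.
clearbody B.
have C0 : 0 <= C by rewrite (le_trans _ (hC 0)).
pose P := [set x | C / 3 < h x]; pose N := [set x | h x < - (C / 3)].
have mP : measurable P.
  rewrite (_ : P = h @^-1` `]C / 3, +oo[); last by apply/seteqP; split => x /=; rewrite in_itv /= andbT.
  by rewrite -[X in measurable X]setTI; exact: mh.
have mN : measurable N.
  rewrite (_ : N = h @^-1` `]-oo, - (C / 3)[); last by apply/seteqP; split => x /=; rewrite in_itv.
  by rewrite -[X in measurable X]setTI; exact: mh.
have tI D : measurable D -> tame (\1_(D `&` B)).
  move=> mD; apply: (@tame_bounded_set _ (r + 1)); first exact: measurableI.
  by move=> x [_ /Br].
pose s x : R := C / 3 * \1_(P `&` B) x + - (C / 3) * \1_(N `&` B) x.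
exists s; split.
- by apply: tame_add; apply: tame_scale; exact: tI.
- apply: tc_add; [by apply: tame_scale; exact: tI|by apply: tame_scale; exact: tI| |].
    by apply: tc_scale; [exact: tI|exact: (tc_measurable _ oB Br)].
  by apply: tc_scale; [exact: tI|exact: (tc_measurable _ oB Br)].
- move=> x xr; rewrite /s !indicE !memNset ?mulr0 ?addr0// => -[]; rewrite /P /N /= hr//; lra.
- move=> x; have [xr|xr] := leP `|x| r; last first.
    rewrite /s hr// !indicE !memNset ?mulr0 ?addr0 ?subrr ?normr0; first by lra.
      by move=> []; rewrite /N /= hr//; lra.
    by move=> []; rewrite /P /= hr//; lra.
  have xB : x \in B by rewrite inE; exact: Bx.
  rewrite /s !indicE !in_setI xB !andbT.
  have := hC x; rewrite !ler_norml => /andP[h1 h2].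
  have [/set_mem|] := boolP (x \in P); have [/set_mem|] := boolP (x \in N);
    rewrite ?notin_setE /P /N /= => a b; apply/andP; split; lra.
Qed.

(** Iterating [tc_step] approximates [h] uniformly, hence in [L^1] since all the
    supports are in one ball. *)
Lemma tame_tc h : tame h -> tc h.
Proof.
move=> th; have [mh [C hC] [r hr]] := th.
have C0 : 0 <= C by rewrite (le_trans _ (hC 0)).
have approx k : exists s, [/\ tame s, tc s, forall x, r < `|x| -> s x = 0 &
      forall x, `|h x - s x| <= (2 / 3) ^+ k * C].
  elim: k => [|k [s [ts cs sr hs]]].
    exists (fun=> 0); split => //; first exact: tame0.
      move=> e e0; exists 1 => // z _.
      by under eq_fun do rewrite subrr normr0; rewrite intg0 ltW.
    by move=> x; rewrite subr0 expr0 mul1r.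
  have [||s' [ts' cs' s'r hs']] := @tc_step (fun x => h x - s x) ((2 / 3) ^+ k * C) r (tame_sub th ts).
  - by move=> x xr; rewrite hr// sr// subrr.
  - by [].
  exists (fun x => s x + s' x); split.
  - exact: tame_add.
  - exact: tc_add.
  - by move=> x xr; rewrite sr// s'r// addr0.
  - by move=> x; rewrite opprD addrA exprS -mulrA.
apply: tc_approx => // eps eps0.
pose b : 'rV[R]_n -> R := \1_[set x | `|x| <= `|r|].
have tb : tame b.
  apply: (@tame_bounded_set _ `|r|) => //; apply: closed_measurable_rV.
  by apply: compact_closed; [exact: norm_hausdorff|exact: compact_norm_le].
have J0 : 0 <= intg b.
  by apply: intg_ge0 => x; rewrite /b indicE ler0n.
have p0 m : 0 <= (2 / 3 : R) ^+ m by apply: exprn_ge0; lra.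
have [k hk] : exists k : nat, (2 / 3) ^+ k * (C * intg b + 1) <= eps.
  have C1 : 0 < C * intg b + 1 by rewrite ltr_wpDl// mulr_ge0.
  have e1 : 0 < eps / (C * intg b + 1) by rewrite divr_gt0.
  have c : (fun k => (2 / 3 : R) ^+ k) @ \oo --> 0 by apply: cvg_expr; rewrite ger0_norm; lra.
  have /cvgrPdist_lt/(_ _ e1)[k _ /(_ k (leqnn k))] := c.
  rewrite sub0r normrN ger0_norm//.
  by rewrite ltr_pdivlMr// => /ltW; exists k.
have [s [ts cs sr hs]] := approx k; exists s; split => //.
apply: le_trans hk; apply: (@le_trans _ _ (intg (fun x => (2 / 3) ^+ k * C * b x))).
  apply: ler_intg; [by apply: tame_norm; exact: tame_sub|exact: tame_scale|].
  move=> x; rewrite /b indicE; have [xr|xr] := leP `|x| `|r|; first by rewrite mem_set// mulr1.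
  have xr' : r < `|x| by rewrite (le_lt_trans (ler_norm r)).
  by rewrite hr// sr// subrr normr0 mulr_ge0 ?ler0n// mulr_ge0.
rewrite intgZ// -mulrA ler_wpM2l//.
by rewrite lerDl.
Qed.

End L1_translation.

Section mollification.
Context {R : realType} {n : nat}.
Local Notation mu := (lebesgue_rV R n).
Implicit Types (g h rho : 'rV[R]_n -> R) (A : set 'rV[R]_n).

Lemma mollify_out h rho (e : R) x : (forall z, e <= `|z| -> rho z = 0) ->
  (forall y, `|y - x| < e -> h y = 0) -> mollify h rho x = 0.
Proof.
move=> rhoe hx; rewrite /mollify -[RHS](@intg0 _ n); congr intg; apply/funext => y.
have [yx|/rhoe ->] := ltP `|y - x| e; last by rewrite mulr0.
by rewrite hx// mul0r.
Qed.

Lemma mollify_tame h rho (e : R) : tame h -> continuous rho ->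
  (forall z, e <= `|z| -> rho z = 0) -> tame (mollify h rho).
Proof.
move=> th crho rhoe; have [_ _ [r hr]] := th.
apply: (@tame_compact _ _ [set x | `|x| <= r + e]).
- exact: compact_norm_le.
- exact: continuous_mollify.
- move=> x /= /negP; rewrite -ltNge => xr; apply: (mollify_out rhoe) => y yx.
  apply: hr; have := ler_normD (y - x) x.
  have := ler_normB y (y - x); rewrite opprB addrCA subrr addr0 => h1 _.
  by have := lt_le_trans xr h1; lra.
Qed.

(** The error is the average, with weights [rho], of the translation errors of [h]:
    Fubini's theorem bounds its integral by the largest of theirs. *)
Lemma mollification_cvg h : tame h -> forall eps : R, 0 < eps ->
  exists2 d : R, 0 < d & forall e rho, e <= d -> mollifier e rho ->
    intg (fun x => `|mollify h rho x - h x|) <= eps.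
Proof.
move=> th eps eps0; have [d d0 hd] := tame_tc th eps0; exists d => // e rho ed mrho.
have trho := tame_mollifier mrho; have [srho rho0 rhoe rho1 _] := mrho.
have crho := smooth_continuous srho.
have tc := mollify_tame th crho rhoe.
have mollifyE x : mollify h rho x = intg (fun z => h (x + z) * rho z).
  rewrite /mollify -(intg_shift x (tame_mollify x th crho)).
  by congr intg; apply/funext => z; rewrite addrK addrC.
have thx x : tame (fun z => h (x + z) * rho z).
  by under eq_fun do rewrite addrC; apply: tame_mul_continuous => //; exact: tame_shift.
pose D x z := `|h (x + z) - h x| * rho z.
have tD x : tame (D x).
  apply: tame_mul => //; split.
    apply: measurableT_comp => //; apply: measurable_funB; last exact: measurable_cst.
    by under eq_fun do rewrite addrC; case: (tame_shift x th).
  have [_ [M hM] _] := th; exists (M + M) => z; rewrite normr_id.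
  by rewrite (le_trans (ler_normB _ _))// lerD.
have le1 x : `|mollify h rho x - h x| <= intg (D x).
  have -> : mollify h rho x - h x = intg (fun z => h (x + z) * rho z - h x * rho z).
    by rewrite intgB//; [rewrite intgZ// rho1 mulr1 mollifyE|exact: tame_scale].
  apply: le_trans (ler_norm_intg _) _.
    by apply: tame_sub => //; exact: tame_scale.
  apply: ler_intg => //; first by apply/tame_norm/tame_sub => //; exact: tame_scale.
  by move=> z; rewrite /D -mulrBl normrM (ger0_norm (rho0 z)).
have mD : measurable_fun [set: 'rV[R]_n * 'rV[R]_n] (fun p => (D p.1 p.2)%:E).
  apply/measurable_EFinP; apply: measurable_funM.
    apply: measurableT_comp => //; apply: measurable_funB.
      by apply: measurableT_comp; [case: th|exact: measurable_add_rV].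
    by apply: measurableT_comp; [case: th|exact: measurable_fst].
  by apply: measurableT_comp; [case: trho|exact: measurable_snd].
have D0 p : (0 <= (D p.1 p.2)%:E)%E by rewrite lee_fin mulr_ge0.
have F := @fubini_tonelli _ _ _ _ R mu mu _ mD D0.
have tN : tame (fun x => `|mollify h rho x - h x|) by apply: tame_norm; exact: tame_sub.
have tDz z : tame (fun x => D x z).
  by under eq_fun do rewrite /D mulrC; apply: tame_scale; exact: tame_diff_shift.
have te : tame (fun z => eps * rho z) by exact: tame_scale.
have DI z : intg (fun x => D x z) <= eps * rho z.
  rewrite /D; have [ze|ze] := ltP `|z| e; last first.
    under eq_fun do rewrite (rhoe z ze) mulr0.
    by rewrite intg0 (rhoe z ze) mulr0.
  under eq_fun do rewrite mulrC.
  rewrite intgZ; last exact: tame_diff_shift.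
  by rewrite mulrC ler_wpM2r//; apply: hd; exact: lt_le_trans ed.
rewrite -lee_fin -(intgE tN).
apply: (@le_trans _ _ (\int[mu]_x \int[mu]_z (D x z)%:E)%E).
  apply: ge0_le_integral; first exact: measurableT.
  - by move=> x _; rewrite lee_fin.
  - by apply/measurable_EFinP; case: tN.
  - exact: (@measurable_fun_fubini_tonelli_F _ _ _ _ R mu _ mD D0).
  - by move=> x _; rewrite (intgE (tD x)) lee_fin.
rewrite F; apply: (@le_trans _ _ (\int[mu]_z (eps * rho z)%:E)%E); last first.
  by rewrite (intgE te) (intgZ _ trho) rho1 mulr1.
apply: ge0_le_integral; first exact: measurableT.
- by move=> z _; apply: integral_ge0 => x _; exact: (D0 (x, z)).
- exact: (@measurable_fun_fubini_tonelli_G _ _ _ _ R mu _ mD D0).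
- by apply/measurable_EFinP; case: te.
- by move=> z _; rewrite (intgE (tDz z)) lee_fin.
Qed.

End mollification.

(** * Test functions, weak gradients and W^{1,1}_0 *)

Section test_functions.
Context {R : realType} {n : nat}.
Local Notation mu := (lebesgue_rV R n).
Variable Omega : set 'rV[R]_n.
Implicit Types (phi psi u h : 'rV[R]_n -> R) (x y : 'rV[R]_n).

Lemma closed_support_out phi x : ~ closed_support phi x -> phi x = 0.
Proof.
move=> cx; apply: contrapT => /eqP p0; apply: cx.
by apply: subset_closure.
Qed.

Lemma test_continuous phi : test_function Omega phi -> continuous phi.
Proof. by case=> /smooth_continuous. Qed.

Lemma test_tame phi : test_function Omega phi -> tame phi.
Proof.
move=> [sphi cphi _]; apply: (tame_compact cphi); first exact: smooth_continuous.
exact: closed_support_out.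
Qed.

Lemma test_out phi x : test_function Omega phi -> ~ Omega x -> phi x = 0.
Proof. by move=> [_ _ s] Ox; apply: closed_support_out => /s. Qed.

Lemma test_sub phi psi : test_function Omega phi -> smooth psi ->
  (forall x, phi x = 0 -> psi x = 0) -> test_function Omega psi.
Proof.
move=> [sphi cphi phiO] spsi h.
have S : closed_support psi `<=` closed_support phi.
  by apply: closure_subset => x /=; apply: contra_neq => /h.
split => //; last exact: subset_trans phiO.
by apply: (subclosed_compact _ cphi S); exact: closed_closure.
Qed.

Lemma test_mul phi psi : test_function Omega phi -> smooth psi ->
  test_function Omega (fun x => phi x * psi x).
Proof.
move=> tphi spsi; apply: (test_sub tphi); last by move=> x ->; rewrite mul0r.
by apply: smooth_mul => //; case: tphi.
Qed.

Lemma partial_support_out phi i x : ~ closed_support phi x -> partial i phi x = 0.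
Proof.
move=> cx; have nx : nbhs x (~` closed_support phi).
  by apply: open_nbhs_nbhs; split => //; apply: closed_openC; exact: closed_closure.
rewrite /partial (@near_eq_derive _ _ _ phi (cst 0)) ?derive_cst//.
by apply: filterS nx => y /closed_support_out.
Qed.

Lemma test_partial phi i : test_function Omega phi -> test_function Omega (partial i phi).
Proof.
move=> [sphi cphi phiO].
have S : closed_support (partial i phi) `<=` closed_support phi.
  rewrite [X in _ `<=` X](closure_id _).1; last exact: closed_closure.
  apply: closure_subset => x /= px; apply: contrapT => /(partial_support_out i) px0.
  by rewrite px0 eqxx in px.
split; first exact: smooth_partial.
- by apply: (subclosed_compact _ cphi S); exact: closed_closure.
- exact: subset_trans phiO.
Qed.

Lemma test0 : test_function Omega (fun=> 0).
Proof.
have E : closed_support (fun _ : 'rV[R]_n => 0 : R) = set0.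
  rewrite /closed_support (_ : [set x | _] = set0) ?closure0//.
  by apply/seteqP; split => // x /=; rewrite eqxx.
by split; [exact: smooth_cst|rewrite E; exact: compact0|rewrite E].
Qed.

Lemma test_add phi psi : test_function Omega phi -> test_function Omega psi ->
  test_function Omega (fun x => phi x + psi x).
Proof.
move=> [s1 c1 O1] [s2 c2 O2].
have S : closed_support (fun x => phi x + psi x) `<=` closed_support phi `|` closed_support psi.
  rewrite -closureU; apply: closure_subset => x /=.
  have [->|? _] := eqVneq (phi x) 0; last by left.
  by rewrite add0r; right.
split; first exact: smooth_add.
- by apply: (subclosed_compact _ (compactU c1 c2) S); exact: closed_closure.
- by move=> x /S [/O1|/O2].
Qed.

Lemma test_mollify h rho (r e d : R) : Omega `<=` [set x | `|x| <= r] -> tame h ->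
  mollifier e rho -> e < d -> (forall x, h x != 0 -> inner Omega d x) ->
  test_function Omega (mollify h rho).
Proof.
move=> Or th [srho _ rhoe _ _] ed hd; have ed0 : 0 < d - e by rewrite subr_gt0.
have suppC : closed_support (mollify h rho) `<=` inner Omega (d - e).
  rewrite [X in _ `<=` X](closure_id _).1; last exact: inner_closed.
  apply: closure_subset => x cx.
  have [[y [/hd yd yx]]|no] := pselect (exists y, h y != 0 /\ `|y - x| < e).
    by apply: (inner_near yd); rewrite distrC; lra.
  move: cx; rewrite /= (mollify_out rhoe) ?eqxx// => y yx.
  by apply: contrapT => /eqP hy; apply: no; exists y.
split; first exact: smooth_mollify; last by move=> x /suppC /(inner_sub ed0).
apply: bounded_closed_compact; last exact: closed_closure.
exists r; split; [exact: num_real|move=> M /ltW rM x /suppC /(inner_sub ed0) /Or /= hx].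
exact: le_trans rM.
Qed.

(** The mollification, at scale [d / 3], of the indicator of the points at distance
    [2 * d / 3] from the complement. *)
Lemma cutoff_exists (r d : R) : Omega `<=` [set x | `|x| <= r] -> 0 < d ->
  exists eta, [/\ test_function Omega eta, forall x, 0 <= eta x <= 1 &
    forall x, inner Omega d x -> eta x = 1].
Proof.
move=> Or d0; have d3 : 0 < d / 3 by rewrite divr_gt0.
have [rho mrho] := @mollifier_exists R n _ d3.
have trho := tame_mollifier mrho; have [srho rho0 rhoe rho1 _] := mrho.
pose S := inner Omega (d / 3 + d / 3).
have SO : S `<=` Omega by apply: inner_sub; lra.
have tS : tame (\1_S).
  apply: (@tame_bounded_set _ _ _ r); last exact: subset_trans Or.
  by apply: closed_measurable_rV; exact: inner_closed.
have crho := smooth_continuous srho.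
have trx x : tame (fun y => rho (y - x)) by exact: tame_shift.
exists (mollify (\1_S) rho); split.
- apply: (test_mollify (d := d / 3 + d / 3) Or tS mrho); first by rewrite ltrDl.
  by move=> x; rewrite indicE pnatr_eq0 eqb0 negbK => /set_mem.
- move=> x; apply/andP; split.
    by apply: intg_ge0 => y; rewrite mulr_ge0// indicE ler0n.
  rewrite -rho1 -(intg_shift (- x) trho); apply: ler_intg => //; first exact: tame_mollify.
  by move=> y; rewrite indicE; case: (y \in S); rewrite ?mul1r ?mul0r.
- move=> x dx; rewrite /mollify -rho1 -(intg_shift (- x) trho); congr intg.
  apply/funext => y; have [yx|/rhoe ->] := ltP `|y - x| (d / 3); last by rewrite mulr0.
  rewrite indicE mem_set ?mul1r//; apply: (inner_near dx); lra.
Qed.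

End test_functions.

Section weak_derivative.
Context {R : realType} {n : nat}.
Local Notation mu := (lebesgue_rV R n).
Variables (Omega : set 'rV[R]_n) (r0 : R).
Hypothesis oOmega : open Omega.
Hypothesis bOmega : Omega `<=` [set x | `|x| <= r0].
Implicit Types (phi psi u h U : 'rV[R]_n -> R) (x y : 'rV[R]_n) (g : 'rV[R]_n -> 'rV[R]_n).

Let mOmega : measurable Omega. Proof. exact: open_measurable_rV. Qed.

(** Integration by parts against a smooth function, by passing to the limit in
    the difference quotients; translation invariance moves them from the test
    function to [v]. *)
Lemma intg_by_parts (v phi G g : 'rV[R]_n -> R) i :
  tame v -> smooth phi -> tame phi -> tame G -> tame g ->
  (\forall x \ae mu, k.+1%:R * (v (x + k.+1%:R^-1 *: delta_mx ord0 i) - v x) * phi x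
      @[k --> \oo] --> G x) ->
  (forall k x, `|k.+1%:R * (v (x + k.+1%:R^-1 *: delta_mx ord0 i) - v x) * phi x| <= g x) ->
  intg (fun x => v x * partial i phi x) = - intg G.
Proof.
move=> tv sphi tphi tG tg cvG leg.
set e : 'rV[R]_n := delta_mx ord0 i.
have cphi := smooth_continuous sphi.
have dphi y : derivable phi y e by exact: smooth_derivable.
have cD : continuous (fun y => 'D_e phi y) by exact: smooth_continuous (smooth_partial i sphi).
have [D1 D2] := is_derive_mollify 0 tv cphi dphi cD.
pose t (k : nat) : R := k.+1%:R^-1.
have t0 : t k @[k --> \oo] --> (0 : R)^'.
  move=> A /= [d /= d0 hd]; have := near_infty_natSinv_lt (PosNum d0).
  apply: filterS => k /= kd; apply: hd; last by rewrite /= gt_eqF// invr_gt0.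
  by rewrite /= sub0r normrN ger0_norm ?invr_ge0.
have Q : k.+1%:R * (mollify v phi (t k *: e) - mollify v phi 0) @[k --> \oo] -->
    - intg (fun x => v x * partial i phi x).
  have -> : - intg (fun x => v x * partial i phi x) = 'D_e (mollify v phi) 0.
    by rewrite D2 /mollify; congr (- intg _); apply/funext => y; rewrite subr0.
  have D1' : (fun h : R => h^-1 *: ((mollify v phi \o shift 0) (h *: e) - mollify v phi 0)) @ 0^'
    --> 'D_e (mollify v phi) 0 by exact: D1.
  have := cvg_comp _ _ t0 D1'.
  rewrite (_ : _ \o _ = (fun k => k.+1%:R * (mollify v phi (t k *: e) - mollify v phi 0))) //.
  by apply/funext => k; rewrite /= addr0 invrK.
have tq k : tame (fun x => k.+1%:R * (v (x + t k *: e) - v x) * phi x).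
  apply: tame_mul_continuous => //; apply: tame_scale; apply: tame_sub => //.
  exact: tame_shift.
have E k : k.+1%:R * (mollify v phi (t k *: e) - mollify v phi 0) =
    intg (fun x => k.+1%:R * (v (x + t k *: e) - v x) * phi x).
  have -> : mollify v phi (t k *: e) = intg (fun x => v (x + t k *: e) * phi x).
    rewrite /mollify -(intg_shift (t k *: e) (tame_mollify (t k *: e) tv cphi)).
    by congr intg; apply/funext => y; rewrite addrK.
  have -> : mollify v phi 0 = intg (fun x => v x * phi x).
    by rewrite /mollify; congr intg; apply/funext => y; rewrite subr0.
  rewrite -intgB; [|by apply: tame_mul_continuous => //; exact: tame_shift|exact: tame_mul_continuous].
  rewrite -intgZ; last first.
    apply: tame_sub; last exact: tame_mul_continuous.
    by apply: tame_mul_continuous => //; exact: tame_shift.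
  by congr intg; apply/funext => y; ring.
have L : intg (fun x => k.+1%:R * (v (x + t k *: e) - v x) * phi x) @[k --> \oo] --> intg G.
  exact: (intg_dominated tq tg tG).
have Q' : intg (fun x => k.+1%:R * (v (x + t k *: e) - v x) * phi x) @[k --> \oo] -->
    - intg (fun x => v x * partial i phi x).
  by under eq_fun do rewrite -E.
have QL := cvg_unique (@Rhausdorff R) Q' L.
by rewrite -QL opprK.
Qed.

(** The identity that defines [weak_gradient], between real-valued integrals. *)
Definition weak_partials U (G : 'I_n -> 'rV[R]_n -> R) :=
  forall phi i, test_function Omega phi ->
    intg (fun x => U x * partial i phi x) = - intg (fun x => G i x * phi x).

Lemma integral_test u U psi : measurable_fun Omega u -> tame U ->
  (\forall x \ae mu, Omega x -> u x = U x) -> test_function Omega psi ->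
  (\int[mu]_(x in Omega) (u x * psi x)%:E)%E = (intg (fun x => U x * psi x))%:E.
Proof.
move=> mu_ tU uU tpsi; have cpsi := test_continuous tpsi.
have tUp := tame_mul_continuous tU cpsi.
rewrite -(intgE tUp) integral_mkcond; apply: ae_eq_integral => //.
- apply/measurable_restrict => //; rewrite setTI.
  apply/measurable_EFinP; apply: measurable_funM => //.
  by apply: (measurable_funS measurableT) => //; exact: continuousT_measurable_rV.
- by apply/measurable_EFinP; case: tUp.
- apply: filterS uU => x uUx _; rewrite patchE; case: ifPn => [/set_mem /uUx ->//|].
  by rewrite notin_setE => xO; rewrite (test_out tpsi xO) mulr0.
Qed.

Lemma loc_integrable_tame u U : measurable_fun Omega u -> tame U ->
  (\forall x \ae mu, Omega x -> u x = U x) -> loc_integrable Omega u.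
Proof.
move=> mu_ tU uU; split => // K cK KO.
have mK : measurable K by apply: closed_measurable_rV; exact: compact_closed.
have muK : measurable_fun K u by exact: measurable_funS mu_.
apply/integrableP; split; first exact/measurable_EFinP.
have iU : mu.-integrable K (EFin \o U).
  by apply: (integrableS measurableT) => //; exact: tame_integrable.
have /integrableP[mUK] := iU; apply: le_lt_trans.
rewrite le_eqVlt; apply/orP; left; apply/eqP; apply: ae_eq_integral => //.
- by apply: measurableT_comp => //; exact/measurable_EFinP.
- exact: measurableT_comp.
- by apply: filterS uU => x uUx /KO /uUx /= ->.
Qed.

Lemma weak_gradient_tame u g U G : measurable_fun Omega u -> tame U ->
  (\forall x \ae mu, Omega x -> u x = U x) ->
  (forall i, measurable_fun Omega (fun x => g x ord0 i)) -> (forall i, tame (G i)) ->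
  (forall i, \forall x \ae mu, Omega x -> g x ord0 i = G i x) ->
  weak_partials U G -> weak_gradient Omega u g.
Proof.
move=> mu_ tU uU mg tG gG w; split.
- exact: loc_integrable_tame uU.
- by move=> i; exact: loc_integrable_tame (gG i).
- move=> phi i tphi; rewrite (integral_test mu_ tU uU); last exact: test_partial.
  by rewrite (integral_test (mg i) (tG i) (gG i))// w.
Qed.

Lemma weak_partials_of_gradient u g U G : weak_gradient Omega u g -> tame U ->
  (\forall x \ae mu, Omega x -> u x = U x) -> (forall i, tame (G i)) ->
  (forall i, \forall x \ae mu, Omega x -> g x ord0 i = G i x) ->
  weak_partials U G.
Proof.
move=> [[mu_ _] lg w] tU uU tG gG phi i tphi; apply: EFin_inj.
rewrite EFinN -(integral_test mu_ tU uU); last exact: test_partial.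
have [mgi _] := lg i.
by rewrite -(integral_test mgi (tG i) (gG i))// w.
Qed.

Lemma loc_integrable_test u psi : loc_integrable Omega u -> test_function Omega psi ->
  mu.-integrable Omega (fun x => (u x * psi x)%:E).
Proof.
move=> [mu_ iu] tpsi; have [_ cK KO] := tpsi.
have := iu _ cK KO; set K := closed_support psi => iK.
have mK : measurable K by apply: closed_measurable_rV; exact: compact_closed.
have [mpsi [M hM] _] := test_tame tpsi.
apply/(integrable_mkcond _ mOmega).
rewrite (_ : _ \_ _ = (fun x => (u x * psi x)%:E) \_ K); last first.
  apply/funext => x; rewrite !patchE.
  have [xK|xK] := boolP (x \in K).
    by rewrite mem_set//; apply: KO; exact: set_mem.
  have p0 : psi x = 0 by apply: closed_support_out; move: xK; rewrite notin_setE.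
  by rewrite p0 mulr0 if_same.
apply/(integrable_mkcond _ mK).
apply: (@le_integrable _ _ _ _ _ mK _ (fun x => (M * u x)%:E)).
- apply/measurable_EFinP; apply: measurable_funM; last exact: (measurable_funS measurableT).
  exact: measurable_funS mu_.
- move=> x Kx; rewrite lee_fin mulrC !normrM ler_wpM2r//.
  by rewrite (le_trans (hM x))// ler_norm.
- by under eq_fun do rewrite EFinM; exact: integrableZl.
Qed.

Lemma loc_integrable_add u u' : loc_integrable Omega u -> loc_integrable Omega u' ->
  loc_integrable Omega (fun x => u x + u' x).
Proof.
move=> [m1 i1] [m2 i2]; split; first exact: measurable_funD.
move=> K cK KO; have mK : measurable K by apply: closed_measurable_rV; exact: compact_closed.
by rewrite (_ : _ \o _ = (EFin \o u) \+ (EFin \o u'))%E //; apply: integrableD => //; [exact: i1|exact: i2].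
Qed.

Lemma weak_gradient_add u u' g g' : weak_gradient Omega u g -> weak_gradient Omega u' g' ->
  weak_gradient Omega (fun x => u x + u' x) (fun x => g x + g' x).
Proof.
move=> [lu lg w] [lu' lg' w']; split.
- exact: loc_integrable_add.
- by move=> i; under eq_fun do rewrite mxE; exact: loc_integrable_add.
- move=> phi i tphi; have tp := test_partial i tphi.
  under eq_integral do rewrite mulrDl EFinD.
  rewrite integralD//; [|exact: loc_integrable_test|exact: loc_integrable_test].
  rewrite w// w'//.
  under [in RHS]eq_integral do rewrite mxE mulrDl EFinD.
  rewrite integralD//; [|exact: loc_integrable_test|exact: loc_integrable_test].
  rewrite oppeD// fin_num_adde_defr//.
  by apply: integrable_fin_num => //; exact: loc_integrable_test.
Qed.

Lemma ess_sup_on_leP (h : 'rV[R]_n -> \bar R) (c : \bar R) :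
  (ess_sup_on Omega h <= c)%E <-> (\forall x \ae mu, Omega x -> (h x <= c)%E).
Proof.
split.
  move=> /ess_supP; apply: filterS => x + Ox.
  by rewrite mem_set.
move=> hc; apply/ess_supP; apply: filterS hc => x hx.
by case: ifPn => [/set_mem /hx//|_]; exact: leNye.
Qed.

Lemma ess_boundedP u : ess_bounded Omega u <->
  measurable_fun Omega u /\ exists M : R, \forall x \ae mu, Omega x -> `|u x| <= M.
Proof.
split=> -[mu_ h]; split => //.
  pose s := ess_sup_on Omega (fun x => `|u x|%:E).
  exists (fine (maxe s 0)).
  have /ess_sup_on_leP : (s <= maxe s 0)%E by rewrite le_max lexx.
  apply: filterS => x /[apply]; rewrite -lee_fin fineK//.
  rewrite ge0_fin_numE ?le_max ?lexx ?orbT//.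
  by rewrite gt_max h ltry.
have [M hM] := h; apply: (@le_lt_trans _ _ M%:E); last exact: ltry.
by apply/ess_sup_on_leP; apply: filterS hM => x /[apply]; rewrite lee_fin.
Qed.

Lemma tame_representative u (M : R) : measurable_fun Omega u ->
  (\forall x \ae mu, Omega x -> `|u x| <= M) ->
  exists U, [/\ tame U, \forall x \ae mu, Omega x -> u x = U x &
    forall x, ~ Omega x -> U x = 0].
Proof.
move=> mu_ uM; pose A := Omega `&` (fun x => u x) @^-1` `[- M, M].
have mA : measurable A by apply: mu_ => //; exact: measurable_itv.
exists (u \_ A); split.
- apply: (@tame_indic _ _ A u r0) => //.
  - by move=> x [/bOmega].
  - by apply: (measurable_funS mOmega) => // x [].
  - by exists M => x [_ /=]; rewrite in_itv /= -ler_norml.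
- apply: filterS uM => x uMx Ox; rewrite patchE mem_set//; split => //=.
  by rewrite in_itv /= -ler_norml uMx.
- by move=> x Ox; rewrite patchE memNset// => -[].
Qed.

End weak_derivative.

Lemma ae_forall_count d (T : measurableType d) (R : realType)
    (mu : {measure set T -> \bar R}) (J : countType) (P : J -> T -> Prop) :
  (forall j, \forall x \ae mu, P j x) -> \forall x \ae mu, forall j, P j x.
Proof.
move=> hP.
have : \forall x \ae mu, forall k : nat, forall j, pickle j = k -> P j x.
  apply: ae_foralln => k.
  have [[j jk]|no] := pselect (exists j : J, pickle j = k).
    apply: filterS (hP j) => x Pjx j' j'k.
    by rewrite (_ : j' = j)//; apply: (pcan_inj pickleK); rewrite jk.
  by apply: aeW => x j jk; case: no; exists j.
by apply: filterS => x h j; exact: (h _ j erefl).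
Qed.

Lemma lteD_half (R : realType) (a b a' b' : \bar R) (e : R) :
  (a + b < (e / 2)%:E -> a' + b' < (e / 2)%:E -> (a + a') + (b + b') < e%:E)%E.
Proof. by move=> h h'; rewrite addeACA [e]splitr EFinD; exact: lteD. Qed.

Section W11_zero.
Context {R : realType} {n : nat}.
Local Notation mu := (lebesgue_rV R n).
Variables (Omega : set 'rV[R]_n) (r0 : R).
Hypothesis oOmega : open Omega.
Hypothesis bOmega : Omega `<=` [set x | `|x| <= r0].
Implicit Types (phi psi u h U : 'rV[R]_n -> R) (x y : 'rV[R]_n) (g : 'rV[R]_n -> 'rV[R]_n).

Let mOmega : measurable Omega. Proof. exact: open_measurable_rV. Qed.

Lemma compact_inner (K : set 'rV[R]_n) : compact K -> K `<=` Omega ->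
  exists2 d : R, 0 < d & K `<=` inner Omega d.
Proof.
move=> /compact_near_coveringP cK KO.
have /nbhs_ballP[d /= d0 hd] : nbhs (0 : 'rV[R]_n) [set z | K `<=` [set y | Omega (y + z)]].
  apply: (cK _ (nbhs (0 : 'rV[R]_n)) (fun z y => Omega (y + z))) => y Ky.
  have [d d0 yd] := inner_open oOmega (KO _ Ky).
  have d20 : 0 < d / 2 by rewrite divr_gt0.
  exists (ball y (d / 2), ball 0 (d / 2)).
    by split; exact: nbhsx_ballx.
  move=> [y' z] /= []; rewrite !ball_rVE subr0 => yy' z0.
  apply: yd; rewrite addrAC (le_lt_trans (ler_normD _ _))// [ltRHS]splitr.
  exact: ltrD.
exists d => // x Kx y yx; rewrite -(subrK x y) addrC; apply: hd => //.
by rewrite ball_rVE subr0.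
Qed.

Lemma quotient_shift psi a v x :
  (fun h : R => h^-1 *: (((fun y => psi (y - a)) \o shift x) (h *: v) - psi (x - a))) =
  (fun h : R => h^-1 *: ((psi \o shift (x - a)) (h *: v) - psi (x - a))).
Proof. by apply/funext => h /=; rewrite addrA. Qed.

Lemma derive_shift_rV psi a v x : 'D_v (fun y => psi (y - a)) x = 'D_v psi (x - a).
Proof. by rewrite /derive quotient_shift. Qed.

Lemma Ck_shift k psi a : Ck k psi -> Ck k (fun y => psi (y - a)).
Proof.
elim: k psi => [|k IH] psi [cpsi dpsi]; first by split => //; exact: continuous_shift.
split; first exact: continuous_shift.
move=> i; have [di Ci] := dpsi i; split => [x|].
  by rewrite /derivable quotient_shift; exact: di.
rewrite (_ : partial i _ = (fun y => partial i psi (y - a))); first exact: IH.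
by apply/funext => x; exact: derive_shift_rV.
Qed.

Lemma smooth_shift psi a : smooth psi -> smooth (fun y => psi (y - a)).
Proof. by move=> s k; exact: Ck_shift. Qed.

(** Since [eta * rho (. - x)] is a test function, the derivatives of the
    mollification can be transferred to [U]. *)
Lemma partial_mollify_cutoff U G eta rho i x : tame U -> (forall i, tame (G i)) ->
  weak_partials Omega U G -> test_function Omega eta -> smooth rho ->
  partial i (mollify (fun y => eta y * U y) rho) x =
  mollify (fun y => eta y * G i y + U y * partial i eta y) rho x.
Proof.
move=> tU tG w teta srho; have [seta _ _] := teta.
have ceta := smooth_continuous seta.
have crho := smooth_continuous srho.
have tUe : tame (fun y => eta y * U y).
  by under eq_fun do rewrite mulrC; exact: tame_mul_continuous.
have tGe : tame (fun y => eta y * G i y).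
  by under eq_fun do rewrite mulrC; exact: tame_mul_continuous.
have cpeta : continuous (partial i eta) by exact/smooth_continuous/smooth_partial.
have cprho : continuous (partial i rho) by exact/smooth_continuous/smooth_partial.
have tUp : tame (fun y => U y * partial i eta y) by exact: tame_mul_continuous.
rewrite partial_mollify//.
have srx := smooth_shift x srho.
have tt := test_mul teta srx.
have := w _ i tt.
rewrite (_ : (fun y => U y * partial i _ y) = (fun y =>
    (eta y * U y) * partial i rho (y - x) + (U y * partial i eta y) * rho (y - x))); last first.
  apply/funext => y; rewrite partial_mul// /partial derive_shift_rV -/(partial i rho _).
  by rewrite -/(partial i eta _); ring.
rewrite intgD; [|exact: tame_mollify|exact: tame_mollify] => E.
rewrite (_ : mollify (fun y => _ + _) rho x = intg (fun y => eta y * G i y * rho (y - x) +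
    U y * partial i eta y * rho (y - x))); last first.
  by rewrite /mollify; congr intg; apply/funext => y; rewrite mulrDl.
rewrite intgD; [|exact: tame_mollify|exact: tame_mollify].
move: E; set a := intg (fun y => eta y * U y * _); set b := intg (fun y => U y * _ * _).
rewrite (_ : intg (fun y => G i y * _) = intg (fun y => eta y * G i y * rho (y - x))).
  by rewrite /mollify -/a; move: (intg _) => c E; lra.
by congr intg; apply/funext => y; ring.
Qed.

Lemma measurable_enorm (h : 'rV[R]_n -> 'rV[R]_n) :
  (forall i, measurable_fun Omega (fun x => h x ord0 i)) ->
  measurable_fun Omega (fun x => enorm (h x)).
Proof.
move=> mh; rewrite (_ : (fun x => _) = (@Num.sqrt R) \o (fun x => dotv (h x) (h x))) //.
apply: measurableT_comp; first by apply: continuous_measurable_fun; exact: sqrt_continuous.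
apply: measurable_sum => i; exact: measurable_funM.
Qed.

Lemma le_integral_intg (f F : 'rV[R]_n -> R) : measurable_fun Omega f -> (forall x, 0 <= f x) ->
  tame F -> (forall x, 0 <= F x) -> (\forall x \ae mu, Omega x -> f x <= F x) ->
  (\int[mu]_(x in Omega) (f x)%:E <= (intg F)%:E)%E.
Proof.
move=> mf f0 tF F0 fF; rewrite -(intgE tF) integral_mkcond.
apply: ae_ge0_le_integral => //.
- by move=> x _; rewrite patchE; case: ifP => // _; rewrite lee_fin.
- by apply/measurable_restrict => //; rewrite setTI; exact/measurable_EFinP.
- by move=> x _; rewrite lee_fin.
- by apply/measurable_EFinP; case: tF.
- apply: filterS fF => x fFx _; rewrite patchE; case: ifPn => [/set_mem /fFx|_]; by rewrite lee_fin.
Qed.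

(** If the cutoffs of [U] approximate it in [W^{1,1}], so do their mollifications,
    which are test functions. *)
Lemma W11_0_cutoff u g U G : weak_gradient Omega u g -> tame U ->
  (\forall x \ae mu, Omega x -> u x = U x) -> (forall i, tame (G i)) ->
  (forall i, \forall x \ae mu, Omega x -> g x ord0 i = G i x) ->
  weak_partials Omega U G ->
  (forall eps : R, 0 < eps -> exists eta, test_function Omega eta /\
    intg (fun x => `|U x - eta x * U x|) +
    \sum_i intg (fun x => `|G i x - (eta x * G i x + U x * partial i eta x)|) <= eps) ->
  W11_0 Omega u.
Proof.
move=> wug tU uU tG gG w app.
have [[mu_ _] lg _] := wug.
exists g; split => //.
- apply/integrableP; split; first exact/measurable_EFinP.
  apply: (@le_lt_trans _ _ (intg (fun x => `|U x|))%:E); last exact: ltry.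
  apply: le_integral_intg => //; [exact: measurableT_comp|exact: tame_norm|].
  by apply: filterS uU => x /[apply] ->.
- move=> i; have [mgi _] := lg i.
  apply/integrableP; split; first exact/measurable_EFinP.
  apply: (@le_lt_trans _ _ (intg (fun x => `|G i x|))%:E); last exact: ltry.
  apply: le_integral_intg => //; [exact: measurableT_comp|exact: tame_norm|].
  by apply: filterS (gG i) => x /[apply] ->.
move=> eps eps0.
have e4 : 0 < eps / 4 by rewrite divr_gt0.
have [eta [teta heta]] := app _ e4.
have [seta Keta KO] := teta.
have ceta := smooth_continuous seta.
have [d d0 Kd] := compact_inner Keta KO.
pose h y := eta y * U y.
pose H i y := eta y * G i y + U y * partial i eta y.
have th : tame h by rewrite /h; under eq_fun do rewrite mulrC; exact: tame_mul_continuous.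
have tH i : tame (H i).
  apply: tame_add.
    by under eq_fun do rewrite mulrC; exact: tame_mul_continuous.
  by apply: tame_mul_continuous => //; exact/smooth_continuous/smooth_partial.
have e4n : 0 < eps / 4 / n.+1%:R by rewrite divr_gt0.
have [d1 d10 hd1] := mollification_cvg th e4.
have /choice[d2 hd2] : forall i, exists d' : R, 0 < d' /\
    forall (e : R) (rho : 'rV[R]_n -> R), e <= d' -> mollifier e rho ->
    intg (fun x => `|mollify (H i) rho x - H i x|) <= eps / 4 / n.+1%:R.
  by move=> i; have [d' d'0 hd'] := mollification_cvg (tH i) e4n; exists d'.
pose e := \big[Num.min/Num.min (d / 2) d1]_i d2 i.
have e0 : 0 < e.
  rewrite /e; elim/big_ind : _ => //.
  - by rewrite lt_min d10 andbT divr_gt0.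
  - by move=> a b a0 b0; rewrite lt_min a0.
  - by move=> i _; have [] := hd2 i.
have ed : e <= d / 2 by rewrite (le_trans (bigmin_le_id _ _ _ _))// ge_min lexx.
have ed1 : e <= d1 by rewrite (le_trans (bigmin_le_id _ _ _ _))// ge_min lexx orbT.
have ed2 i : e <= d2 i by exact: bigmin_le_cond.
have [rho mrho] := @mollifier_exists R n _ e0; have [srho _ _ _ _] := mrho.
pose phi := mollify h rho.
have tphi : test_function Omega phi.
  apply: (test_mollify (d := d) bOmega th mrho); first by lra.
  move=> x; rewrite /h mulf_eq0 negb_or => /andP[ex _]; apply: Kd.
  by apply: contrapT => /closed_support_out ex0; rewrite ex0 eqxx in ex.
exists phi; split => //.
have tphi' := test_tame tphi.
have tpphi i := test_tame (test_partial i tphi).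
have pphiE i : partial i phi = mollify (H i) rho.
  by apply/funext => x; exact: partial_mollify_cutoff.
have cphi := test_continuous tphi.
have mphi : measurable_fun Omega phi.
  by apply: (measurable_funS measurableT) => //; exact: continuousT_measurable_rV.
have mpphi i : measurable_fun Omega (partial i phi).
  apply: (measurable_funS measurableT) => //; apply: continuousT_measurable_rV.
  exact: test_continuous (test_partial i tphi).
have A1 : (\int[mu]_(x in Omega) `|u x - phi x|%:E <= (intg (fun x => `|U x - phi x|))%:E)%E.
  apply: le_integral_intg => //.
  - by apply: measurableT_comp => //; exact: measurable_funB.
  - by apply: tame_norm; exact: tame_sub.
  - by apply: filterS uU => x /[apply] ->.
have A2 : (\int[mu]_(x in Omega) (enorm (g x - gradient phi x))%:E <=
    (intg (fun x => \sum_i `|G i x - partial i phi x|))%:E)%E.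
  apply: le_integral_intg => //.
  - apply: measurable_enorm => i.
    under eq_fun do rewrite !mxE; apply: measurable_funB => //.
    by have [] := lg i.
  - by move=> x; exact: sqrtr_ge0.
  - by apply: tame_sum => i; apply: tame_norm; exact: tame_sub.
  - by move=> x; exact: sumr_ge0.
  - have : \forall x \ae mu, forall i, Omega x -> g x ord0 i = G i x.
      exact: ae_forall_count.
    apply: filterS => x gGx Ox; apply: le_trans (le_enorm_sum _) _.
    by apply: ler_sum => i _; rewrite !mxE gGx.
apply: le_lt_trans (leeD A1 A2) _; rewrite -EFinD lte_fin.
have tUh : tame (fun x => `|U x - h x|) by apply: tame_norm; exact: tame_sub.
have thp : tame (fun x => `|phi x - h x|) by apply: tame_norm; exact: tame_sub.
have tGH i : tame (fun x => `|G i x - H i x|) by apply: tame_norm; exact: tame_sub.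
have tHp i : tame (fun x => `|partial i phi x - H i x|) by apply: tame_norm; exact: tame_sub.
have tGp i : tame (fun x => `|G i x - partial i phi x|) by apply: tame_norm; exact: tame_sub.
have B1 : intg (fun x => `|U x - phi x|) <= intg (fun x => `|U x - h x|) + eps / 4.
  apply: le_trans (lerD (lexx _) (hd1 e rho ed1 mrho)).
  rewrite -intgD//; apply: ler_intg; [by apply: tame_norm; exact: tame_sub|exact: tame_add|].
  by move=> x; rewrite (distrC (phi x)) ler_distD.
have B2 : intg (fun x => \sum_i `|G i x - partial i phi x|) <=
    \sum_i intg (fun x => `|G i x - H i x|) + eps / 4.
  rewrite intg_sum//.
  apply: (@le_trans _ _ (\sum_(i < n) (intg (fun x => `|G i x - H i x|) + eps / 4 / n.+1%:R))).
    apply: ler_sum => i _; have [_ hi] := hd2 i.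
    apply: le_trans (lerD (lexx _) (hi e rho (ed2 i) mrho)).
    rewrite -pphiE -intgD//; apply: ler_intg => //; first exact: tame_add.
    by move=> x; rewrite (distrC (partial i phi x)) ler_distD.
  rewrite big_split /= lerD2l sumr_const card_ord -[leLHS]mulr_natr.
  by rewrite mulrAC ler_pdivrMr// ler_wpM2l ?(ltW e4)// ler_nat.
by move: heta B1 B2; rewrite -/h -/H; lra.
Qed.

Lemma le_integralD (f f1 f2 : 'rV[R]_n -> R) : measurable_fun Omega f -> measurable_fun Omega f1 ->
  measurable_fun Omega f2 -> (forall x, 0 <= f x) -> (forall x, 0 <= f1 x) ->
  (forall x, 0 <= f2 x) -> (forall x, f x <= f1 x + f2 x) ->
  (\int[mu]_(x in Omega) (f x)%:E <=
   \int[mu]_(x in Omega) (f1 x)%:E + \int[mu]_(x in Omega) (f2 x)%:E)%E.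
Proof.
move=> mf m1 m2 f0 f10 f20 ff.
rewrite -ge0_integralD//; last 4 first.
- by move=> x _; rewrite lee_fin.
- exact/measurable_EFinP.
- by move=> x _; rewrite lee_fin.
- exact/measurable_EFinP.
apply: ge0_le_integral => //.
- by move=> x _; rewrite lee_fin.
- exact/measurable_EFinP.
- by apply: emeasurable_funD; exact/measurable_EFinP.
- by move=> x _; rewrite -EFinD lee_fin.
Qed.

Lemma enormD x y : enorm (x + y) <= enorm x + enorm y.
Proof.
have ex : 0 <= enorm x by exact: sqrtr_ge0.
have ey : 0 <= enorm y by exact: sqrtr_ge0.
have sx : enorm x ^+ 2 = dotv x x by rewrite sqr_sqrtr// dotv_ge0.
have sy : enorm y ^+ 2 = dotv y y by rewrite sqr_sqrtr// dotv_ge0.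
have cs : dotv x y <= enorm x * enorm y.
  have [->|x0] := eqVneq x 0; first by rewrite dotvC dotv0r mulr_ge0 ?sqrtr_ge0.
  have [->|y0] := eqVneq y 0; first by rewrite dotv0r mulr_ge0 ?sqrtr_ge0.
  have x1 : 0 < enorm x by rewrite sqrtr_gt0 dotv_gt0.
  have y1 : 0 < enorm y by rewrite sqrtr_gt0 dotv_gt0.
  have := dotv_ge0 (enorm y *: x - enorm x *: y).
  rewrite !(dotvBr, dotvBl, dotvZr, dotvZl) -sx -sy (dotvC y x).
  rewrite (_ : _ - _ = 2 * (enorm x * enorm y) * (enorm x * enorm y - dotv x y)); last by ring.
  by rewrite pmulr_rge0 ?subr_ge0// !mulr_gt0.
rewrite -(ler_pXn2r (n := 2)) ?nnegrE ?addr_ge0// ?sqrtr_ge0//.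
rewrite {1}/enorm sqr_sqrtr ?dotv_ge0// !(dotvDr, dotvDl) (dotvC y x) sqrrD sx sy.
by move: cs; rewrite mulr2n; lra.
Qed.

Lemma W11_0_add u u' : W11_0 Omega u -> W11_0 Omega u' -> W11_0 Omega (fun x => u x + u' x).
Proof.
move=> [g [w iu ig app]] [g' [w' iu' ig' app']].
exists (fun x => g x + g' x); split.
- exact: weak_gradient_add.
- by rewrite (_ : _ \o _ = (EFin \o u) \+ (EFin \o u'))%E //; exact: integrableD.
- move=> i; rewrite (_ : (fun x => _) =
    (fun x => (g x ord0 i)%:E) \+ (fun x => (g' x ord0 i)%:E))%E; first exact: integrableD.
  by apply/funext => x; rewrite mxE EFinD.
move=> eps eps0; have e2 : 0 < eps / 2 by rewrite divr_gt0.
have [phi [tphi h]] := app _ e2; have [phi' [tphi' h']] := app' _ e2.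
exists (fun x => phi x + phi' x); split; first exact: test_add.
have [[mu_ _] lg _] := w; have [[mu_' _] lg' _] := w'.
have mt psi : test_function Omega psi -> measurable_fun Omega psi.
  move=> tp; apply: (measurable_funS measurableT) => //; apply: continuousT_measurable_rV.
  exact: test_continuous tp.
have mp := mt _ tphi; have mp' := mt _ tphi'.
have mg i : measurable_fun Omega (fun x => g x ord0 i) by have [] := lg i.
have mg' i : measurable_fun Omega (fun x => g' x ord0 i) by have [] := lg' i.
have mpp i := mt _ (test_partial i tphi).
have mpp' i := mt _ (test_partial i tphi').
have gradD x : gradient (fun x => phi x + phi' x) x = gradient phi x + gradient phi' x.
  apply/rowP => i; rewrite !mxE /partial deriveD//.
    by apply: smooth_derivable; case: tphi.
  by apply: smooth_derivable; case: tphi'.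
have a1 : measurable_fun Omega (fun x => enorm (g x - gradient phi x)).
  by apply: measurable_enorm => i; under eq_fun do rewrite !mxE; exact: measurable_funB.
have a2 : measurable_fun Omega (fun x => enorm (g' x - gradient phi' x)).
  by apply: measurable_enorm => i; under eq_fun do rewrite !mxE; exact: measurable_funB.
have A1 : (\int[mu]_(x in Omega) (`|u x + u' x - (phi x + phi' x)|)%:E <=
    \int[mu]_(x in Omega) (`|u x - phi x|)%:E +
    \int[mu]_(x in Omega) (`|u' x - phi' x|)%:E)%E.
  apply: le_integralD => //.
  - by apply: measurableT_comp => //; apply: measurable_funB; exact: measurable_funD.
  - by apply: measurableT_comp => //; exact: measurable_funB.
  - by apply: measurableT_comp => //; exact: measurable_funB.
  - by move=> x; rewrite opprD addrACA ler_normD.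
have A2 : (\int[mu]_(x in Omega) (enorm (g x + g' x - gradient (fun x => phi x + phi' x) x))%:E <=
    \int[mu]_(x in Omega) (enorm (g x - gradient phi x))%:E +
    \int[mu]_(x in Omega) (enorm (g' x - gradient phi' x))%:E)%E.
  apply: (@le_integralD _ (fun x => enorm (g x - gradient phi x)) (fun x => enorm (g' x - gradient phi' x))).
  - apply: measurable_enorm => i.
    rewrite (_ : (fun x => _) = (fun x => g x ord0 i + g' x ord0 i -
        (partial i phi x + partial i phi' x))); last first.
      by apply/funext => x; rewrite gradD !mxE.
    by apply: measurable_funB; exact: measurable_funD.
  - exact: a1.
  - exact: a2.
  - by move=> x; exact: sqrtr_ge0.
  - by move=> x; exact: sqrtr_ge0.
  - by move=> x; exact: sqrtr_ge0.
  - by move=> x; rewrite gradD opprD addrACA enormD.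
apply: le_lt_trans (leeD A1 A2) _.
exact: lteD_half h h'.
Qed.

End W11_zero.

(** * Level convexity *)

Section level_sets.
Context {R : realType} {n : nat}.
Local Notation vec := 'rV[R]_n.+1.
Implicit Types (f : vec -> R) (xi z e : vec) (E : seq vec).

Local Open Scope convex_scope.

Lemma conv_vecE (x y : convex_lmodType vec) (l : {i01 R}) :
  x <| l |> y = l%:inum *: (x : vec) + (1 - l%:inum) *: (y : vec).
Proof. by []. Qed.

Lemma norm_attained z : exists i, `|z ord0 i| = `|z|.
Proof.
have [->|z0] := eqVneq z 0.
  by exists ord0; rewrite mxE !normr0.
have [] := mx_norm_neq0 (x := z); first by apply: contra_neq z0; exact: mx_norm_eq0.
by case=> i j /= h; exists j; rewrite (ord1 i) in h; exact: (esym h).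
Qed.

Lemma compact_net (K : set vec) (r : R) : compact K -> 0 < r ->
  exists s : seq vec, (forall x, x \in s -> K x) /\
    forall x, K x -> exists2 y, y \in s & `|x - y| < r.
Proof.
move=> + r0; rewrite compact_cover => /(_ _ K (fun y => ball y r)) [].
- by move=> y _; exact: ball_open.
- by move=> x Kx; exists x => //; exact: ballxx.
move=> D' D'K cov; exists (finmap.enum_fset D'); split.
  by move=> x /D'K; rewrite inE.
by move=> x /cov[y /= yD]; rewrite ball_rVE => xy; exists y.
Qed.

(** The points whose ball of radius [delta], for the [l^1] norm dual to the sup norm,
    lies in the convex hull of [E]: an inclusion of convex sets amounts to an
    inequality between their support functions. *)
Definition hull_dir E (delta : R) : set vec :=
  [set xi | forall z, exists2 e, e \in E & dotv xi z + delta * `|z| <= dotv e z].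

(** The sublevel set is compact; [E] consists of a finite net of it moved by
    [tau] along the coordinate axes in both directions, so that whatever the
    direction [z] some point of [E] lies beyond the sublevel set by
    [tau / 2]. *)
Lemma sublevel_hull_dir f (gamma : R -> R) (c c' : R) : continuous f ->
  gamma t @[t --> +oo] --> +oo -> (forall xi, gamma (enorm xi) <= f xi) -> c < c' ->
  exists E (delta : R), [/\ 0 < delta, forall e, e \in E -> f e <= c' &
    [set xi | f xi <= c] `<=` hull_dir E delta].
Proof.
move=> cf gammay gf cc'.
pose L := [set xi | f xi <= c].
have cL : compact L.
  apply: bounded_closed_compact.
    have /cvgryPgt/(_ c)[T [_ hT]] := gammay.
    exists T; split; first exact: num_real.
    move=> M TM xi /= fxi; apply: ltW; apply: le_lt_trans TM.
    rewrite leNgt; apply/negP => Txi.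
    have := hT (enorm xi) (lt_le_trans Txi (le_norm_enorm xi)).
    by rewrite ltNge (le_trans (gf xi)).
  by apply: (@preimage_closed _ _ f [set y | y <= c]); [move=> x _; exact: cf|exact: closed_le].
have e0 : 0 < c' - c by rewrite subr_gt0.
have [tau0 tau00 htau] := near_translate_unif cL cf e0.
pose tau := tau0 / 2; have tau_gt0 : 0 < tau by rewrite divr_gt0.
have r0 : 0 < tau / 2 / n.+1%:R by rewrite !divr_gt0.
have [s [sL hs]] := compact_net cL r0.
pose dir (p : bool * 'I_n.+1) : vec := ((-1) ^+ p.1 * tau) *: delta_mx ord0 p.2.
exists [seq x + dir p | x <- s, p <- enum {: bool * 'I_n.+1}], (tau / 2); split.
- by rewrite divr_gt0.
- move=> e /allpairsP[[x p] /= [xs _ ->]].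
  have := htau x (dir p) (sL _ xs) _; rewrite /dir normrZ normrM normrX normrN normr1 expr1n mul1r.
  rewrite gtr0_norm// => /(_ _)/wrap[].
    apply: (@le_lt_trans _ _ (tau * 1)); last by rewrite mulr1 /tau; lra.
    by rewrite ler_wpM2l ?(ltW tau_gt0)// norm_delta_mx.
  have := sL _ xs; rewrite /L /= => fx; rewrite ler_norml => /andP[_].
  by move: fx; lra.
- move=> xi fxi z; have [y ys xiy] := hs _ fxi.
  have [i zi] := norm_attained z.
  exists (y + dir (z ord0 i < 0, i)).
    by apply/allpairsP; exists (y, (z ord0 i < 0, i)); rewrite mem_enum.
  rewrite dotvDl dotvZl (dotvC (delta_mx _ _)) dotv_delta /=.
  have -> : (-1) ^+ (z ord0 i < 0)%R * tau * z ord0 i = tau * `|z|.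
    by rewrite -zi normrEsign; ring.
  have h1 : dotv xi z - dotv y z <= tau / 2 * `|z|.
    rewrite -dotvBl (le_trans (ler_norm _))// (le_trans (le_dotv _ _))//.
    rewrite ler_wpM2r// mulrC -ler_pdivlMr//; exact: ltW.
  by move: h1; set a := `|z|; lra.
Qed.

Lemma hull_dir_convex E (delta : R) : convex_set (hull_dir E delta).
Proof.
move=> x y l; rewrite !inE => hx hy z.
have [e1 e1E h1] := hx z; have [e2 e2E h2] := hy z.
rewrite conv_vecE.
have l0 : 0 <= l%:inum by [].
have l1 : 0 <= 1 - l%:inum by rewrite subr_ge0.
have ll : l%:inum + (1 - l%:inum) = 1 by rewrite addrC subrK.
rewrite dotvDl !dotvZl.
have [e eE [h1' h2']] : exists2 e, e \in E & dotv x z + delta * `|z| <= dotv e z /\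
    dotv y z + delta * `|z| <= dotv e z.
  have [e12|e12] := leP (dotv e1 z) (dotv e2 z).
    by exists e2 => //; split=> //; exact: le_trans e12.
  by exists e1 => //; split=> //; exact: le_trans (ltW e12).
exists e => //; have := lerD (ler_wpM2l l0 h1') (ler_wpM2l l1 h2').
by move: (l%:inum) (dotv x z) (dotv y z) (dotv e z) (`|z|) => a b c d k; lra.
Qed.

Lemma hull_dir_closed E (delta : R) : closed (hull_dir E delta).
Proof.
rewrite (_ : hull_dir E delta = \bigcap_(z in [set: vec])
    [set xi | exists2 e, e \in E & dotv xi z + delta * `|z| <= dotv e z]); last first.
  by apply/seteqP; split => xi h z; [move=> _; exact: h|exact: (h z Logic.I)].
apply: closed_bigI => z _; elim: E => [|e E IH].
  rewrite (_ : [set xi | _] = set0); first exact: closed0.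
  by apply/seteqP; split => // x [].
rewrite (_ : [set xi | _] = [set xi | dotv z xi <= dotv e z - delta * `|z|] `|`
    [set xi | exists2 e, e \in E & dotv xi z + delta * `|z| <= dotv e z]); last first.
  apply/seteqP; split => [x [e' ]|x [h|[e' e'E h]]].
  - by rewrite inE => /orP[/eqP ->|e'E h]; [left; rewrite /= dotvC lerBrDr|right; exists e'].
  - by exists e; [rewrite mem_head|rewrite -lerBrDr dotvC].
  - by exists e' => //; rewrite inE e'E orbT.
apply: closedU => //.
apply: (@preimage_closed _ _ (dotv z) [set y | y <= dotv e z - delta * `|z|]).
  by move=> x _; exact: dotv_continuous.
exact: closed_le.
Qed.

Lemma lslc_le f xi : (lslc_envelope f xi <= (f xi)%:E)%E.
Proof. by apply: ge_ereal_sup => _ [g [_ _ gf ->]]. Qed.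

(** The function equal to [-oo] on the closed convex set [hull_dir E delta] and
    to [c] outside it competes in the definition of the envelope. *)
Lemma lslc_hull_dir f (c : R) E delta xi :
  [set xi | f xi <= c] `<=` hull_dir E delta -> (lslc_envelope f xi < c%:E)%E ->
  hull_dir E delta xi.
Proof.
move=> fE; apply: contraTP => xiE; rewrite -leNgt.
pose g xi : \bar R := if `[< hull_dir E delta xi >] then -oo%E else c%:E.
have subE d : sublevel g d = if d < c then hull_dir E delta else setT.
  apply/seteqP; split => x; rewrite /sublevel /g /=; case: (ltP d c) => dc;
    case: asboolP => //= hx; rewrite ?leNye// lee_fin//.
  by rewrite leNgt dc.
apply: ereal_sup_ubound; exists g; split.
- by move=> d; rewrite subE; case: ifP => _; [exact: hull_dir_closed|exact: closedT].
- move=> d; rewrite subE; case: ifP => _; first exact: hull_dir_convex.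
  by move=> x y l _ _; rewrite inE.
- move=> eta; rewrite /g; case: asboolP => [_|h]; first exact: leNye.
  by rewrite lee_fin leNgt; apply/negP => /ltW /fE.
- by rewrite /g; case: asboolP.
Qed.

Lemma lslc_sublevelE f (c : R) : sublevel (lslc_envelope f) c =
  \bigcap_(g in [set g | [/\ lsc g, level_convex g & forall eta, (g eta <= (f eta)%:E)%E]])
    sublevel g c.
Proof.
apply/seteqP; split => [xi h g [g1 g2 g3]|xi h].
  apply: le_trans h; apply: ereal_sup_ubound; by exists g.
by apply: ge_ereal_sup => _ [g [g1 g2 g3 ->]]; apply: h.
Qed.

Lemma lslc_sublevel_closed f (c : R) : closed (sublevel (lslc_envelope f) c).
Proof. by rewrite lslc_sublevelE; apply: closed_bigI => g [g1 _ _]; exact: g1. Qed.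

Lemma lslc_sublevel_convex f (c : R) : convex_set (sublevel (lslc_envelope f) c).
Proof.
rewrite lslc_sublevelE => x y l; rewrite !inE => hx hy g gP.
have [_ /(_ c x y l) + _] := gP; rewrite !inE; apply; [exact: hx|exact: hy].
Qed.

Lemma dotv_scale_sub (t : R) (w z : vec) : dotv (t *: w - z) (t *: w - z) =
  t * (t * dotv w w) - 2 * (t * dotv w z) + dotv z z.
Proof.
by rewrite dotvBr dotvZr dotvBl dotvZl dotvBl dotvZl (dotvC z w); ring.
Qed.

(** The hyperplane through the point [p] of [S] nearest to [xi0], orthogonal to
    [xi0 - p], separates them. *)
Lemma separation (S : set vec) xi0 : closed S -> convex_set S -> S !=set0 -> ~ S xi0 ->
  exists z (a : R), (forall xi, S xi -> dotv xi z <= a) /\ a < dotv xi0 z.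
Proof.
move=> clS cvS [s0 Ss0] Sxi0.
pose q xi := dotv (xi - xi0) (xi - xi0).
have cq : continuous q.
  apply: (@continuous_sum _ _ _ _ (fun i (xi : vec) => (xi - xi0) ord0 i * (xi - xi0) ord0 i)) => i.
  have ci : continuous (fun xi : vec => (xi - xi0) ord0 i).
    under eq_fun do rewrite !mxE.
    apply: continuous_add; [exact: coord_continuous|exact: cst_continuous].
  exact: continuous_mul.
pose A := S `&` [set xi | q xi <= q s0].
have le_q xi : `|xi - xi0| ^+ 2 <= q xi.
  rewrite -[q xi]sqr_sqrtr ?dotv_ge0// ler_pXn2r ?nnegrE ?sqrtr_ge0//.
  exact: le_norm_enorm.
have cA : compact A.
  apply: bounded_closed_compact.
    exists (`|xi0| + Num.sqrt (q s0)); split; first exact: num_real.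
    move=> M /ltW hM x [_ /= qx]; apply: le_trans hM.
    rewrite -[x](subrK xi0) addrC (le_trans (ler_normD _ _))// lerD2l.
    rewrite -[`|x - xi0|]ger0_norm// -sqrtr_sqr ler_wsqrtr//.
    exact: le_trans qx.
  apply: closedI => //.
  apply: (@preimage_closed _ _ q [set y | y <= q s0]); last exact: closed_le.
  by move=> x _; exact: cq.
have [p] : exists2 p, p \in A & forall t, t \in A -> q p <= q t.
  apply: compact_EVT_min => //; first by exists s0; split => //=.
  exact: continuous_subspaceT.
rewrite inE => -[Sp qp] pmin.
have pmin' s : S s -> q p <= q s.
  move=> Ss; have [qs|/ltW qs] := leP (q s) (q s0).
    by apply: pmin; rewrite inE.
  exact: le_trans qs.
have z0 : xi0 - p != 0.
  by rewrite subr_eq0; apply/eqP => xp; apply: Sxi0; rewrite xp.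
exists (xi0 - p), (dotv p (xi0 - p)); split; last first.
  by rewrite -subr_gt0 -dotvBl dotv_gt0.
move=> s Ss; rewrite -subr_le0 -dotvBl.
set z := xi0 - p; set w := s - p.
have quad (t : R) : 0 < t -> t <= 1 -> 2 * dotv w z <= t * dotv w w.
  move=> t0 t1.
  have : S (t *: s + (1 - t) *: p).
    pose l : {i01 R} := @Itv01 R t (ltW t0) t1.
    have := cvS s p l; rewrite !inE => /(_ Ss Sp).
    by rewrite conv_vecE.
  move=> /pmin'; rewrite /q.
  rewrite (_ : t *: s + (1 - t) *: p - xi0 = t *: w - z); last first.
    by rewrite /w /z scalerBl scalerBr scale1r opprB; apply/rowP => i; rewrite !mxE; ring.
  rewrite (_ : p - xi0 = - z); last by rewrite /z opprB.
  have -> : dotv (- z) (- z) = dotv z z by rewrite dotvNr dotvC dotvNr opprK.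
  have -> : dotv (t *: w - z) (t *: w - z) =
      t * (t * dotv w w) - 2 * (t * dotv w z) + dotv z z.
    exact: dotv_scale_sub.
  set a := dotv w w; set b := dotv w z; set c := dotv z z => h.
  have : 0 <= t * (t * a - 2 * b) by move: h; lra.
  by rewrite pmulr_rge0// subr_ge0.
(* A step [t] of order [dotv w z] along [w] would make [p] move closer to [xi0]. *)
rewrite leNgt; apply/negP => wz.
have ww : 0 <= dotv w w by exact: dotv_ge0.
have t0 : 0 < Num.min 1 (dotv w z / (dotv w w + 1)).
  by rewrite lt_min ltr01 divr_gt0// ltr_wpDl.
have := quad _ t0; rewrite ge_min lexx => /(_ isT).
suff : Num.min 1 (dotv w z / (dotv w w + 1)) * dotv w w <= dotv w z.
  by move: wz; lra.
apply: (@le_trans _ _ (dotv w z / (dotv w w + 1) * dotv w w)).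
  by rewrite ler_wpM2r// ge_min lexx orbT.
rewrite mulrAC ler_pdivrMr ?ltr_wpDl// ler_wpM2l ?(ltW wz)//.
by rewrite lerDl.
Qed.

End level_sets.

(** * The Lipschitz representative *)

Definition segment_inside (R : realType) n (Omega : set 'rV[R]_n) (d : R) x y :=
  forall t : R, 0 <= t <= 1 -> inner Omega d (y + t *: (x - y)).

Section representative.
Context {R : realType} {n : nat}.
Local Notation mu := (lebesgue_rV R n).
Variables (Omega : set 'rV[R]_n).
Implicit Types (phi psi u h U : 'rV[R]_n -> R) (x y z w : 'rV[R]_n).

Lemma ler_intg_ae (g h : 'rV[R]_n -> R) : tame g -> tame h ->
  (\forall x \ae mu, g x <= h x) -> intg g <= intg h.
Proof.
move=> tg th gh; rewrite -subr_ge0 -intgB//.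
rewrite (@ae_eq_intg _ _ _ (fun x => `|h x - g x|)).
- by apply: intg_ge0.
- exact: tame_sub.
- by apply: tame_norm; exact: tame_sub.
- by apply: filterS gh => x gh; rewrite ger0_norm// subr_ge0.
Qed.

Lemma test_shift rho (e d : R) w : smooth rho -> (forall z, e <= `|z| -> rho z = 0) ->
  e < d -> inner Omega d w -> test_function Omega (fun y => rho (y - w)).
Proof.
move=> srho rhoe ed wd.
have suppC : closed_support (fun y => rho (y - w)) `<=` closed_ball_ (fun x => `|x|) w e.
  rewrite [X in _ `<=` X](closure_id _).1; last exact: closed_closed_ball_.
  apply: closure_subset => y /=; rewrite /closed_ball_ /= distrC => ry.
  rewrite leNgt; apply/negP => /ltW /rhoe ry0.
  by rewrite ry0 eqxx in ry.
split; first exact: smooth_shift.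
  apply: bounded_closed_compact; last exact: closed_closure.
  exists (`|w| + e); split; [exact: num_real|move=> M /ltW hM y /suppC].
  rewrite /closed_ball_ /= distrC => yw; apply: le_trans hM.
  by rewrite -[y](subrK w) addrC (le_trans (ler_normD _ _))// lerD2l.
by move=> y /suppC; rewrite /closed_ball_ /= distrC => yw; apply: wd; lra.
Qed.

(** Along a segment inside [Omega] the mollification inherits the bound on the
    directional derivatives, because averages preserve it. *)
Lemma mollify_segment U G rho (H : 'rV[R]_n -> R) (e d : R) x y :
  tame U -> (forall i, tame (G i)) -> weak_partials Omega U G ->
  (\forall w \ae mu, Omega w -> forall z, \sum_i z ord0 i * G i w <= H z) ->
  mollifier e rho -> 0 < d -> e < d -> segment_inside Omega d x y ->
  mollify U rho x - mollify U rho y <= H (x - y).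
Proof.
move=> tU tG wUG GH mrho d0 ed seg; have [srho rho0 rhoe rho1 drho] := mrho.
set z := x - y.
have crho := smooth_continuous srho.
have Dz q : 'D_z rho q = \sum_i z ord0 i * partial i rho q.
  exact: (derive_val (is_derive := differentiable_derive z (drho q))).
have dz q : derivable rho q z by exact: diff_derivable.
have cDz : continuous (fun q => 'D_z rho q).
  rewrite (_ : (fun q => _) = (fun q => \sum_i z ord0 i * partial i rho q)); last exact/funext.
  apply: continuous_sum => i; apply: continuous_mul; first exact: cst_continuous.
  exact/smooth_continuous/smooth_partial.
have dm w := is_derive_mollify w tU crho dz cDz.
have [s s01 sE] : exists2 s : R, 0 <= s <= 1 &
    mollify U rho x - mollify U rho y = 'D_z (mollify U rho) (y + s *: z).
  pose k (r : R) := mollify U rho (y + r *: z).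
  have dk (r : R) : is_derive r 1 k ('D_z (mollify U rho) (y + r *: z)).
    by apply: derive_line; case: (dm (y + r *: z)).
  have ck : continuous k.
    by move=> r; apply: differentiable_continuous; apply/derivable1_diffP; case: (dk r).
  have [//|s] := @MVT _ k (fun r => 'D_z (mollify U rho) (y + r *: z)) 0 1 ltr01 (fun r _ => dk r).
    exact: continuous_subspaceT.
  have yz : y + 1 *: z = x by rewrite scale1r /z addrC subrK.
  rewrite in_itv /= subr0 mulr1 /k scale0r addr0 yz => /andP[s0 s1] kE.
  by exists s => //; rewrite !ltW.
rewrite sE (derive_val (is_derive := dm _)).
set w := y + s *: z.
have wd : inner Omega d w by exact: seg.
have tw := test_shift srho rhoe ed wd.
have trw : tame (fun q => rho (q - w)) by exact: test_tame tw.
have tGr i : tame (fun q => G i q * rho (q - w)) by exact: tame_mollify.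
have -> : - mollify U (fun q => 'D_z rho q) w =
    intg (fun q => (\sum_i z ord0 i * G i q) * rho (q - w)).
  have tUr i : tame (fun q => U q * partial i rho (q - w)).
    exact: (tame_mollify w tU (smooth_continuous (smooth_partial i srho))).
  have -> : mollify U (fun q => 'D_z rho q) w =
      \sum_i z ord0 i * intg (fun q => U q * partial i rho (q - w)).
    rewrite /mollify.
    under [RHS]eq_bigr do rewrite -intgZ//.
    rewrite -intg_sum; last by move=> i; exact: tame_scale.
    congr intg; apply/funext => q; rewrite Dz mulr_sumr.
    by apply: eq_bigr => i _; ring.
  have -> : intg (fun q => (\sum_i z ord0 i * G i q) * rho (q - w)) =
      \sum_i z ord0 i * intg (fun q => G i q * rho (q - w)).
    under [RHS]eq_bigr do rewrite -intgZ//.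
    rewrite -intg_sum; last by move=> i; exact: tame_scale.
    congr intg; apply/funext => q; rewrite mulr_suml.
    by apply: eq_bigr => i _; ring.
  rewrite -sumrN; apply: eq_bigr => i _.
  rewrite -mulrN; congr (_ * _).
  have := wUG _ i tw; rewrite (_ : partial i _ = fun q => partial i rho (q - w)).
    by move=> ->; rewrite opprK.
  by apply/funext => q; exact: derive_shift_rV.
have -> : H z = intg (fun q => H z * rho (q - w)).
  by rewrite intgZ// (intg_shift (- w) (tame_mollifier mrho)) rho1 mulr1.
apply: ler_intg_ae.
- by apply: tame_mollify => //; apply: tame_sum => i; exact: tame_scale.
- exact: tame_scale.
- apply: filterS GH => q GHq; have [Oq|Oq] := pselect (Omega q).
    by apply: ler_wpM2r => //; exact: GHq.
  by rewrite (test_out tw Oq) !mulr0.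
Qed.

(** The series of the errors has a finite integral, hence converges almost
    everywhere. *)
Lemma ae_cvg_of_L1 (F : nat -> 'rV[R]_n -> R) h : (forall k, tame (F k)) -> tame h ->
  (forall k, intg (fun x => `|F k x - h x|) <= (2^-1) ^+ k.+1) ->
  \forall x \ae mu, F k x @[k --> \oo] --> h x.
Proof.
move=> tF th hF.
pose D k x := `|F k x - h x|.
have tD k : tame (D k) by apply: tame_norm; exact: tame_sub.
pose S x := (\sum_(k <oo) (D k x)%:E)%E.
have mD k : measurable_fun setT (fun x => (D k x)%:E).
  by apply/measurable_EFinP; case: (tD k).
have D0 k x : setT x -> (0 <= (D k x)%:E)%E by move=> _; rewrite lee_fin /D.
have IS : (\int[mu]_x S x < +oo)%E.
  rewrite (integral_nneseries mu measurableT mD D0).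
  apply: (@le_lt_trans _ _ (\sum_(k <oo) ((2^-1) ^+ k.+1)%:E)%E).
    apply: lee_nneseries => [k _ _|k _].
      by apply: integral_ge0 => x _; exact: D0.
    by rewrite (intgE (tD k)) lee_fin; exact: hF.
  apply: (@le_lt_trans _ _ 1%:E); last exact: ltry.
  apply: lime_le.
    by apply: is_cvg_nneseries => k _ _; rewrite lee_fin exprn_ge0.
  apply: nearW => m; rewrite big_mkord sumEFin lee_fin.
  suff -> : \sum_(i < m) (2^-1 : R) ^+ i.+1 = 1 - 2^-1 ^+ m by rewrite gerBl exprn_ge0.
  elim: m => [|m IH]; first by rewrite big_ord0 expr0 subrr.
  by rewrite big_ord_recr /= IH exprS; lra.
have mS : measurable_fun setT S.
  by apply: ge0_emeasurable_sum => // k x _ _; exact: D0.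
have S0 x : (0 <= S x)%E by apply: nneseries_ge0 => k _ _; exact: D0.
have iS : mu.-integrable setT S.
  apply/integrableP; split => //.
  by under eq_integral do rewrite gee0_abs//.
have := integrable_ae measurableT iS; apply: filterS => x /(_ Logic.I) Sx.
have Dx : D k x @[k --> \oo] --> 0.
  apply: cvg_series_cvg_0; apply: nondecreasing_is_cvgn.
    by apply/nondecreasing_series => k _ _; exact: normr_ge0.
  exists (fine (S x)) => _ [m _ <-]; rewrite -lee_fin fineK// /series /= -sumEFin.
  by apply: nneseries_lim_ge => k _ _; exact: D0.
apply/cvgrPdist_le => eps eps0; move/cvgrPdist_le : Dx => /(_ _ eps0).
by apply: filterS => k; rewrite sub0r normrN normr_id distrC.
Qed.

(** [V] is the limit superior of mollifications converging to [U] almost everywhere.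
    Written as the infimum of the eventual upper bounds, it inherits at every point
    the inequalities that eventually hold along the sequence. *)
Lemma lipschitz_representative U G (H : 'rV[R]_n -> R) :
  tame U -> (forall i, tame (G i)) -> weak_partials Omega U G ->
  (\forall w \ae mu, Omega w -> forall z, \sum_i z ord0 i * G i w <= H z) ->
  exists V : 'rV[R]_n -> R, [/\ \forall x \ae mu, U x = V x,
    exists M, forall x, `|V x| <= M &
    forall x y (d : R), 0 < d -> segment_inside Omega d x y -> V x - V y <= H (x - y)].
Proof.
move=> tU tG wUG GH.
have h2 k : 0 < (2^-1 : R) ^+ k.+1 by rewrite exprn_gt0.
have /choice[er her] : forall k : nat, exists er : R * ('rV[R]_n -> R),
    [/\ er.1 <= k.+1%:R^-1, mollifier er.1 er.2 &
      intg (fun x => `|mollify U er.2 x - U x|) <= (2^-1) ^+ k.+1].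
  move=> k; have [d d0 hd] := mollification_cvg tU (h2 k).
  pose e := Num.min d k.+1%:R^-1.
  have e0 : 0 < e by rewrite lt_min d0 invr_gt0 ltr0n.
  have [rho mrho] := @mollifier_exists R n _ e0.
  exists (e, rho); split => //=; first by rewrite ge_min lexx orbT.
  by apply: (hd e) => //; rewrite ge_min lexx.
pose u k := mollify U (er k).2.
have tu k : tame (u k).
  have [_ [s _ re _ _] _] := her k; apply: mollify_tame re => //; exact: smooth_continuous.
have [_ [M hM] _] := tU.
have uM k x : `|u k x| <= M.
  have [_ mr _] := her k; have tr := tame_mollifier mr.
  have [s r0 re r1 _] := mr; have cr := smooth_continuous s.
  have trx : tame (fun y => (er k).2 (y - x)) by exact: tame_shift.
  apply: le_trans (ler_norm_intg (tame_mollify x tU cr)) _.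
  apply: (@le_trans _ _ (intg (fun y => M * (er k).2 (y - x)))).
    apply: ler_intg; [by apply: tame_norm; exact: tame_mollify|exact: tame_scale|].
    by move=> y; rewrite normrM (ger0_norm (r0 _)) ler_wpM2r.
  by rewrite intgZ// (intg_shift (- x) tr) r1 mulr1.
pose B x : set R := [set b | \forall k \near \oo, u k x <= b].
have B0 x : B x !=set0.
  by exists M; apply: nearW => k; rewrite (le_trans (ler_norm _)).
have BM x b : B x b -> - M <= b.
  move=> Bb; have [k hk] : exists k, u k x <= b.
    by have [k _ /(_ k (leqnn k)) ?] := Bb; exists k.
  by apply: le_trans hk; have := uM k x; rewrite ler_norml => /andP[].
have Blb x : has_lbound (B x) by exists (- M) => b /BM.
exists (fun x => inf (B x)); split; last 2 first.
- exists M => x; have MB : B x M.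
    by apply: nearW => k; rewrite (le_trans (ler_norm _)).
  have h1 : - M <= inf (B x) by apply: lb_le_inf => // b /BM.
  have h3 : inf (B x) <= M by apply: ge_inf.
  by rewrite ler_norml h1 h3.
- move=> x y d d0 seg.
  rewrite lerBlDl -lerBlDr; apply: lb_le_inf => // b Bb.
  rewrite lerBlDr; apply: ge_inf => //.
  have nd : \forall k \near \oo, k.+1%:R^-1 < d by exact: (near_infty_natSinv_lt (PosNum d0)).
  apply: filterS2 Bb nd => k ub kd.
  have [ek mr _] := her k.
  have := mollify_segment tU tG wUG GH mr d0 (le_lt_trans ek kd) seg.
  by rewrite -/(u k); move: ub; rewrite /u; lra.
- have : \forall x \ae mu, u k x @[k --> \oo] --> U x.
    by apply: ae_cvg_of_L1 => // k; have [] := her k.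
  apply: filterS => x ux; apply/eqP; rewrite eq_le; apply/andP; split.
    apply: lb_le_inf => // b Bb.
    rewrite -(cvg_lim (@Rhausdorff R) ux); apply: limr_le => //.
    by apply/cvg_ex; exists (U x).
  apply/ler_addgt0Pr => e e0; apply: ge_inf => //.
  have /cvgrPdist_le/(_ _ e0) := ux; apply: filterS => k.
  by rewrite ler_norml => /andP[]; lra.
Qed.

End representative.

(** * The piecewise affine perturbation *)

Section hyperplane.
Context {R : realType} {n : nat}.
Local Notation mu := (lebesgue_rV R n).

(** A bounded piece of a hyperplane is disjoint from its translates in the
    normal direction, which contradicts continuity of translations in [L^1]
    unless it is null. *)
Lemma hyperplane_null (a : 'rV[R]_n) (b : R) : a != 0 ->
  \forall x \ae mu, dotv a x <> b.
Proof.
move=> a0; pose S (k : nat) : set 'rV[R]_n :=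
  [set x | dotv a x = b] `&` [set x | `|x| <= k%:R].
have mS k : measurable (S k).
  apply: closed_measurable_rV; apply: closedI.
    apply: (@preimage_closed _ _ (dotv a) [set b]); last exact: closed_eq.
    by move=> x _; exact: dotv_continuous.
  by apply: compact_closed; [exact: norm_hausdorff|exact: compact_norm_le].
have tS k : tame (\1_(S k)) by apply: (@tame_bounded_set _ _ _ k%:R) => // x [].
have I0 k : intg (\1_(S k)) = 0.
  apply/eqP; rewrite eq_le; apply/andP; split; last first.
    by apply: intg_ge0 => x; rewrite indicE ler0n.
  apply/ler_addgt0Pr => e e0; rewrite add0r.
  have [d d0 hd] := tame_tc (tS k) e0.
  pose t := d / 2 / (`|a| + 1).
  have t0 : 0 < t by rewrite !divr_gt0// ltr_wpDl.
  have td : `|t *: a| < d.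
    rewrite normrZ gtr0_norm// /t mulrAC ltr_pdivrMr ?ltr_wpDl//.
    by apply: (@le_lt_trans _ _ (d / 2 * (`|a| + 1))); [rewrite ler_wpM2l ?lerDl// ltW// divr_gt0|rewrite ltr_pM2r ?ltr_wpDl//; lra].
  apply: le_trans (hd _ td).
  apply: ler_intg => //; first exact: tame_diff_shift.
  move=> x; rewrite !indicE; have [xS|xS] := boolP (x \in S k); last first.
    by rewrite normr_ge0.
  rewrite memNset ?sub0r ?normrN ?normr1//.
  have [/= ax _] := set_mem xS; move=> [/= axt _].
  have := dotv_gt0 a0; have : t * dotv a a = 0.
    by move: axt; rewrite dotvDr dotvZr ax; lra.
  by move=> /eqP; rewrite mulf_eq0 gt_eqF//= => /eqP ->; rewrite ltxx.
have nS k : mu (S k) = 0%E.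
  by have := intgE (tS k); rewrite I0 integral_indic// setIT.
have : mu.-negligible (\bigcup_k S k).
  by apply: negligible_bigcup => k; apply/negligibleP => //; exact: nS.
apply: negligibleS => x /= /contrapT ax.
exists (Num.truncn `|x|).+1 => //; split => //=.
by apply/ltW; exact: truncnS_gt.
Qed.

End hyperplane.

Section support_function.
Context {R : realType} {n : nat}.
Local Notation vec := 'rV[R]_n.
Implicit Types (x y z e : vec) (E : seq vec).

(** Support function of the convex hull of [E], when [E] is not empty: the initial
    value of the maximum is then one of the competitors. *)
Definition supp_fun E z : R := \big[Num.max/dotv (head 0 E) z]_(e <- E) dotv e z.

Lemma supp_fun_ge E e z : e \in E -> dotv e z <= supp_fun E z.
Proof. by move=> eE; exact: (@le_bigmax_seq _ R _ E _ e xpredT (fun e => dotv e z) eE). Qed.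

Lemma supp_fun_attained E z : E != [::] -> exists2 e, e \in E & supp_fun E z = dotv e z.
Proof.
case: E => // e0 E _; rewrite /supp_fun /= big_seq.
elim/big_ind : _.
- by exists e0 => //; exact: mem_head.
- by move=> a b ha hb; case: (leP a b).
- by move=> e eE; exists e.
Qed.

Lemma supp_fun_subadd E y z : E != [::] -> supp_fun E (y + z) <= supp_fun E y + supp_fun E z.
Proof.
move=> E0; have [e eE ->] := supp_fun_attained (y + z) E0.
by rewrite dotvDr lerD// supp_fun_ge.
Qed.

Definition slope_bound E (L : R) :=
  forall e, e \in E -> forall z, `|dotv e z| <= L * `|z|.

Lemma supp_fun_le E z (L : R) : E != [::] -> slope_bound E L ->
  supp_fun E z <= L * `|z|.
Proof.
move=> E0 EL; have [e eE ->] := supp_fun_attained z E0.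
by rewrite (le_trans (ler_norm _))// EL.
Qed.

Lemma slopes_bounded E : exists2 L : R, 0 < L & slope_bound E L.
Proof.
elim: E => [|e E [L L0 hL]]; first by exists 1.
exists (L + n%:R * `|e|); first by rewrite ltr_wpDr// mulr_ge0.
move=> e'; rewrite inE => /orP[/eqP -> z|/hL h z].
  by rewrite (le_trans (le_dotv _ _))// ler_wpM2r// lerDr ltW.
by rewrite (le_trans (h z))// ler_wpM2r// lerDl mulr_ge0.
Qed.

End support_function.

Lemma seq_argmin (R : realType) (T : eqType) (F : T -> R) (s : seq T) : s != [::] ->
  exists2 m, m \in s & forall t, t \in s -> F m <= F t.
Proof.
elim: s => // a [|b s] IH _.
  by exists a => [|t]; rewrite ?mem_head// inE => /eqP ->.
have [//|m ms mF] := IH; have [am|/ltW ma] := leP (F a) (F m).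
  exists a; first exact: mem_head.
  by move=> t; rewrite inE => /orP[/eqP ->//|/mF]; exact: le_trans.
exists m; first by rewrite inE ms orbT.
by move=> t; rewrite inE => /orP[/eqP ->//|/mF].
Qed.

(** The decrease by a factor four makes each term dominate all the later ones. *)
Fixpoint quartered (R : realType) (a : nat -> R) (j : nat) : R :=
  if j is k.+1 then Num.min (quartered a k / 4) (a j) else a 0%N.

Section quartered.
Context {R : realType}.
Variable a : nat -> R.
Hypothesis a0 : forall j, 0 < a j.

Lemma quartered_gt0 j : 0 < quartered a j.
Proof. by elim: j => //= j IH; rewrite lt_min a0 divr_gt0. Qed.

Lemma quartered_le j : quartered a j <= a j.
Proof. by case: j => //= j; rewrite ge_min lexx orbT. Qed.

Lemma quarteredS j k : (j < k)%N -> quartered a k <= quartered a j / 4.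
Proof.
elim: k => // k IH; rewrite ltnS leq_eqVlt => /orP[/eqP ->|/IH h].
  by rewrite /= ge_min lexx.
rewrite /= ge_min; apply/orP; left; apply: le_trans h.
by have := quartered_gt0 k; lra.
Qed.

Lemma quartered_nincr j k : (j <= k)%N -> quartered a k <= quartered a j.
Proof.
rewrite leq_eqVlt => /orP[/eqP -> //|/quarteredS h].
by apply: le_trans h _; have := quartered_gt0 j; lra.
Qed.

End quartered.

Lemma ae_forall_seq d (T : measurableType d) (R : realType)
    (mu : {measure set T -> \bar R}) (A : eqType) (P : A -> T -> Prop) (s : seq A) :
  (forall a, a \in s -> \forall x \ae mu, P a x) ->
  \forall x \ae mu, forall a, a \in s -> P a x.
Proof.
elim: s => [|a s IH] h; first exact: aeW.
have hs : \forall x \ae mu, forall b, b \in s -> P b x.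
  by apply: IH => b bs; apply: h; rewrite inE bs orbT.
apply: filterS2 (h a (mem_head _ _)) hs => x Pa Ps b.
by rewrite inE => /orP[/eqP -> //|]; exact: Ps.
Qed.

Section local_behaviour.
Context {R : realType} {n : nat}.
Implicit Types (w : 'rV[R]_n -> R) (x e : 'rV[R]_n).

(** Lipschitz continuity for small steps, whose admissible length may shrink as the
    starting point approaches the boundary. *)
Definition locally_lipschitz (Omega : set 'rV[R]_n) w (L : R) :=
  forall j, exists2 tau : R, 0 < tau & forall x h, inner Omega j.+1%:R^-1 x ->
    `|h| < tau -> `|w (x + h) - w x| <= L * `|h|.

Definition affine_near w x e := exists2 d : R, 0 < d & forall y, `|y - x| < d ->
  w y = w x + dotv e (y - x).

End local_behaviour.

Section perturbation.
Context {R : realType} {n : nat}.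
Local Notation mu := (lebesgue_rV R n.+1).
Local Notation vec := 'rV[R]_n.+1.
Variables (Omega : set vec) (r0 : R).
Hypothesis oOmega : open Omega.
Hypothesis bOmega : Omega `<=` [set x | `|x| <= r0].
Implicit Types (x y z e : vec) (i j l : nat).

Variables (E : seq vec) (delta L : R) (V : vec -> R).
Hypothesis E0 : E != [::].
Hypothesis delta0 : 0 < delta.
Hypothesis L0 : 0 < L.
Hypothesis EL : slope_bound E L.
Local Notation H := (supp_fun E).
Hypothesis VH : forall x y (d : R), 0 < d -> segment_inside Omega d x y ->
  V x - V y <= H (x - y) - delta * `|x - y|.
Variable kappa : nat -> R.
Hypothesis kappa0 : forall l, 0 < kappa l.

Let d_ j : R := j.+1%:R^-1.
Let Om j := inner Omega (d_ j).
Let d_gt0 j : 0 < d_ j. Proof. by rewrite /d_ invr_gt0. Qed.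

(** The cones of layer [j], with vertices in [Om j], are only used within distance
    [rho_ j] of their vertex, which is well inside [Om j.+1]. *)
Let rho_ := quartered (fun j => (d_ j - d_ j.+1) / 2).

Let gap_gt0 j : 0 < (d_ j - d_ j.+1) / 2.
Proof. by rewrite divr_gt0// subr_gt0 /d_ ltf_pV2 ?posrE// ltr_nat. Qed.

Let rho_gt0 j : 0 < rho_ j. Proof. exact: quartered_gt0. Qed.

Let rho_lt j : rho_ j + rho_ j <= d_ j - d_ j.+1.
Proof. by have := quartered_le (fun j => (d_ j - d_ j.+1) / 2) j; rewrite -/rho_ /=; lra. Qed.

(** Depth of the cones of layer [j]: by the term [delta * rho_ j / 2], a cone is
    already above [V] halfway to the distance [rho_ j] where it is dropped; [kappa]
    prescribes the smallness at the boundary. *)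
Let r_ := quartered (fun j => Num.min (delta * rho_ j / 2) (kappa j)).

Let bnd_gt0 j : 0 < Num.min (delta * rho_ j / 2) (kappa j).
Proof. by rewrite lt_min kappa0 !divr_gt0 ?mulr_gt0. Qed.

Let r_gt0 j : 0 < r_ j. Proof. exact: quartered_gt0. Qed.

Let r_rho j : r_ j <= delta * rho_ j / 2.
Proof. by rewrite (le_trans (quartered_le _ j))// ge_min lexx. Qed.

Let r_kappa l j : (l <= j)%N -> r_ j <= kappa l.
Proof.
move=> lj; rewrite (le_trans (quartered_nincr bnd_gt0 lj))//.
by rewrite (le_trans (quartered_le _ l))// ge_min lexx orbT.
Qed.

Let OmS i j : (i <= j)%N -> Om i `<=` Om j.
Proof. by move=> ij; apply: innerS; rewrite /d_ lef_pV2 ?posrE// ler_nat. Qed.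

Let Om_near i x y : Om i y -> `|x - y| < rho_ i + rho_ i -> Om i.+1 x.
Proof. by move=> yi /ltW xy; apply: (inner_near yi); apply: le_trans xy _. Qed.

Let Om_exists x : Omega x -> exists j, Om j x.
Proof.
move=> Ox; have [d d0 xd] := inner_open oOmega Ox.
have [j _ /(_ j (leqnn j)) jd] := near_infty_natSinv_lt (PosNum d0).
by exists j; apply: innerS xd; exact: ltW.
Qed.

Let V_near i x y : Om i y -> `|x - y| < rho_ i ->
  V x - V y + delta * `|x - y| <= H (x - y) /\ V y - V x + delta * `|x - y| <= H (y - x).
Proof.
move=> yi xy; have xyd : 0 < d_ i - `|x - y|.
  by have := rho_lt i; have := d_gt0 i.+1; have := rho_gt0 i; lra.
have seg (t : R) : 0 <= t <= 1 -> inner Omega (d_ i - `|x - y|) (y + t *: (x - y)).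
  move=> /andP[t0 t1]; apply: (inner_near yi).
  rewrite addrAC subrr add0r normrZ ger0_norm// opprB addrCA subrr addr0.
  by rewrite ler_piMl.
split; first by have := VH xyd seg; lra.
suff seg' (t : R) : 0 <= t <= 1 -> inner Omega (d_ i - `|x - y|) (x + t *: (y - x)).
  by have := VH xyd seg'; rewrite (distrC x y); lra.
move=> /andP[t0 t1].
rewrite (_ : x + t *: (y - x) = y + (1 - t) *: (x - y)); last first.
  by apply/rowP => k; rewrite !mxE; ring.
by apply: seg; rewrite subr_ge0 t1 gerBl.
Qed.

(** Mesh of the vertices of layer [j]: a point this close to a vertex sees its cone
    below [V - r_ j / 2]. *)
Let s_ j : R := Num.min (rho_ j) (r_ j / (4 * L)).

Let s_gt0 j : 0 < s_ j. Proof. by rewrite lt_min rho_gt0 divr_gt0// mulr_gt0. Qed.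

Let Om_compact j : compact (Om j).
Proof.
apply: bounded_closed_compact; last exact: inner_closed.
exists r0; split; [exact: num_real|move=> M /ltW rM x /(inner_sub (d_gt0 j)) /bOmega /= h].
exact: le_trans rM.
Qed.

Let Y j : seq vec := projT1 (cid (compact_net (@Om_compact j) (s_gt0 j))).

Let Y_sub j y : y \in Y j -> Om j y.
Proof. by rewrite /Y; case: cid => s /= [h _] /h. Qed.

Let Y_net j x : Om j x -> exists2 y, y \in Y j & `|x - y| < s_ j.
Proof. by rewrite /Y; case: cid => s /= [_ h] /h. Qed.

Let P i y x : R := V y - r_ i + H (x - y).
Let active i y x := y \in Y i /\ `|x - y| < rho_ i.
Let v x : R := inf [set a | exists i y, active i y x /\ a = P i y x].

Let P_ge i y x : active i y x -> V x - r_ i + delta * `|x - y| <= P i y x.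
Proof. by move=> [yY xy]; have [h _] := V_near (Y_sub yY) xy; rewrite /P; lra. Qed.

Let P_le i y x : y \in Y i -> `|x - y| < s_ i -> active i y x /\ P i y x <= V x - r_ i / 2.
Proof.
move=> yY; rewrite lt_min => /andP[xy xs]; split => //.
have [_ h] := V_near (Y_sub yY) xy.
have h1 := supp_fun_le (y - x) E0 EL; have h2 := supp_fun_le (x - y) E0 EL.
have h3 : L * `|x - y| <= r_ i / 4.
  move: xs; rewrite ltr_pdivlMr ?mulr_gt0// => xs.
  by move: xs; move: `|x - y| (r_ i) => k q; lra.
have h4 : 0 <= delta * `|x - y| by rewrite mulr_ge0// ltW.
by move: h h1; rewrite (distrC y) /P; lra.
Qed.

(** On [Om j] the minimum is attained among the layers [i <= j]: a cone of layer [j]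
    goes below [V - r_ j / 2], while those of the later layers stay above
    [V - r_ j / 4]. *)
Let v_min j x : Om j x -> exists i y, [/\ (i <= j)%N, active i y x, v x = P i y x,
  forall i' y', active i' y' x -> P i y x <= P i' y' x & P i y x <= V x - r_ j / 2].
Proof.
move=> xj; pose pts := [seq (i, y) | i <- iota 0 j.+1, y <- Y i].
pose cand := [seq q <- pts | `|x - q.2| < rho_ q.1].
have candP i y : (i, y) \in cand <-> (i <= j)%N /\ active i y x.
  rewrite mem_filter /=; split.
    move=> /andP[xy /allpairsPdep[i' [y' [+ y'Y [ei ey]]]]]; subst i' y'.
    by rewrite mem_iota /= ltnS.
  move=> [ij [yY ->]]; apply/allpairsPdep; exists i, y; split => //.
  by rewrite mem_iota /= ltnS.
have [y yY yx] := Y_net xj; have [ya Py] := P_le yY yx.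
have jy : (j, y) \in cand by apply/candP.
have [|[i0 y0] mc mmin] := @seq_argmin R _ (fun q => P q.1 q.2 x) cand.
  by apply/eqP => c0; rewrite c0 in jy.
have [i0j a0] := (candP _ _).1 mc.
have le0 : P i0 y0 x <= V x - r_ j / 2 by apply: le_trans Py; exact: (mmin _ jy).
have lemin i' y' : active i' y' x -> P i0 y0 x <= P i' y' x.
  move=> a'; have [i'j|ji'] := leqP i' j; first by apply: (mmin (i', y')); apply/candP.
  have := P_ge a'; have := quarteredS bnd_gt0 ji'; rewrite -/r_.
  have : 0 <= delta * `|x - y'| by rewrite mulr_ge0// ltW.
  by have := r_gt0 j; lra.
exists i0, y0; split => //; apply/eqP; rewrite eq_le; apply/andP; split.
  apply: ge_inf; last by exists i0, y0.
  by exists (P i0 y0 x) => _ [i' [y' [/lemin ? ->]]].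
apply: lb_le_inf; first by exists (P i0 y0 x), i0, y0.
by move=> _ [i' [y' [/lemin ? ->]]].
Qed.

Let v_le j x i y : Om j x -> active i y x -> v x <= P i y x.
Proof. by move=> /v_min[i0 [y0 [_ _ -> h _]]] /h. Qed.

Let v_leV x : Omega x -> v x <= V x.
Proof.
move=> /Om_exists[j xj]; have [i [y [_ _ -> _ h]]] := v_min xj.
by apply: le_trans h _; have := r_gt0 j; lra.
Qed.

Let v_geV l x : Omega x -> ~ Om l x -> V x - kappa l <= v x.
Proof.
move=> /Om_exists[j xj] xl; have [i [y [_ a -> _ _]]] := v_min xj.
have := P_ge a; have : 0 <= delta * `|x - y| by rewrite mulr_ge0// ltW.
suff li : (l <= i)%N by have := r_kappa li; lra.
rewrite leqNgt; apply/negP => il; apply: xl; have [yY xy] := a.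
apply: (OmS il); apply: (Om_near (Y_sub yY)).
by rewrite (lt_trans xy)// ltrDl.
Qed.

Let v_geV0 x : Omega x -> V x - kappa 0 <= v x.
Proof.
move=> /Om_exists[j xj]; have [i [y [_ a -> _ _]]] := v_min xj.
have := P_ge a; have : 0 <= delta * `|x - y| by rewrite mulr_ge0// ltW.
by have := r_kappa (leq0n i); lra.
Qed.

(** A cone attaining the minimum at [x'] has its vertex within [rho_ i / 2], so that
    it still competes at the nearby point [x]. *)
Let v_lip1 j x x' : Om j x' -> `|x - x'| < rho_ j / 2 -> v x <= v x' + L * `|x - x'|.
Proof.
move=> xj xx'; have [i [y [ij a' vE _ le']]] := v_min xj.
have rij := quartered_nincr gap_gt0 ij; rewrite -/rho_ in rij.
have [yY x'y] := a'.
have x'y2 : `|x' - y| < rho_ i / 2.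
  have := P_ge a'; have := r_gt0 j => rj h.
  have : delta * `|x' - y| < delta * (rho_ i / 2) by have := r_rho i; lra.
  by rewrite ltr_pM2l.
have a : active i y x.
  split=> //; rewrite -(subrKA x') (le_lt_trans (ler_normD _ _))//.
  by move: x'y2 xx'; lra.
have xj1 : Om j.+1 x by apply: (Om_near xj); rewrite (lt_trans xx')//; have := rho_gt0 j; lra.
apply: le_trans (v_le xj1 a) _; rewrite vE /P -[x - y](subrKA x').
have := supp_fun_subadd (x - x') (x' - y) E0.
by have := supp_fun_le (x - x') E0 EL; lra.
Qed.

Let v_lip : locally_lipschitz Omega v L.
Proof.
move=> j; exists (rho_ j.+1 / 2); first by rewrite divr_gt0.
move=> x h xj hr.
have rr : rho_ j.+1 <= rho_ j by exact: quartered_nincr.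
have xhj : Om j.+1 (x + h).
  apply: (Om_near xj); rewrite addrAC subrr add0r (lt_le_trans hr)//.
  by have := rho_gt0 j; lra.
have h1 := @v_lip1 j (x + h) x xj; rewrite addrAC subrr add0r in h1.
have h2 := @v_lip1 j.+1 x (x + h) xhj; rewrite opprD addNKr normrN in h2.
have {}h1 := h1 (lt_le_trans hr _); have {}h2 := h2 hr.
rewrite ler_norml; apply/andP; split; last by rewrite lerBlDl h1// ler_pM2r.
by rewrite lerNl opprB lerBlDl.
Qed.

Let val (a : R * vec) x : R := a.1 + dotv a.2 x.

(** The finitely many affine pieces that can attain [v] on [Om j]. *)
Let aff j : seq (R * vec) :=
  [seq (V q.2 - r_ q.1 - dotv e q.2, e) | q <- [seq (i, y) | i <- iota 0 j.+1, y <- Y i], e <- E].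

Let v_aff j x : Om j x -> exists2 a, a \in aff j & v x = val a x.
Proof.
move=> /v_min[i [y [ij [yY _] -> _ _]]].
have [e eE he] := supp_fun_attained (x - y) E0.
exists (V y - r_ i - dotv e y, e); last by rewrite /val /P he dotvBr /=; ring.
apply/allpairsPdep; exists (i, y), e; split => //.
by apply/allpairsPdep; exists i, y; rewrite mem_iota /= ltnS.
Qed.

Let aff_slope j a : a \in aff j -> a.2 \in E.
Proof. by move=> /allpairsPdep[q [e [_ eE ->]]]. Qed.

Let ae_generic : \forall x \ae mu, forall j a b, a \in aff j -> b \in aff j ->
  val a x = val b x -> a.2 = b.2.
Proof.
apply: (@ae_forall_count _ _ _ mu nat (fun j x => forall a b, a \in aff j -> b \in aff j ->
  val a x = val b x -> a.2 = b.2)) => j.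
have C a b : \forall x \ae mu, val a x = val b x -> a.2 = b.2.
  have [->|ab] := eqVneq a.2 b.2; first exact: aeW.
  have ab0 : a.2 - b.2 != 0 by rewrite subr_eq0.
  apply: filterS (hyperplane_null (b.1 - a.1) ab0) => x hx vab.
  by case: hx; move: vab; rewrite /val dotvBl; lra.
have Cs a : \forall x \ae mu, forall b, b \in aff j -> val a x = val b x -> a.2 = b.2.
  exact: (@ae_forall_seq _ _ _ mu _ (fun b x => val a x = val b x -> a.2 = b.2)).
have := @ae_forall_seq _ _ _ mu _ (fun a x => forall b, b \in aff j ->
  val a x = val b x -> a.2 = b.2) (aff j) (fun a _ => Cs a).
by apply: filterS => x h a b aj bj; exact: h.
Qed.

(** Off the hyperplanes where two affine pieces with different slopes meet, all the
    pieces attaining [v] at [x0] coincide; by continuity the others stay away from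
    [v] near [x0]. *)
Let v_affine x0 j : Om j x0 ->
  (forall a b, a \in aff j.+1 -> b \in aff j.+1 -> val a x0 = val b x0 -> a.2 = b.2) ->
  exists2 e, e \in E & affine_near v x0 e.
Proof.
move=> xj gen; have [a0 a0T va0] := v_aff (OmS (leqnSn j) xj).
have [tau tau0 vtau] := v_lip j.
have [d [d0 dtau hd]] : exists d : R, [/\ 0 < d, d <= tau & forall a, a \in aff j.+1 ->
    val a x0 <> v x0 -> forall x, `|x - x0| < d -> val a x <> v x].
  have : forall a, a \in aff j.+1 -> a.2 \in E by move=> a /aff_slope.
  elim: (aff j.+1) => [|a s IH] sE; first by exists tau.
  have [|d [d0 dt hd]] := IH; first by move=> b bs; apply: sE; rewrite inE bs orbT.
  have [va|va] := eqVneq (val a x0) (v x0).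
    exists d; split => // b; rewrite inE => /orP[/eqP -> //|]; exact: hd.
  have g0 : 0 < `|val a x0 - v x0| / (2 * L) by rewrite divr_gt0 ?mulr_gt0// normr_gt0 subr_eq0.
  (* Both [v] and the piece [a] vary with speed at most [L]. *)
  exists (Num.min d (`|val a x0 - v x0| / (2 * L))); split.
  - by rewrite lt_min d0.
  - by rewrite ge_min dt.
  move=> b; rewrite inE => /orP[/eqP ->|bs] vb x; rewrite lt_min => /andP[xd xg]; last first.
    exact: (hd b).
  move=> vax; have := vtau x0 (x - x0) xj (lt_le_trans xd dt).
  rewrite (addrC x0) subrK => vx.
  have := EL (sE a (mem_head _ _)) (x - x0) => ax.
  have E1 : val a x0 - v x0 = (v x - v x0) - dotv a.2 (x - x0).
    by rewrite -vax /val dotvBr; ring.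
  move: xg; rewrite ltr_pdivlMr ?mulr_gt0// E1.
  have := ler_normB (v x - v x0) (dotv a.2 (x - x0)).
  by move: vx ax; move: (`|x - x0|) => k; lra.
exists a0.2; first exact: aff_slope a0T.
exists (Num.min d (rho_ j)); first by rewrite lt_min d0 rho_gt0.
move=> x; rewrite lt_min => /andP[xd xr].
have xj1 : Om j.+1 x by apply: (Om_near xj); rewrite (lt_trans xr)// ltrDl.
have [a aT va] := v_aff xj1.
have vax0 : val a x0 = v x0.
  by apply: contrapT => /(hd a aT)/(_ x xd); rewrite va.
have slope : a.2 = a0.2 by apply: gen => //; rewrite vax0.
rewrite va -vax0 /val slope dotvBr; ring.
Qed.

(** The lower envelope of the cones [V y - r + H (x - y)] over a cover of [Omega] by
    small balls accumulating only at the boundary. Only finitely many of them matter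
    near a point of [Omega]: a cone rises above [V] away from its vertex, and the
    cones of the later layers are not deep enough. *)
Lemma perturbation_exists : exists w : vec -> R, [/\
  forall x, Omega x -> V x - kappa 0 <= w x <= V x,
  forall l x, Omega x -> ~ inner Omega l.+1%:R^-1 x -> V x - kappa l <= w x,
  locally_lipschitz Omega w L &
  \forall x \ae mu, Omega x -> exists2 e, e \in E & affine_near w x e].
Proof.
exists v; split.
- by move=> x Ox; rewrite v_geV0//= v_leV.
- by move=> l x; exact: v_geV.
- exact: v_lip.
- apply: filterS ae_generic => x gen Ox; have [j xj] := Om_exists Ox.
  by apply: (v_affine xj) => a b; exact: gen.
Qed.

End perturbation.

(** * Weak gradient of a locally affine function *)

Section locally_affine.
Context {R : realType} {n : nat}.
Local Notation mu := (lebesgue_rV R n).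
Local Notation vec := 'rV[R]_n.
Variables (Omega : set vec) (r0 : R).
Hypothesis oOmega : open Omega.
Hypothesis bOmega : Omega `<=` [set x | `|x| <= r0].
Implicit Types (w W U : vec -> R) (D : vec -> vec) (x y z e : vec).

Lemma affine_near_unique w x e e' : affine_near w x e -> affine_near w x e' -> e = e'.
Proof.
move=> [d d0 hd] [d' d'0 hd']; apply/eqP; rewrite -subr_eq0; apply: contraT => ee'.
have ne : 0 < `|e - e'| by rewrite normr_gt0.
pose t := Num.min d d' / (2 * `|e - e'|).
have dd : 0 < Num.min d d' by rewrite lt_min d0.
have t0 : 0 < t by rewrite divr_gt0// mulr_gt0.
have tn : `|t *: (e - e')| < Num.min d d'.
  rewrite normrZ gtr0_norm// /t invfM !mulrA mulfVK ?gt_eqF//.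
  by rewrite ltr_pdivrMr// ltr_pMr// ltr1n.
have h y : `|y| < Num.min d d' -> dotv (e - e') y = 0.
  rewrite lt_min => /andP[yd yd'].
  have := hd (x + y); have := hd' (x + y).
  rewrite addrAC subrr add0r => /(_ yd') h1 /(_ yd) h2.
  by rewrite dotvBl; move: h1 h2; lra.
have := h _ tn; rewrite dotvZr => /eqP; rewrite mulf_eq0 gt_eqF//= gt_eqF//.
exact: dotv_gt0.
Qed.

Lemma affine_near_open w e : open (Omega `&` [set x | affine_near w x e]).
Proof.
rewrite openE => x [Ox [d d0 hd]].
have [d' d'0 hd'] := inner_open oOmega Ox.
apply/nbhs_ballP; exists (Num.min (d / 2) d'); first by rewrite /= lt_min d'0 andbT divr_gt0.
move=> y; rewrite ball_rVE lt_min => /andP[yd yd']; split; first exact: hd'.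
exists (d / 2); first by rewrite divr_gt0.
move=> z zy; have zx : `|z - x| < d.
  by rewrite -(subrKA y) (le_lt_trans (ler_normD _ _))// [ltRHS]splitr ltrD.
rewrite (hd _ zx) (hd y); last by lra.
by rewrite -addrA -dotvDr (addrC (y - x)) subrKA.
Qed.

(** The slope, as a finite sum over the open sets on which it is constant. *)
Lemma slope_field w (E : seq vec) :
  (\forall x \ae mu, Omega x -> exists2 e, e \in E & affine_near w x e) ->
  exists D, [/\ forall i, tame (fun x => D x ord0 i), forall x, ~ Omega x -> D x = 0 &
    \forall x \ae mu, Omega x -> D x \in E /\ affine_near w x (D x)].
Proof.
move=> wE; pose A e := Omega `&` [set x | affine_near w x e].
pose D x := \sum_(e <- undup E) \1_(A e) x *: e.
have DE x i : D x ord0 i = \sum_(e <- undup E) \1_(A e) x * e ord0 i.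
  by rewrite /D summxE; apply: eq_bigr => e _; rewrite mxE.
exists D; split.
- move=> i; under eq_fun do rewrite DE.
  apply: tame_sum => e; under eq_fun do rewrite mulrC; apply: tame_scale.
  apply: (@tame_bounded_set _ _ _ r0); first by apply: open_measurable_rV; exact: affine_near_open.
  by move=> x [/bOmega].
- move=> x Ox; apply/rowP => i; rewrite DE mxE big1// => e _.
  by rewrite indicE memNset ?mul0r// => -[].
- apply: filterS wE => x h Ox; have [e eE xe] := h Ox.
  suff -> : D x = e by [].
  rewrite /D (bigD1_seq e) ?mem_undup ?undup_uniq//= indicE mem_set// scale1r big1 ?addr0//.
  move=> e' e'e; rewrite indicE memNset ?scale0r// => -[_ xe'].
  by rewrite (affine_near_unique xe xe') eqxx in e'e.
Qed.

(** The difference quotients of [w] are bounded by [L] on the support of the test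
    function and eventually equal to the slope: dominated convergence. *)
Lemma weak_partials_affine w W D (L : R) :
  tame W -> (forall x, Omega x -> W x = w x) -> (forall i, tame (fun x => D x ord0 i)) ->
  0 <= L -> locally_lipschitz Omega w L ->
  (\forall x \ae mu, Omega x -> affine_near w x (D x)) ->
  weak_partials Omega W (fun i x => D x ord0 i).
Proof.
move=> tW Ww tD L0 lip aff phi i tphi.
have [sphi cphi phiO] := tphi.
have [d d0 Kd] := compact_inner oOmega cphi phiO.
have [j _ /(_ j (leqnn j)) /= jd] := near_infty_natSinv_lt (PosNum d0).
have Kj x : phi x != 0 -> inner Omega j.+1%:R^-1 x.
  move=> px; apply: (innerS (ltW jd)); apply: Kd.
  by apply: contrapT => /closed_support_out px0; rewrite px0 eqxx in px.
have [tau tau0 htau] := lip j.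
have j0 : 0 < j.+1%:R^-1 :> R by rewrite invr_gt0.
pose dd := Num.min tau j.+1%:R^-1; have dd0 : 0 < dd by rewrite lt_min tau0.
have [k0 _ hk0] := near_infty_natSinv_lt (PosNum dd0).
pose h k : vec := k.+1%:R^-1 *: delta_mx ord0 i.
have hk k : `|h k| <= k.+1%:R^-1.
  rewrite /h normrZ ger0_norm ?invr_ge0//.
  by rewrite ler_piMr ?invr_ge0// norm_delta_mx.
have [_ [M hM] _] := tW.
have M0 : 0 <= M by rewrite (le_trans _ (hM 0)).
pose C := L + k0%:R * (M + M).
have tphi' := test_tame tphi.
(* When the step is too long for the Lipschitz bound, that is for finitely many
   [k], the boundedness of [W] is used instead. *)
have quot k x : `|k.+1%:R * (W (x + h k) - W x) * phi x| <= C * `|phi x|.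
  rewrite normrM; have [->|px] := eqVneq (phi x) 0; first by rewrite normr0 !mulr0.
  rewrite ler_wpM2r// normrM ger0_norm//.
  have [kk0|k0k] := ltnP k k0.
    apply: (@le_trans _ _ (k0%:R * (M + M))).
      by rewrite ler_pM// ?ler_nat// (le_trans (ler_normB _ _))// lerD.
    by rewrite /C lerDr.
  have xj := Kj x px; have Ox : Omega x by exact: inner_sub xj.
  have kdd : k.+1%:R^-1 < dd by exact: (hk0 k k0k).
  have hdd : `|h k| < dd by exact: le_lt_trans kdd.
  have Oxh : Omega (x + h k).
    by apply: xj; rewrite addrAC subrr add0r (lt_le_trans hdd)// ge_min lexx orbT.
  rewrite !Ww//; have := htau x (h k) xj; rewrite (lt_le_trans hdd) ?ge_min ?lexx// => /(_ isT).
  move=> wL; apply: (@le_trans _ _ L); last by rewrite /C lerDl mulr_ge0// addr_ge0.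
  rewrite mulrC -ler_pdivlMr//; apply: le_trans wL _.
  by rewrite ler_wpM2l.
apply: (intg_by_parts tW sphi tphi' _ _ _ quot).
- by apply: tame_mul_continuous => //; exact: smooth_continuous.
- by apply: tame_scale; exact: tame_norm.
- apply: filterS aff => x affx; have [Ox|Ox] := pselect (Omega x); last first.
    by rewrite (test_out tphi Ox); under eq_fun do rewrite mulr0; rewrite mulr0; exact: cvg_cst.
  have [d1 d10 hd1] := affx Ox; have [d2 d20 hd2] := inner_open oOmega Ox.
  have d3 : 0 < Num.min d1 d2 by rewrite lt_min d10.
  apply: cvg_near_cst; have := near_infty_natSinv_lt (PosNum d3).
  apply: filterS => k /= kd; have hkd : `|h k| < Num.min d1 d2 by exact: le_lt_trans kd.
  have [hk1 hk2] : `|h k| < d1 /\ `|h k| < d2 by move: hkd; rewrite lt_min => /andP.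
  rewrite -/(h k) !Ww//; last by apply: hd2; rewrite addrAC subrr add0r.
  rewrite hd1; last by rewrite addrAC subrr add0r.
  rewrite addrAC subrr add0r (addrC x) addrK /h dotvZr dotv_delta.
  by rewrite mulVKf.
Qed.

Lemma weak_partials_sub U G U' G' : tame U -> tame U' -> (forall i, tame (G i)) ->
  (forall i, tame (G' i)) -> weak_partials Omega U G -> weak_partials Omega U' G' ->
  weak_partials Omega (fun x => U x - U' x) (fun i x => G i x - G' i x).
Proof.
move=> tU tU' tG tG' w w' phi i tphi.
have cp := test_continuous (test_partial i tphi); have cphi := test_continuous tphi.
under eq_fun do rewrite mulrBl; under [in RHS]eq_fun do rewrite mulrBl.
rewrite !intgB; try exact: tame_mul_continuous.
by rewrite w// w'// opprB opprK addrC.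
Qed.

End locally_affine.


(** * Functions vanishing fast at the boundary *)

Section boundary_decay.
Context {R : realType} {n : nat}.
Local Notation mu := (lebesgue_rV R n).
Local Notation vec := 'rV[R]_n.
Variables (Omega : set vec) (r0 : R).
Hypothesis oOmega : open Omega.
Hypothesis bOmega : Omega `<=` [set x | `|x| <= r0].
Implicit Types (z Z : vec -> R) (y : vec -> vec) (eta : nat -> vec -> R) (M : nat -> R).

(** The bounds [M] on the gradients come before the function to be cut off, which
    has to be small enough near the boundary to compensate for them. *)
Definition exhausting_cutoffs (eta : nat -> vec -> R) M := forall l,
  [/\ test_function Omega (eta l), forall x, 0 <= eta l x <= 1,
    forall x, inner Omega l.+2%:R^-1 x -> eta l x = 1, 0 <= M l &
    forall i x, `|partial i (eta l) x| <= M l].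

Lemma exhausting_cutoffs_exist : exists eta M, exhausting_cutoffs eta M.
Proof.
have h l : exists p : (vec -> R) * R, [/\ test_function Omega p.1,
    forall x, 0 <= p.1 x <= 1, forall x, inner Omega l.+2%:R^-1 x -> p.1 x = 1, 0 <= p.2 &
    forall i x, `|partial i p.1 x| <= p.2].
  have d0 : 0 < l.+2%:R^-1 :> R by rewrite invr_gt0.
  have [eta [teta eta01 eta1]] := cutoff_exists bOmega d0.
  have : forall i, exists m : R, forall x, `|partial i eta x| <= m.
    by move=> i; have [_ bd _] := test_tame (test_partial i teta).
  move=> /choice[m hm]; exists (eta, \sum_i `|m i|); split => //=.
    by apply: sumr_ge0 => i _.
  move=> i x; apply: le_trans (hm i x) _; apply: le_trans (ler_norm _) _.
  by rewrite (bigD1 i)//= lerDl sumr_ge0.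
by have [p hp] := choice h; exists (fun l => (p l).1), (fun l => (p l).2).
Qed.

Lemma cutoff_partial0 (phi : vec -> R) l i x :
  (forall x', inner Omega l.+2%:R^-1 x' -> phi x' = 1) ->
  inner Omega l.+1%:R^-1 x -> partial i phi x = 0.
Proof.
move=> phi1 xl; rewrite /partial (@near_eq_derive _ _ _ phi (cst 1)) ?derive_cst//.
have d0 : 0 < l.+1%:R^-1 - l.+2%:R^-1 :> R by rewrite subr_gt0 ltf_pV2 ?posrE// ltr_nat.
apply/nbhs_ballP; exists (l.+1%:R^-1 - l.+2%:R^-1) => //= x'; rewrite ball_rVE => x'x.
by apply: phi1; apply: (inner_near xl); exact: ltW.
Qed.

(** The cutoff error [eta l * z - z] lives in the boundary layer off
    [inner Omega l.+1^-1], whose measure vanishes; there the gradient of [eta l],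
    however large, is compensated by the smallness of [z]. *)
Lemma W11_0_boundary_decay eta M z y Z (Y : 'I_n -> vec -> R) (C : R) : 0 <= C ->
  exhausting_cutoffs eta M -> weak_gradient Omega z y ->
  tame Z -> (\forall x \ae mu, Omega x -> z x = Z x) -> (forall i, tame (Y i)) ->
  (forall i, \forall x \ae mu, Omega x -> y x ord0 i = Y i x) -> weak_partials Omega Z Y ->
  (forall i, \forall x \ae mu, `|Y i x| <= C * \1_Omega x) ->
  (forall l, \forall x \ae mu, ~ inner Omega l.+1%:R^-1 x ->
    `|Z x| <= l.+1%:R^-1 / (1 + M l) * \1_Omega x) ->
  W11_0 Omega z.
Proof.
move=> C0 cut wz tZ zZ tY yY wZ YC Zdecay.
apply: (W11_0_cutoff oOmega bOmega wz tZ zZ tY yY wZ) => eps eps0.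
have mO := open_measurable_rV oOmega.
have tO := tame_bounded_set mO bOmega.
have k0 k : 0 < k.+1%:R^-1 :> R by rewrite invr_gt0.
have sub k : inner Omega (k.+1%:R^-1 : R) `<=` Omega by exact: inner_sub.
have tI k := tame_inner (k0 k) bOmega.
pose b l := C * intg (fun x => \1_Omega x - \1_(inner Omega l.+1%:R^-1) x) +
  l.+1%:R^-1 * intg (\1_Omega : vec -> R).
have b0 : b l @[l --> \oo] --> 0.
  rewrite -[X in _ --> X](_ : C * 0 + 0 * intg (\1_Omega : vec -> R) = 0); last by rewrite mulr0 mul0r addr0.
  apply: cvgD; first exact: cvgM (cvg_cst C) (inner_exhausts oOmega bOmega).
  exact: cvgM cvg_harmonic (cvg_cst _).
have e0 : 0 < eps / n.+1%:R by rewrite divr_gt0.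
have [l bl] : exists l, b l < eps / n.+1%:R.
  have /cvgrPdist_lt/(_ _ e0)[l _ /(_ l (leqnn l))/=] := b0.
  by rewrite sub0r normrN => h; exists l; exact: le_lt_trans (ler_norm _) h.
have [tl el01 el1 Ml0 Ml] := cut l.
have cl := test_continuous tl; have cpl i := test_continuous (test_partial i tl).
have tmul (h psi : vec -> R) : tame h -> continuous psi -> tame (fun x => psi x * h x).
  by move=> th cpsi; under eq_fun do rewrite mulrC; exact: tame_mul_continuous.
exists (eta l); split => //.
have M1 : 0 < 1 + M l by rewrite ltr_pwDl.
have l0 : 0 < l.+1%:R^-1 :> R by rewrite invr_gt0.
pose B x : R := C * (\1_Omega x - \1_(inner Omega l.+1%:R^-1) x) + l.+1%:R^-1 * \1_Omega x.
have tB : tame B by apply: tame_add; apply: tame_scale => //; exact: tame_sub.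
have BE : intg B = b l.
  by rewrite /B intgD ?intgZ//; do ?apply: tame_scale => //; exact: tame_sub.
have O01 x : (0 : R) <= \1_Omega x by rewrite indicE ler0n.
have I1 x : inner Omega l.+1%:R^-1 x -> [/\ \1_Omega x = 1 :> R,
    \1_(inner Omega l.+1%:R^-1) x = 1 :> R & eta l x = 1].
  move=> xl; split; first by rewrite indicE mem_set//; exact: (sub l).
  - by rewrite indicE mem_set.
  - by apply: el1; apply: innerS xl; rewrite lef_pV2 ?posrE// ler_nat.
have I0 x : ~ inner Omega l.+1%:R^-1 x -> \1_(inner Omega l.+1%:R^-1) x = 0 :> R.
  by move=> xl; rewrite indicE memNset.
have eB h : tame h -> (\forall x \ae mu, `|h x| <= B x) -> intg (fun x => `|h x|) <= b l.
  by move=> th hB; rewrite -BE; apply: ler_intg_ae => //; exact: tame_norm.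
apply: (@le_trans _ _ (b l + \sum_(i < n) b l)); last first.
  rewrite sumr_const card_ord -mulrS -mulr_natr -ler_pdivlMr//; exact: ltW.
apply: lerD; last apply: ler_sum => i _; apply: eB.
- by apply: tame_sub => //; exact: tmul.
- apply: filterS (Zdecay l) => x hZ.
  have [xl|xl] := pselect (inner Omega l.+1%:R^-1 x).
    have [ Ox1 i1 ->] := I1 x xl; rewrite mul1r subrr normr0 /B Ox1 i1 subrr mulr0 add0r mulr1.
    exact: ltW.
  rewrite /B I0// subr0 -[X in `|X - _|]mul1r -mulrBl normrM ler_wpDl ?mulr_ge0//.
  have e1 : `|1 - eta l x| <= 1 by have /andP[ea eb] := el01 x; rewrite ger0_norm; lra.
  apply: (@le_trans _ _ `|Z x|); first by rewrite -[leRHS]mul1r ler_wpM2r.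
  by apply: le_trans (hZ xl) _; rewrite ler_wpM2r// ler_piMr ?invr_ge0// invf_le1// lerDl.
- by apply: tame_sub => //; apply: tame_add; [exact: tmul|exact: tame_mul_continuous].
- apply: filterS2 (Zdecay l) (YC i) => x hZ hY.
  have [xl|xl] := pselect (inner Omega l.+1%:R^-1 x).
    have [ Ox1 i1 ->] := I1 x xl; rewrite (cutoff_partial0 i el1 xl) mul1r mulr0 addr0 subrr.
    by rewrite normr0 /B Ox1 i1 subrr mulr0 add0r mulr1 ltW.
  rewrite /B I0// subr0 opprD addrA -[X in `|X - _ - _|]mul1r -mulrBl.
  apply: le_trans (ler_normB _ _) _; rewrite !normrM; apply: lerD.
    have e1 : `|1 - eta l x| <= 1 by have /andP[ea eb] := el01 x; rewrite ger0_norm; lra.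
    by apply: le_trans hY; rewrite -[leRHS]mul1r ler_wpM2r.
  apply: (@le_trans _ _ (l.+1%:R^-1 / (1 + M l) * \1_Omega x * M l)).
    by rewrite ler_pM//; exact: hZ.
  rewrite mulrAC ler_wpM2r// -mulrA ler_piMr ?invr_ge0//.
  by rewrite mulrC ler_pdivrMr// mul1r lerDr.
Qed.

End boundary_decay.


(** * Perturbation by functions with prescribed slopes *)

Section slope_perturbation.
Context {R : realType} {n : nat}.
Local Notation mu := (lebesgue_rV R n.+1).
Local Notation vec := 'rV[R]_n.+1.
Variables (Omega : set vec) (r0 : R).
Hypothesis oOmega : open Omega.
Hypothesis bOmega : Omega `<=` [set x | `|x| <= r0].
Implicit Types (u v w : vec -> R) (g D : vec -> vec) (E : seq vec).

Lemma tame_restrict w (L M : R) : 0 <= L -> locally_lipschitz Omega w L ->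
  (forall x, Omega x -> `|w x| <= M) -> tame (w \_ Omega).
Proof.
move=> L0 lip wM; apply: (tame_indic (open_measurable_rV oOmega) bOmega); last by exists M.
apply: continuous_measurable_rV => // x; rewrite inE => Ox.
apply/continuous_epsP => eps eps0.
have [d d0 xd] := inner_open oOmega Ox.
have [j _ /(_ j (leqnn j)) /= jd] := near_infty_natSinv_lt (PosNum d0).
have [tau tau0 htau] := lip j.
have L1 : 0 < L + 1 by rewrite ltr_wpDl.
exists (Num.min tau (eps / (L + 1))); first by rewrite lt_min tau0 divr_gt0.
move=> y; rewrite lt_min => /andP[y1 y2].
have := htau x (y - x) (innerS (ltW jd) xd) y1; rewrite (addrC x) subrK => /le_trans; apply.
rewrite ltr_pdivlMr// in y2; apply: le_trans (ltW y2).
by rewrite mulrC ler_wpM2l// lerDl.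
Qed.

Lemma slope_coord_le E (L : R) e i : 0 < L ->
  slope_bound E L -> e \in E -> `|e ord0 i| <= L.
Proof.
move=> L0 EL eE; rewrite -dotv_delta (le_trans (EL e eE _))//.
by rewrite -[leRHS]mulr1 ler_wpM2l ?norm_delta_mx// ltW.
Qed.

Lemma hull_dir_bounded E (delta L : R) xi i : 0 < L -> 0 < delta ->
  slope_bound E L ->
  hull_dir E delta xi -> `|xi ord0 i| <= L.
Proof.
move=> L0 delta0 EL xiE; rewrite ler_norml.
have [e eE h1] := xiE (delta_mx ord0 i).
have [e' e'E h2] := xiE (- delta_mx ord0 i).
move: h1 h2; rewrite !dotvNr !dotv_delta normrN.
have d0 : 0 <= delta * `|delta_mx ord0 i : vec| by rewrite mulr_ge0// ltW.
have := slope_coord_le i L0 EL eE; have := slope_coord_le i L0 EL e'E; rewrite !ler_norml.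
by move: d0; move: (delta * _) => q d0 /andP[a1 a2] /andP[a3 a4] h1 h2; apply/andP; split; lra.
Qed.

(** The envelope of cones built on the Lipschitz representative of [u], with depths
    adapted to a sequence of cutoffs. *)
Lemma slope_perturbation u g E (delta M : R) : weak_gradient Omega u g ->
  (\forall x \ae mu, Omega x -> `|u x| <= M) -> E != [::] -> 0 < delta ->
  (\forall x \ae mu, Omega x -> hull_dir E delta (g x)) ->
  exists v D, [/\ weak_gradient Omega v D /\ tame v, W11_0 Omega (fun x => v x - u x),
    weak_gradient Omega (fun x => v x - u x) (fun x => D x - g x),
    exists C : R, forall i, \forall x \ae mu, Omega x -> `|D x ord0 i - g x ord0 i| <= C &
    \forall x \ae mu, Omega x -> D x \in E].
Proof.
move=> wug uM E0 delta0 gE.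
have [[mu_ _] locg _] := wug.
have mg i : measurable_fun Omega (fun x => g x ord0 i) by have [] := locg i.
have [L L0 EL] := slopes_bounded E.
have gL i : \forall x \ae mu, Omega x -> `|g x ord0 i| <= L.
  by apply: filterS gE => x gx Ox; exact: (hull_dir_bounded i L0 delta0 EL (gx Ox)).
have [U [tU uU U0]] := tame_representative oOmega bOmega mu_ uM.
have /choice[G hG] := fun i => tame_representative oOmega bOmega (mg i) (gL i).
have tG i : tame (G i) by have [] := hG i.
have gG i : \forall x \ae mu, Omega x -> g x ord0 i = G i x by have [] := hG i.
have G0 i x : ~ Omega x -> G i x = 0 by have [_ _] := hG i; exact.
have wUG := weak_partials_of_gradient oOmega wug tU uU tG gG.
have gGall : \forall x \ae mu, forall i, Omega x -> g x ord0 i = G i x by exact: ae_forall_count.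
have GH : \forall x \ae mu, Omega x -> forall z : vec,
    \sum_i z ord0 i * G i x <= supp_fun E z - delta * `|z|.
  apply: filterS2 gGall gE => x gGx gEx Ox z; have [e eE h] := gEx Ox z.
  rewrite lerBrDr; apply: le_trans (supp_fun_ge z eE); apply: le_trans h.
  rewrite lerD2r /dotv le_eqVlt; apply/orP; left; apply/eqP.
  by apply: eq_bigr => i _; rewrite mulrC gGx.
have [V [UV [MV hMV] VH]] := lipschitz_representative tU tG wUG GH.
have [eta [Mc cut]] := exhausting_cutoffs_exist bOmega.
pose kappa l := l.+1%:R^-1 / (1 + Mc l).
have kappa0 l : 0 < kappa l.
  by have [_ _ _ Ml _] := cut l; rewrite divr_gt0 ?invr_gt0// ltr_pwDl.
have [w [w1 w2 w3 w4]] := perturbation_exists oOmega bOmega E0 delta0 L0 EL VH kappa0.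
have [D [tD D0 hD]] := slope_field oOmega bOmega w4.
have wM x : Omega x -> `|w x| <= MV + kappa 0.
  move=> Ox; have /andP[a b] := w1 x Ox; have := hMV x; have := kappa0 0%N.
  rewrite !ler_norml => ? /andP[c d]; apply/andP; split; lra.
have tW := tame_restrict (ltW L0) w3 wM.
have Ww x : Omega x -> (w \_ Omega) x = w x by move=> Ox; rewrite patchE mem_set.
have W0 x : ~ Omega x -> (w \_ Omega) x = 0 by move=> Ox; rewrite patchE memNset.
have aff : \forall x \ae mu, Omega x -> affine_near w x (D x).
  by apply: filterS hD => x h /h[].
have wWD := weak_partials_affine oOmega tW Ww tD (ltW L0) w3 aff.
have wZ := weak_partials_sub tW tU tD tG wWD wUG.
have mW : measurable_fun Omega (w \_ Omega).
  by have [m _ _] := tW; exact: measurable_funS m.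
have mD i : measurable_fun Omega (fun x => D x ord0 i).
  by have [m _ _] := tD i; exact: measurable_funS m.
have tZ := tame_sub tW tU; have tY i := tame_sub (tD i) (tG i).
have zZ : \forall x \ae mu, Omega x -> (w \_ Omega) x - u x = (w \_ Omega) x - U x.
  by apply: filterS uU => x h /h ->.
have yY i : \forall x \ae mu, Omega x -> (D x - g x) ord0 i = D x ord0 i - G i x.
  by apply: filterS (gG i) => x h /h; rewrite !mxE => ->.
have wz : weak_gradient Omega (fun x => (w \_ Omega) x - u x) (fun x => D x - g x).
  apply: (weak_gradient_tame oOmega _ tZ zZ _ tY yY wZ); first exact: measurable_funB.
  by move=> i; under eq_fun do rewrite !mxE; exact: measurable_funB.
have DL i : \forall x \ae mu, Omega x -> `|D x ord0 i| <= L.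
  by apply: filterS hD => x h /h[/(slope_coord_le i L0 EL)].
exists (w \_ Omega), D; split => //.
- split => //; apply: (weak_gradient_tame oOmega mW tW _ mD tD _ wWD); first exact: aeW.
  by move=> i; exact: aeW.
- apply: (W11_0_boundary_decay oOmega bOmega (C := L + L) _ cut wz tZ zZ tY yY wZ).
  + by rewrite addr_ge0// ltW.
  + move=> i; apply: filterS3 (DL i) (gL i) (gG i) => x h1 h2 h3.
    have [Ox|Ox] := pselect (Omega x); last first.
      by rewrite D0// G0// mxE subrr normr0 indicE memNset// mulr0.
    rewrite indicE mem_set// mulr1 -h3// (le_trans (ler_normB _ _))// lerD//; [exact: h1|exact: h2].
  + move=> l; apply: filterS UV => x UVx xl.
    have [Ox|Ox] := pselect (Omega x); last first.
      by rewrite W0// U0// subrr normr0 indicE memNset// mulr0.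
    rewrite indicE mem_set// mulr1 Ww// UVx -/(kappa l) ler_norml.
    have := w2 l x Ox xl; have /andP[_] := w1 x Ox; have := kappa0 l.
    by move=> ? ? ?; apply/andP; split; lra.
- exists (L + L) => i; apply: filterS2 (DL i) (gL i) => x h1 h2 Ox.
  by rewrite (le_trans (ler_normB _ _))// lerD// ?h1 ?h2.
- by apply: filterS hD => x h /h[].
Qed.

End slope_perturbation.


(** * Relaxation *)

Section relaxation.
Context {R : realType} {n : nat}.
Local Notation mu := (lebesgue_rV R n.+1).
Local Notation vec := 'rV[R]_n.+1.
Variables (Omega : set vec) (r0 : R) (f : vec -> R) (gamma : R -> R).
Hypothesis oOmega : open Omega.
Hypothesis bOmega : Omega `<=` [set x | `|x| <= r0].
Hypothesis Omega0 : Omega !=set0.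
Hypothesis cf : continuous f.
Hypothesis gammaoo : gamma t @[t --> +oo] --> +oo.
Hypothesis fgamma : forall xi, gamma (enorm xi) <= f xi.
Implicit Types (u v w : vec -> R) (g D : vec -> vec) (E : seq vec).

Lemma ae_exists (P : vec -> Prop) : (\forall x \ae mu, Omega x -> P x) -> exists x, P x.
Proof.
move=> PO; have [x0 Ox0] := Omega0.
have [d d0 xd] := inner_open oOmega Ox0.
by have [y [/xd Oy /(_ Oy) Py]] := ae_meets_ball x0 d0 PO; exists y.
Qed.

Lemma ae_le_ess_sup_on (h : vec -> \bar R) :
  \forall x \ae mu, Omega x -> (h x <= ess_sup_on Omega h)%E.
Proof. exact/ess_sup_on_leP. Qed.

Lemma W1oo_0_ess_bounded u u0 : W1oo Omega u0 -> W1oo_0 Omega (fun x => u x - u0 x) ->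
  exists M : R, \forall x \ae mu, Omega x -> `|u x| <= M.
Proof.
move=> [/ess_boundedP[_ [M0 hM0]] _] [_ [/ess_boundedP[_ [M hM]] _]].
exists (M + M0); apply: filterS2 hM hM0 => x h1 h2 Ox.
by rewrite -[u x](subrK (u0 x)) (le_trans (ler_normD _ _))// lerD ?h1 ?h2.
Qed.

(** An intermediate level [m'] is needed: the sublevel set of the envelope at [m] is
    in the hull obtained from the sublevel set of [f] at any higher level. *)
Lemma relaxed_competitor u0 u g (m c : R) : W1oo Omega u0 ->
  W1oo_0 Omega (fun x => u x - u0 x) -> weak_gradient Omega u g ->
  (\forall x \ae mu, Omega x -> (lslc_envelope f (g x) <= m%:E)%E) -> m < c ->
  exists v D, [/\ W1oo_0 Omega (fun x => v x - u0 x), weak_gradient Omega v D &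
    (ess_sup_on Omega (EFin \o f \o D) <= c%:E)%E].
Proof.
move=> Wu0 Wu wug gm mc; pose m' := (m + c) / 2.
have mm' : m < m' by rewrite /m'; lra.
have m'c : m' < c by rewrite /m'; lra.
have [E [delta [delta0 Ec fE]]] := sublevel_hull_dir cf gammaoo fgamma m'c.
have gE : \forall x \ae mu, Omega x -> hull_dir E delta (g x).
  apply: filterS gm => x h /h gx; apply: (lslc_hull_dir fE).
  by rewrite (le_lt_trans gx)// lte_fin.
have E0 : E != [::].
  by have [x gx] := ae_exists gE; have [e eE _] := gx 0; case: (E) eE.
have [M uM] := W1oo_0_ess_bounded Wu0 Wu.
have [v [D [[wvD tv] W11 wdiff [C hC] DE]]] :=
  slope_perturbation oOmega bOmega wug uM E0 delta0 gE.
have [W11u [bu [g2 [wg2 bg2]]]] := Wu.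
have [bu0 _] := Wu0.
have vE : (fun x => v x - u0 x) = (fun x => (v x - u x) + (u x - u0 x)).
  by apply/funext => x; rewrite subrKA.
exists v, D; split => //; last first.
  by apply/ess_sup_on_leP; apply: filterS DE => x h /h /Ec; rewrite lee_fin.
split; first by rewrite vE; exact: W11_0_add.
split.
  move/ess_boundedP : bu0 => [mu0 [M0 hM0]].
  have [mv [Mv hMv] _] := tv.
  apply/ess_boundedP; split; first by apply: measurable_funB => //; exact: measurable_funS mv.
  exists (Mv + M0); apply: filterS hM0 => x h Ox.
  by rewrite (le_trans (ler_normB _ _))// lerD ?h.
exists (fun x => (D x - g x) + g2 x); split; first by rewrite vE; exact: weak_gradient_add.
move=> i; have /ess_boundedP[mg2 [M2 hM2]] := bg2 i.
have [_ /(_ i)[md _] _] := wdiff.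
apply/ess_boundedP; split.
  by under eq_fun do rewrite mxE; exact: measurable_funD.
exists (C + M2); apply: filterS2 (hC i) hM2 => x h1 h2 Ox.
by rewrite !mxE (le_trans (ler_normD _ _))// lerD ?h1 ?h2.
Qed.

Lemma le_of_real_bounds (s t : \bar R) :
  (forall m c : R, (s <= m%:E)%E -> m < c -> (t <= c%:E)%E) -> (t <= s)%E.
Proof.
case: s => [m| |] h; last 2 first.
- exact: leey.
- case: t h => [t| |] h //; last by have := h 0 1 (leNye _) ltr01.
  have t12 : t - 2 < t - 1 by lra.
  by have := h _ _ (leNye _) t12; rewrite lee_fin lerDl oppr_ge0 ler10.
- by apply/lee_addgt0Pr => e e0; rewrite -EFinD; apply: (h m) => //; rewrite ltrDl.
Qed.

Lemma inf_sup_relaxation u0 : W1oo Omega u0 ->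
  inf_sup_problem Omega (EFin \o f) u0 = inf_sup_problem Omega (lslc_envelope f) u0.
Proof.
move=> Wu0; apply/eqP; rewrite eq_le; apply/andP; split.
- apply: le_ereal_inf_tmp => _ [u [g [Wu wug ->]]]; apply: le_of_real_bounds => m c um mc.
  have gm : \forall x \ae mu, Omega x -> (lslc_envelope f (g x) <= m%:E)%E.
    by apply/ess_sup_on_leP.
  have [v [D [Wv wvD Dc]]] := relaxed_competitor Wu0 Wu wug gm mc.
  by apply: le_trans Dc; apply: ereal_inf_lbound; exists v, D.
- apply: le_ereal_inf_tmp => _ [u [g [Wu wug ->]]].
  apply: (@le_trans _ _ (ess_sup_on Omega (lslc_envelope f \o g))).
    by apply: ereal_inf_lbound; exists u, g.
  apply/ess_sup_on_leP; apply: filterS (ae_le_ess_sup_on (EFin \o f \o g)) => x h /h.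
  by apply: le_trans; exact: lslc_le.
Qed.

End relaxation.


(** * Affine boundary data *)

Section affine_data.
Context {R : realType} {n : nat}.
Local Notation mu := (lebesgue_rV R n.+1).
Local Notation vec := 'rV[R]_n.+1.
Variables (Omega : set vec) (r0 : R).
Hypothesis oOmega : open Omega.
Hypothesis bOmega : Omega `<=` [set x | `|x| <= r0].
Implicit Types (u v w : vec -> R) (g D : vec -> vec) (E : seq vec).

Let mOmega : measurable Omega. Proof. exact: open_measurable_rV. Qed.

Lemma weak_gradient_affine u xi (c : R) : measurable_fun Omega u ->
  (\forall x \ae mu, Omega x -> u x = dotv xi x + c) -> weak_gradient Omega u (fun=> xi).
Proof.
move=> mu_ uE; pose w x := dotv xi x + c.
have [L L0 EL] := slopes_bounded [:: xi].
have xiL z : `|dotv xi z| <= L * `|z| by apply: EL; rewrite mem_head.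
have lip : locally_lipschitz Omega w L.
  move=> j; exists 1 => // x h _ _; rewrite /w dotvDr (_ : _ - _ = dotv xi h)//; lra.
have wM x : Omega x -> `|w x| <= L * r0 + `|c|.
  move=> /bOmega /= xr; rewrite (le_trans (ler_normD _ _))// lerD2r.
  by rewrite (le_trans (xiL x))// ler_wpM2l// ltW.
have tW := tame_restrict oOmega bOmega (ltW L0) lip wM.
have Ww x : Omega x -> (w \_ Omega) x = w x by move=> Ox; rewrite patchE mem_set.
pose D x : vec := \1_Omega x *: xi.
have tD i : tame (fun x => D x ord0 i).
  rewrite (_ : (fun _ => _) = (fun x => xi ord0 i * \1_Omega x)); last first.
    by apply/funext => x; rewrite mxE mulrC.
  by apply: tame_scale; exact: tame_bounded_set mOmega bOmega.
have DE x : Omega x -> D x = xi by move=> Ox; rewrite /D indicE mem_set// scale1r.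
have aff : \forall x \ae mu, Omega x -> affine_near w x (D x).
  by apply: aeW => x Ox; exists 1 => // y _; rewrite DE// /w dotvBr; lra.
apply: (weak_gradient_tame oOmega mu_ tW _ _ tD _ (weak_partials_affine oOmega tW Ww tD (ltW L0) lip aff)).
- by apply: filterS uE => x h Ox; rewrite Ww// h.
- by move=> i; exact: measurable_cst.
- by move=> i; apply: aeW => x Ox; rewrite DE.
Qed.

Lemma weak_gradient_cst (c : R) : weak_gradient Omega (fun=> c) (fun=> 0).
Proof.
apply: (@weak_gradient_affine _ _ c); first exact: measurable_cst.
by apply: aeW => x _; rewrite dotvC dotv0r add0r.
Qed.

Lemma ess_bounded_cst (c : R) : ess_bounded Omega (fun=> c).
Proof. by apply/ess_boundedP; split; [exact: measurable_cst|exists `|c|; exact: aeW]. Qed.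

Lemma W1oo_0_zero : W1oo_0 Omega (fun=> 0).
Proof.
have w0 := weak_gradient_cst 0; have t0 := @tame0 R n.+1.
split; last first.
  split; first exact: ess_bounded_cst.
  by exists (fun=> 0); split => // i; under eq_fun do rewrite mxE; exact: ess_bounded_cst.
have aeg (i : 'I_n.+1) : \forall x \ae mu, Omega x -> (0 : vec) ord0 i = (fun=> 0) x.
  by apply: aeW => x _; rewrite mxE.
have ae0 : \forall x \ae mu, Omega x -> (0 : R) = (fun=> 0) x by exact: aeW.
apply: (W11_0_cutoff oOmega bOmega w0 t0 ae0 (fun=> t0) aeg).
  exact: (weak_partials_of_gradient oOmega w0 t0 ae0 (fun=> t0) aeg).
move=> eps eps0; exists (fun=> 0); split; first exact: test0.
have i0 : intg (fun=> 0 : R) = 0 := @intg0 R n.+1.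
under eq_fun do rewrite mul0r subrr normr0.
rewrite i0 add0r big1 ?ltW// => i _.
by under eq_fun do rewrite !mul0r addr0 subrr normr0.
Qed.

Lemma inf_sup_affine_le u0 xi0 (c : R) F : W1oo Omega u0 ->
  (\forall x \ae mu, Omega x -> u0 x = dotv xi0 x + c) ->
  (inf_sup_problem Omega F u0 <= F xi0)%E.
Proof.
move=> [/ess_boundedP[mu0 _] _] u0E.
apply: (@le_trans _ _ (ess_sup_on Omega (F \o (fun=> xi0)))).
  apply: ereal_inf_lbound; exists u0, (fun=> xi0); split => //.
    by under eq_fun do rewrite subrr; exact: W1oo_0_zero.
  exact: weak_gradient_affine u0E.
by apply/ess_sup_on_leP; exact: aeW.
Qed.

Lemma intg_partial_test phi i : test_function Omega phi -> intg (partial i phi) = 0.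
Proof.
move=> tphi; have tO := tame_bounded_set mOmega bOmega.
have ae1 : \forall x \ae mu, Omega x -> (1 : R) = \1_Omega x.
  by apply: aeW => x Ox; rewrite indicE mem_set.
have aeg (j : 'I_n.+1) : \forall x \ae mu, Omega x -> (0 : vec) ord0 j = (fun=> 0) x.
  by apply: aeW => x _; rewrite mxE.
have := weak_partials_of_gradient oOmega (weak_gradient_cst 1) tO ae1 (fun=> @tame0 R n.+1) aeg i tphi.
rewrite [X in _ = - X](_ : _ = 0); last first.
  by under eq_fun do rewrite mul0r; exact: intg0.
rewrite oppr0 => <-; congr intg; apply/funext => x.
have [Ox|Ox] := pselect (Omega x); first by rewrite indicE mem_set// mul1r.
by rewrite indicE memNset// mul0r; exact: (test_out (test_partial i tphi)).
Qed.

(** Up to a small error, a function of [W11_0] has a gradient of mean zero: this is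
    exact for the test functions that approximate it. *)
Lemma W11_0_mean_zero z Z (H : 'I_n.+1 -> vec -> R) (eps d : R) :
  W11_0 Omega z -> tame Z -> (\forall x \ae mu, Omega x -> z x = Z x) ->
  (forall i, tame (H i)) -> weak_partials Omega Z H -> 0 < eps -> 0 < d ->
  exists eta, [/\ test_function Omega eta, forall x, 0 <= eta x <= 1,
    forall x, inner Omega d x -> eta x = 1 &
    forall i, `|intg (fun x => H i x * eta x)| <= eps].
Proof.
move=> [g [wg _ ig gapp]] tZ zZ tH wZ eps0 d0.
have [phi [tphi phieps]] := gapp _ eps0.
have [sphi cphi phiO] := tphi.
have [d1 d10 Kd1] := compact_inner oOmega cphi phiO.
have d20 : 0 < Num.min d d1 by rewrite lt_min d0.
have [eta [teta eta01 eta1]] := cutoff_exists bOmega d20.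
exists eta; split => //.
  by move=> x xd; apply: eta1; apply: innerS xd; rewrite ge_min lexx.
move=> i; have [[mz _] locg wg3] := wg.
have tpphi := test_partial i tphi.
have tp := test_tame tpphi.
have gE : (\int[mu]_(x in Omega) (g x ord0 i * eta x)%:E = (intg (fun x => H i x * eta x))%:E)%E.
  apply: oppe_inj; rewrite -wg3// (integral_test oOmega mz tZ zZ); last exact: test_partial.
  by rewrite wZ.
have pE : (\int[mu]_(x in Omega) (partial i phi x * eta x)%:E = 0)%E.
  rewrite (integral_test oOmega _ tp _ teta).
  + rewrite (_ : intg _ = 0)// -[RHS](intg_partial_test i tphi); congr intg; apply/funext => x.
    have [->|px] := eqVneq (partial i phi x) 0; first by rewrite mul0r.
    rewrite eta1 ?mulr1//; apply: (@innerS _ _ _ _ d1); first by rewrite ge_min lexx orbT.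
    by apply: Kd1; apply: contrapT => /(partial_support_out i) px0; rewrite px0 eqxx in px.
  + by have [m _ _] := tp; exact: measurable_funS m.
  + exact: aeW.
have locp : loc_integrable Omega (partial i phi).
  apply: (loc_integrable_tame oOmega _ tp); last exact: aeW.
  by have [m _ _] := tp; exact: measurable_funS m.
have dE : (\int[mu]_(x in Omega) ((g x ord0 i - partial i phi x) * eta x)%:E =
    (intg (fun x => H i x * eta x))%:E)%E.
  under eq_integral do rewrite mulrBl EFinB.
  by rewrite integralB//; [rewrite gE pE sube0|exact: loc_integrable_test|exact: loc_integrable_test].
have mgp j : measurable_fun Omega (fun x => (g x - gradient phi x) ord0 j).
  under eq_fun do rewrite !mxE; apply: measurable_funB; first by have [] := locg j.
  by have [m _ _] := test_tame (test_partial j tphi); exact: measurable_funS m.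
have meta : measurable_fun Omega eta by have [m _ _] := test_tame teta; exact: measurable_funS m.
have md : measurable_fun Omega (fun x => (g x ord0 i - partial i phi x) * eta x).
  by apply: measurable_funM => //; have := mgp i; under eq_fun do rewrite !mxE.
rewrite -lee_fin -abse_EFin -dE; apply: le_trans (le_abse_integral _ _ _) _ => //.
  exact/measurable_EFinP.
apply: le_trans (ltW phieps); apply: le_trans (leeDr _ _); last by apply: integral_ge0.
apply: ge0_le_integral => //.
- by apply/measurable_EFinP; exact: measurableT_comp.
- by apply/measurable_EFinP; exact: measurable_enorm.
- move=> x _; rewrite lee_fin normrM.
  apply: (@le_trans _ _ `|g x ord0 i - partial i phi x|).
    by rewrite -[leRHS]mulr1 ler_wpM2l// ger0_norm; have /andP[] := eta01 x.
  apply: le_trans (le_norm_enorm _).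
  by have := rV_norm_coord (g x - gradient phi x) i; rewrite !mxE.
Qed.

End affine_data.


(** * Lower bound for affine boundary data *)

Section affine_lower_bound.
Context {R : realType} {n : nat}.
Local Notation mu := (lebesgue_rV R n.+1).
Local Notation vec := 'rV[R]_n.+1.
Variables (Omega : set vec) (r0 : R).
Hypothesis oOmega : open Omega.
Hypothesis bOmega : Omega `<=` [set x | `|x| <= r0].
Hypothesis Omega0 : Omega !=set0.
Implicit Types (u v w : vec -> R) (g h D : vec -> vec) (E : seq vec).

(** Jensen's inequality for the closed convex set [S]: a hyperplane strictly separating
    [xi] from [S] would keep the mean of the gradient [h] away from zero. *)
Lemma W11_0_convex_mean z Z h (H : 'I_n.+1 -> vec -> R) (S : set vec) xi :
  W11_0 Omega z -> tame Z -> (\forall x \ae mu, Omega x -> z x = Z x) ->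
  (forall i, tame (H i)) -> (forall i, \forall x \ae mu, Omega x -> h x ord0 i = H i x) ->
  weak_partials Omega Z H -> closed S -> convex_set S ->
  (\forall x \ae mu, Omega x -> S (xi + h x)) -> S xi.
Proof.
move=> W11z tZ zZ tH hH wZ clS cvS hS; apply: contrapT => nS.
have S0 : S !=set0 by have [x Sx] := ae_exists oOmega Omega0 hS; exists (xi + h x).
have [p [a [Sp ap]]] := separation clS cvS S0 nS.
have [x0 Ox0] := Omega0; have [d d0 xd] := inner_open oOmega Ox0.
have d20 : 0 < d / 2 by rewrite divr_gt0.
pose B : set vec := ball x0 (d / 2).
have BO : B `<=` inner Omega (d / 2).
  move=> y; rewrite /B ball_rVE => yx; apply: (inner_near xd); lra.
have Br : B `<=` [set x | `|x| <= r0].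
  by apply: (subset_trans BO); apply: subset_trans bOmega; exact: inner_sub.
have mB : measurable B by exact: measurable_ball_rV.
have tB := tame_bounded_set mB Br.
have q0 : 0 < intg (\1_B : vec -> R).
  by rewrite -lte_fin -intgE// integral_indic// setIT; exact: lebesgue_rV_ball_gt0.
set q := intg _ in q0.
pose K := \sum_i `|p ord0 i| + 1; have K0 : 0 < K by rewrite ltr_wpDl ?sumr_ge0.
pose theta := dotv xi p - a; have theta0 : 0 < theta by rewrite subr_gt0.
have eps0 : 0 < theta * q / (2 * K) by rewrite divr_gt0 ?mulr_gt0.
have [eta [teta eta01 eta1 Heta]] := W11_0_mean_zero oOmega bOmega W11z tZ zZ tH wZ eps0 d20.
have tHe i : tame (fun x => H i x * eta x).
  by apply: tame_mul_continuous => //; exact: test_continuous teta.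
have te := test_tame teta.
have tpH i : tame (fun x => - p ord0 i * (H i x * eta x)) by exact: tame_scale.
have hHall : \forall x \ae mu, forall i, Omega x -> h x ord0 i = H i x by exact: ae_forall_count.
have lower : theta * q <= intg (fun x => theta * eta x).
  rewrite intgZ// ler_wpM2l ?(ltW theta0)//; apply: ler_intg => // x.
  have [xB|xB] := boolP (x \in B); rewrite indicE.
    by rewrite xB eta1//; apply: BO; exact: set_mem.
  by rewrite (negbTE xB); have /andP[] := eta01 x.
have upper : intg (fun x => theta * eta x) <=
    intg (fun x => \sum_i - p ord0 i * (H i x * eta x)).
  apply: ler_intg_ae; [exact: tame_scale|exact: tame_sum|].
  apply: filterS2 hHall hS => x hHx hSx.
  have [Ox|Ox] := pselect (Omega x); last first.
    by rewrite (test_out teta Ox) mulr0 big1// => i _; rewrite !mulr0.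
  rewrite (_ : \sum_i _ = - dotv (h x) p * eta x); last first.
    rewrite /dotv mulNr mulr_suml -sumrN; apply: eq_bigr => i _.
    by rewrite hHx// mulNr mulrA (mulrC (p _ _)).
  rewrite ler_wpM2r//; first by have /andP[] := eta01 x.
  by have := Sp _ (hSx Ox); rewrite dotvDl /theta; lra.
have := le_trans lower upper; rewrite intg_sum// leNgt => /negP; apply.
apply: (@le_lt_trans _ _ (K * (theta * q / (2 * K)))); last first.
  rewrite (_ : K * _ = theta * q / 2); last by field; rewrite gt_eqF.
  by have := mulr_gt0 theta0 q0; lra.
apply: (@le_trans _ _ ((\sum_i `|p ord0 i|) * (theta * q / (2 * K)))); last first.
  by rewrite ler_wpM2r ?(ltW eps0)// lerDl.
rewrite mulr_suml; apply: ler_sum => i _.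
rewrite intgZ// (le_trans (ler_norm _))// normrM normrN ler_wpM2l//.
Qed.

Variables (f : vec -> R) (gamma : R -> R).
Hypothesis cf : continuous f.
Hypothesis gammaoo : gamma t @[t --> +oo] --> +oo.
Hypothesis fgamma : forall xi, gamma (enorm xi) <= f xi.

Lemma inf_sup_affine_ge u0 xi0 (c0 : R) : W1oo Omega u0 ->
  (\forall x \ae mu, Omega x -> u0 x = dotv xi0 x + c0) ->
  (lslc_envelope f xi0 <= inf_sup_problem Omega (lslc_envelope f) u0)%E.
Proof.
move=> Wu0 u0E; apply: le_ereal_inf_tmp => _ [u [g [Wu wug ->]]].
apply: le_of_real_bounds => m c /ess_sup_on_leP gm mc.
have [/ess_boundedP[mu0 _] _] := Wu0.
have [W11u [/ess_boundedP[muu [M uM]] _]] := Wu.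
pose m' := (m + c) / 2.
have mm' : m < m' by rewrite /m'; lra.
have m'c : m' < c by rewrite /m'; lra.
have [E [delta [delta0 Ec fE]]] := sublevel_hull_dir cf gammaoo fgamma m'c.
have [L L0 EL] := slopes_bounded E.
have gL i : \forall x \ae mu, Omega x -> `|g x ord0 i| <= L.
  apply: filterS gm => x h /h gx; apply: (hull_dir_bounded i L0 delta0 EL).
  by apply: (lslc_hull_dir fE); rewrite (le_lt_trans gx)// lte_fin.
have wneg : weak_gradient Omega (fun x => - u0 x) (fun=> - xi0).
  apply: (@weak_gradient_affine _ _ _ _ oOmega bOmega _ _ (- c0)).
    exact: measurableT_comp.
  by apply: filterS u0E => x h Ox; rewrite h// (dotvC (- xi0)) dotvNr (dotvC x) opprD.
have wz := weak_gradient_add oOmega wug wneg.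
have [Z [tZ zZ _]] := tame_representative oOmega bOmega muu uM.
have /choice[H hH] : forall i, exists Hi, [/\ tame Hi,
    \forall x \ae mu, Omega x -> (g x + - xi0) ord0 i = Hi x & forall x, ~ Omega x -> Hi x = 0].
  move=> i; have [_ /(_ i)[mgi _] _] := wz.
  apply: (tame_representative oOmega bOmega mgi (M := L + `|xi0 ord0 i|)).
  apply: filterS (gL i) => x h Ox; rewrite !mxE (le_trans (ler_normB _ _))//.
  by rewrite lerD2r h.
have tH i : tame (H i) by have [] := hH i.
have gH i : \forall x \ae mu, Omega x -> (g x + - xi0) ord0 i = H i x by have [] := hH i.
have wZ := weak_partials_of_gradient oOmega wz tZ zZ tH gH.
apply: (@le_trans _ _ m%:E); last by rewrite lee_fin ltW.
apply: (@W11_0_convex_mean _ Z _ H (sublevel (lslc_envelope f) m) xi0 W11u tZ zZ tH gH wZ).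
- exact: lslc_sublevel_closed.
- exact: lslc_sublevel_convex.
- by apply: filterS gm => x h /h; rewrite /sublevel/= addrC subrK.
Qed.

End affine_lower_bound.

Theorem corollary3p5 (R : realType) (n : nat) (Omega : set 'rV[R]_n.+1)
    (f : 'rV[R]_n.+1 -> R) (gamma : R -> R) (u0 : 'rV[R]_n.+1 -> R)
    (Omega_neq0 : Omega !=set0) (Omega_open : open Omega)
    (Omega_bounded : bounded_set Omega)
    (Omega_lipschitz : lipschitz_boundary Omega)
    (f_continuous : continuous f)
    (gamma_ge0 : forall t, 0 <= t -> 0 <= gamma t)
    (gamma_continuous : {within [set t | 0 <= t], continuous gamma})
    (gamma_increasing : forall s t, 0 <= s -> s <= t -> gamma s <= gamma t)
    (gamma_cvg : gamma t @[t --> +oo] --> +oo)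
    (f_coercive : forall xi, gamma (enorm xi) <= f xi)
    (u0_W1oo : W1oo Omega u0) :
  inf_sup_problem Omega (EFin \o f) u0 =
    inf_sup_problem Omega (lslc_envelope f) u0 /\
  (forall (xi0 : 'rV[R]_n.+1) (c : R),
    (\forall x \ae lebesgue_rV R n.+1, Omega x -> u0 x = dotv xi0 x + c) ->
    inf_sup_problem Omega (EFin \o f) u0 = lslc_envelope f xi0).
Proof.
have [r0 bO] : exists r0 : R, Omega `<=` [set x | `|x| <= r0].
  by have [M [_ /(_ (M + 1))h]] := Omega_bounded; exists (M + 1) => x; apply: h; rewrite ltrDl.
have relax := inf_sup_relaxation Omega_open bO Omega_neq0 f_continuous gamma_cvg f_coercive u0_W1oo.
split => // xi0 c u0E; rewrite relax; apply/eqP; rewrite eq_le; apply/andP; split.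
  exact: (inf_sup_affine_le Omega_open bO _ u0_W1oo u0E).
exact: (inf_sup_affine_ge Omega_open bO Omega_neq0 f_continuous gamma_cvg f_coercive u0_W1oo u0E).
Qed.
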